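(* Let $d\geqslant1$, let $P_1,P_0\in\mathbb{C}^{d\times d}$ with $P_1^{\star}=P_1$ invertible and $P_0^{\star}=-P_0$, and let $\mathcal{H}\colon[0,\infty)\to\mathbb{C}^{d\times d}$ be measurable, Hermitian almost everywhere, bounded, and such that for every bounded $K\subset[0,\infty)$ there are $m,M>0$ with $m|\zeta|^2\leqslant\zeta^{\star}\mathcal{H}(\xi)\zeta\leqslant M|\zeta|^2$ for all $\zeta\in\mathbb{C}^d$ and a.e. $\xi\in K$. Let $A$ be the operator in $X=L^2_{\mathcal{H}}(0,\infty)$ given by $Ax=P_1(\mathcal{H}x)'+P_0\mathcal{H}x$, $D(A)=\{x\in X:(\mathcal{H}x)'\in X,\ (\mathcal{H}x)(0)=0\}$. Let $S\in\mathbb{C}^{d\times d}$ be unitary with $P_1=S^{\star}\operatorname{diag}(\Lambda,-\Theta)S$, $\Lambda=\operatorname{diag}(\lambda_1,\dots,\lambda_{n_+})$, $\Theta=\operatorname{diag}(\theta_1,\dots,\theta_{n_-})$, $\lambda_k,\theta_j>0$. Let $\mathcal{G}_1=\mathbb{C}^{n_+}$ with scalar product $\langle\cdot,\Lambda\,\cdot\rangle$, $\mathcal{G}_2=\mathbb{C}^{n_-}$ with scalar product $\langle\cdot,\Theta\,\cdot\rangle$, let $\Omega$ be the standard symmetric form on $X\oplus X$, $\omega$ the standard unitary form on $\mathcal{G}_1\oplus\mathcal{G}_2$, and $$F\colon\operatorname{Graph}(A^{\star})\to\mathcal{G}_1\oplus\mathcal{G}_2,\qquad(x,A^{\star}x)\mapsto\bigl(\operatorname{pr}_+(S\mathcal{H}x)(0),\operatorname{pr}_-(S\mathcal{H}x)(0)\bigr).$$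 Then $(\Omega,\mathcal{G}_1,\mathcal{G}_2,F,\omega)$ is a boundary system for $A$.
   Context: All functions are $\mathbb{C}^d$-valued. $L^2_{\mathcal{H}}(0,\infty)=\{x\in L^2_{\mathrm{loc}}[0,\infty):\int_0^\infty x^{\star}\mathcal{H}x<\infty\}$ with scalar product $\int_0^\infty x^{\star}\mathcal{H}y$; derivatives are distributional. The operator $A$ is densely defined, closed and skew-symmetric, with $A^{\star}x=-P_1(\mathcal{H}x)'-P_0\mathcal{H}x$ and $D(A^{\star})=\{x\in X:(\mathcal{H}x)'\in X\}$. $\operatorname{pr}_+$ and $\operatorname{pr}_-$ are the projections of $\mathbb{C}^d$ onto the first $n_+$ and last $n_-$ coordinates; $\mathbb{C}^0=\{0\}$. Standard symmetric form: $\Omega((x,y),(u,v))=\langle x,v\rangle_X+\langle y,u\rangle_X$. Standard unitary form: $\omega((x,y),(u,v))=\langle x,u\rangle_{\mathcal{G}_1}-\langle y,v\rangle_{\mathcal{G}_2}$. A boundary system for a densely defined, closed, skew-symmetric operator $A$ in $X$ is a quintuple $(\Omega,\mathcal{G}_1,\mathcal{G}_2,F,\omega)$ of Hilbert spaces $\mathcal{G}_1,\mathcal{G}_2$, sesquilinear forms $\Omega$ on $X\oplus X$ and $\omega$ on $\mathcal{G}_1\oplus\mathcal{G}_2$, and a linear surjection $F\colon\operatorname{Graph}(A^{\star})\to\mathcal{G}_1\oplus\mathcal{G}_2$ with $\Omega((x,A^{\star}x),(y,A^{\star}y))=\omega(F(x,A^{\star}x),F(y,A^{\star}y))$ for all $x,y\in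 D(A^{\star})$.
   Formalization: It is assumed that A maps D(A) into X, i.e. P_1(Hx)'+P_0Hx lies in X for every x in D(A); this can fail under the stated hypotheses (e.g. P_1 swapping two coordinates, H=diag(1,e^{-t})), and then A is not an operator in X. *)

(* Defs.v *)
From HB Require Import structures.
From mathcomp Require Import all_boot all_order all_algebra.
From mathcomp Require Import complex.
From mathcomp Require Import all_classical all_reals all_analysis.
From mathcomp Require Import measurable_realfun ring lra.
Local Open Scope quotient_scope.
Set Implicit Arguments.
Unset Strict Implicit.
Unset Printing Implicit Defensive.
Import Order.TTheory GRing.Theory Num.Theory.
Import numFieldNormedType.Exports.
Local Open Scope classical_set_scope.
Local Open Scope ring_scope.
Local Open Scope complex_scope.
Local Open Scope sesquilinear_scope.

(* Scalar products are antilinear in the first and linear in the second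
   argument, as in <x, y> = x^* y. *)

Section AbstractTheory.
Variable R : realType.
Local Notation C := R[i].

Definition sesquilinear_form (V : lmodType C) (b : V -> V -> C) : Prop :=
  (forall (a : C) (u v w : V), b (a *: u + v) w = a^* * b u w + b v w) /\
  (forall (a : C) (u v w : V), b w (a *: u + v) = a * b w u + b w v).

(* In the order of R[i], 0 < z entails that z is real. *)
Record scalar_product (V : lmodType C) (ip : V -> V -> C) : Prop := {
  sp_sesquilinear : sesquilinear_form ip ;
  sp_hermitian : forall u v : V, ip u v = (ip v u)^* ;
  sp_definite : forall u : V, u != 0 -> 0 < ip u u }.

Definition ip_norm (V : lmodType C) (ip : V -> V -> C) (u : V) : R :=
  Num.sqrt (complex.Re (ip u u)).

Definition ip_cvg (V : lmodType C) (ip : V -> V -> C) (u : nat -> V) (l : V) :=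
  (fun n => ip_norm ip (u n - l)) @ \oo --> (0 : R).

Definition ip_cauchy (V : lmodType C) (ip : V -> V -> C) (u : nat -> V) :=
  forall e : R, 0 < e -> exists N : nat,
    forall m n : nat, (N <= m)%N -> (N <= n)%N -> ip_norm ip (u m - u n) < e.

Definition hilbert_space (V : lmodType C) (ip : V -> V -> C) : Prop :=
  scalar_product ip /\
  forall u : nat -> V, ip_cauchy ip u -> exists l : V, ip_cvg ip u l.

(* An operator in X is identified with its graph, a subset of X * X. *)
Section Operators.
Variables (X : lmodType C) (ip : X -> X -> C) (A : set (X * X)).

Definition op_domain : set X := [set x | exists y, A (x, y)].

Definition linear_operator : Prop :=
  [/\ A 0,
      forall (a : C) (p q : X * X), A p -> A q -> A (a *: p + q) &
      forall y : X, A (0, y) -> y = 0].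

Definition densely_defined : Prop :=
  forall (x : X) (e : R), 0 < e ->
    exists2 y, op_domain y & ip_norm ip (x - y) < e.

Definition closed_operator : Prop :=
  forall (u v : nat -> X) (x y : X), (forall n, A (u n, v n)) ->
    ip_cvg ip u x -> ip_cvg ip v y -> A (x, y).

Definition skew_symmetric : Prop :=
  forall p q : X * X, A p -> A q -> ip p.2 q.1 = - ip p.1 q.2.

Definition adjoint_graph : set (X * X) :=
  [set uv | forall p, A p -> ip p.2 uv.1 = ip p.1 uv.2].

End Operators.

Definition std_symmetric_form (X : lmodType C) (ip : X -> X -> C)
    (p q : X * X) : C :=
  ip p.1 q.2 + ip p.2 q.1.

Definition std_unitary_form (G1 G2 : lmodType C) (ip1 : G1 -> G1 -> C)
    (ip2 : G2 -> G2 -> C) (p q : G1 * G2) : C :=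
  ip1 p.1 q.1 - ip2 p.2 q.2.

(* The values of F outside the graph of the adjoint are irrelevant. *)
Record boundary_system (X : lmodType C) (ip : X -> X -> C) (A : set (X * X))
    (Omega : X * X -> X * X -> C)
    (G1 : lmodType C) (ip1 : G1 -> G1 -> C)
    (G2 : lmodType C) (ip2 : G2 -> G2 -> C)
    (F : X * X -> G1 * G2)
    (omega : G1 * G2 -> G1 * G2 -> C) : Prop := {
  bs_linear_operator : linear_operator A ;
  bs_densely_defined : densely_defined ip A ;
  bs_closed : closed_operator ip A ;
  bs_skew_symmetric : skew_symmetric ip A ;
  bs_hilbert1 : hilbert_space ip1 ;
  bs_hilbert2 : hilbert_space ip2 ;
  bs_Omega : sesquilinear_form Omega ;
  bs_omega : sesquilinear_form omega ;
  bs_linear : forall (a : C) (p q : X * X),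
    adjoint_graph ip A p -> adjoint_graph ip A q ->
    F (a *: p + q) = a *: F p + F q ;
  bs_surjective : forall g : G1 * G2,
    exists2 p, adjoint_graph ip A p & F p = g ;
  bs_identity : forall p q : X * X,
    adjoint_graph ip A p -> adjoint_graph ip A q ->
    Omega p q = omega (F p) (F q) }.

End AbstractTheory.

Section FunctionsOnHalfLine.
Variable R : realType.
Local Notation C := R[i].
Local Notation mu := (@lebesgue_measure R).

(* The half-line.  Functions on it are total functions on R, of which only the
   restriction to the half-line is ever used. *)
Definition half_line : set R := `[0, +oo[.

Definition hform m n (M : 'M[C]_(m, n)) (u : 'cV[C]_m) (v : 'cV[C]_n) : C :=
  (u^t* *m M *m v) 0 0.

Definition complex_measurable (D : set R) (f : R -> C) : Prop :=
  measurable_fun D (fun t => complex.Re (f t)) /\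
  measurable_fun D (fun t => complex.Im (f t)).

Definition mx_measurable m n (D : set R) (f : R -> 'M[C]_(m, n)) : Prop :=
  forall i j, complex_measurable D (fun t => f t i j).

Definition complex_integral (D : set R) (f : R -> C) : C :=
  (\int[mu]_(t in D) complex.Re (f t)) +i* (\int[mu]_(t in D) complex.Im (f t)).

Definition L2loc n (x : R -> 'cV[C]_n) : Prop :=
  mx_measurable half_line x /\
  forall b : R, mu.-integrable `[0, b]
    (fun t => (complex.Re (hform 1%:M (x t) (x t)))%:E).

(* Test functions on the open half-line (0, oo). *)
Definition test_function (phi : R -> R) : Prop :=
  (forall (k : nat) (t : R), derivable (derive1n k phi) t 1) /\
  exists2 a : R, 0 < a &
    exists b : R, forall t, phi t != 0 -> a <= t <= b.

(* g is the derivative of f in the sense of distributions on (0, oo). *)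
Definition distr_derivative n (f g : R -> 'cV[C]_n) : Prop :=
  forall phi : R -> R, test_function phi -> forall i : 'I_n,
    complex_integral half_line (fun t => (derive1 phi t)%:C * f t i 0) =
    - complex_integral half_line (fun t => (phi t)%:C * g t i 0).

(* y(0) = v, where y(0) is the value at 0 of the continuous representative. *)
Definition has_value0 n (y : R -> 'cV[C]_n) (v : 'cV[C]_n) : Prop :=
  exists z : R -> 'cV[C]_n,
  [/\ forall i, {within half_line, continuous (fun t => complex.Re (z t i 0))},
      forall i, {within half_line, continuous (fun t => complex.Im (z t i 0))},
      {ae mu, forall t, half_line t -> z t = y t} &
      z 0 = v].

Definition value0 n (y : R -> 'cV[C]_n) : 'cV[C]_n := xget 0 (has_value0 y).

Record hamiltonian_density d (H : R -> 'M[C]_d) : Prop := {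
  hd_measurable : mx_measurable half_line H ;
  hd_hermitian : {ae mu, forall t, half_line t -> (H t)^t* = H t} ;
  hd_bounded : exists B : R, forall t, half_line t ->
    forall i j, `|H t i j| <= B%:C ;
  hd_locally_coercive : forall K : set R, bounded_set K -> K `<=` half_line ->
    exists m M : R, [/\ 0 < m, 0 < M &
      {ae mu, forall t, K t -> forall zeta : 'cV[C]_d,
         m%:C * hform 1%:M zeta zeta <= hform (H t) zeta zeta /\
         hform (H t) zeta zeta <= M%:C * hform 1%:M zeta zeta}] }.

End FunctionsOnHalfLine.

Arguments half_line {R}.

Section Closure.
Variable R : realType.
Local Notation C := R[i].
Local Notation mu := (@lebesgue_measure R).

Lemma cmeasD (D : set R) (f g : R -> C) :
  complex_measurable D f -> complex_measurable D g ->
  complex_measurable D (fun t => f t + g t).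
Proof.
move=> [fr fi] [gr gi]; split.
- apply: (eq_measurable_fun (fun t => complex.Re (f t) + complex.Re (g t))).
    by move=> t _; rewrite raddfD.
  exact: measurable_funD.
- apply: (eq_measurable_fun (fun t => complex.Im (f t) + complex.Im (g t))).
    by move=> t _; rewrite raddfD.
  exact: measurable_funD.
Qed.

Lemma cmeasM (D : set R) (f g : R -> C) :
  complex_measurable D f -> complex_measurable D g ->
  complex_measurable D (fun t => f t * g t).
Proof.
move=> [fr fi] [gr gi]; split.
- apply: (eq_measurable_fun (fun t => complex.Re (f t) * complex.Re (g t) -
            complex.Im (f t) * complex.Im (g t))).
    by move=> t _; case: (f t) => a b; case: (g t).
  by apply: measurable_funB; apply: measurable_funM.
- apply: (eq_measurable_fun (fun t => complex.Re (f t) * complex.Im (g t) +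
            complex.Im (f t) * complex.Re (g t))).
    by move=> t _; case: (f t) => a b; case: (g t).
  by apply: measurable_funD; apply: measurable_funM.
Qed.

Lemma cmeas_cst (D : set R) (c : C) : complex_measurable D (fun=> c).
Proof. by split; exact: measurable_cst. Qed.

Lemma cmeas_conj (D : set R) (f : R -> C) :
  complex_measurable D f -> complex_measurable D (fun t => Num.conj (f t)).
Proof.
move=> [fr fi]; split.
  apply: (eq_measurable_fun (fun t => complex.Re (f t))) => //.
  by move=> t _; case: (f t).
apply: (eq_measurable_fun (fun t => - complex.Im (f t))).
  by move=> t _; case: (f t).
exact: measurableT_comp.
Qed.

Lemma cmeas_sum (D : set R) (I : finType) (f : I -> R -> C) :
  (forall i, complex_measurable D (f i)) ->
  complex_measurable D (fun t => \sum_i f i t).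
Proof.
move=> mf; elim: (index_enum I) => [|i s IHs].
  by under [X in complex_measurable _ X]funext do rewrite big_nil;
     exact: cmeas_cst.
by under [X in complex_measurable _ X]funext do rewrite big_cons;
   exact: cmeasD.
Qed.

Lemma mxmeasM (D : set R) m n p (A : R -> 'M[C]_(m, n)) (B : R -> 'M[C]_(n, p)) :
  mx_measurable D A -> mx_measurable D B ->
  mx_measurable D (fun t => A t *m B t).
Proof.
move=> mA mB i j.
under [X in complex_measurable _ X]funext do rewrite mxE.
by apply: cmeas_sum => k; exact: cmeasM.
Qed.

Lemma mxmeas_tr (D : set R) m n (A : R -> 'M[C]_(m, n)) :
  mx_measurable D A -> mx_measurable D (fun t => (A t)^t*).
Proof.
move=> mA i j.
under [X in complex_measurable _ X]funext do rewrite !mxE.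
exact: cmeas_conj.
Qed.

Lemma mxmeas_cst (D : set R) m n (A : 'M[C]_(m, n)) :
  mx_measurable D (fun=> A).
Proof. by move=> i j; exact: cmeas_cst. Qed.

Lemma mxmeas_lin (D : set R) m n (a : C) (x y : R -> 'M[C]_(m, n)) :
  mx_measurable D x -> mx_measurable D y ->
  mx_measurable D (fun t => a *: x t + y t).
Proof.
move=> mx my i j.
under [X in complex_measurable _ X]funext do rewrite !mxE.
by apply: cmeasD => //; apply: cmeasM => //; exact: cmeas_cst.
Qed.

Lemma cmeas_hform (D : set R) n (M : R -> 'M[C]_n) (x : R -> 'cV[C]_n) :
  mx_measurable D M -> mx_measurable D x ->
  complex_measurable D (fun t => hform (M t) (x t) (x t)).
Proof.
move=> mM mx; have := mxmeasM (mxmeasM (mxmeas_tr mx) mM) mx.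
by move=> /(_ 0 0).
Qed.

Lemma cmeas_sub (D E : set R) (f : R -> C) : measurable E -> D `<=` E ->
  complex_measurable E f -> complex_measurable D f.
Proof. by move=> mE DE [fr fi]; split; apply: measurable_funS DE _. Qed.

Lemma hform_linle n (M : 'M[C]_n) (a : C) (u v : 'cV[C]_n) :
  (forall z, 0 <= hform M z z) ->
  complex.Re (hform M (a *: u + v) (a *: u + v)) <=
  complex.Re (2 * (a * a^*)) * complex.Re (hform M u u) +
  2 * complex.Re (hform M v v).
Proof.
move=> M0.
have re0 z : 0 <= complex.Re (hform M z z).
  by have := M0 z; rewrite lecE => /andP[].
have := re0 (a *: u - v).
have E : hform M (a *: u + v) (a *: u + v) + hform M (a *: u - v) (a *: u - v)
  = 2 * (a * a^*) * hform M u u + 2 * hform M v v.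
  have trD (x y : 'cV[C]_n) : (x + y)^t* = x^t* + y^t*.
    by apply/matrixP => i j; rewrite !mxE rmorphD.
  have trN (x : 'cV[C]_n) : (- x)^t* = - x^t*.
    by apply/matrixP => i j; rewrite !mxE rmorphN.
  have trZ (x : 'cV[C]_n) : (a *: x)^t* = a^* *: x^t*.
    by apply/matrixP => i j; rewrite !mxE rmorphM.
  rewrite /hform !(trD, trN, trZ) !(mulmxDl, mulmxDr, mulmxN, mulNmx).
  rewrite -!scalemxAl -!scalemxAr !scalerA.
  have fD (x y : 'M[C]_1) : (x + y) 0 0 = x 0 0 + y 0 0 by rewrite mxE.
  have fN (x : 'M[C]_1) : (- x) 0 0 = - x 0 0 by rewrite mxE.
  have fZ (c : C) (x : 'M[C]_1) : (c *: x) 0 0 = c * x 0 0 by rewrite mxE.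
  rewrite !(fD, fN, fZ).
  by ring.
move: E; set p := hform M (_ + _) _; set q := hform M (_ - _) _ => E q0.
have -> : complex.Re p = complex.Re (p + q) - complex.Re q.
  by rewrite raddfD /= addrK.
rewrite E raddfD /=.
have reM (b c : C) : complex.Im b = 0 ->
    complex.Re (b * c) = complex.Re b * complex.Re c.
  by case: b => b1 b2; case: c => c1 c2 /= ->; rewrite mul0r subr0.
have im2 : complex.Im (2 : C) = 0 by rewrite raddfMn /= mul0rn.
have im2a : complex.Im (2 * (a * a^*)) = 0.
  rewrite mulr_natl raddfMn /=; case: (a) => b c /=.
  by rewrite mulrN mulrC addNr mul0rn.
rewrite (reM _ (hform M u u) im2a) (reM _ (hform M v v) im2) (_ : complex.Re (2 : C) = 2); last by rewrite raddfMn.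
by rewrite gerBl.
Qed.

Lemma integrable_hform_lin n (E : set R) (M : R -> 'M[C]_n) (a : C)
    (x y : R -> 'cV[C]_n) : measurable E ->
  mx_measurable E M -> mx_measurable E x -> mx_measurable E y ->
  {ae mu, forall t, E t -> forall z, 0 <= hform (M t) z z} ->
  mu.-integrable E (fun t => (complex.Re (hform (M t) (x t) (x t)))%:E) ->
  mu.-integrable E (fun t => (complex.Re (hform (M t) (y t) (y t)))%:E) ->
  mu.-integrable E (fun t =>
    (complex.Re (hform (M t) (a *: x t + y t) (a *: x t + y t)))%:E).
Proof.
move=> mE mM mx my M0 ix iy.
have ms : measurable_fun E (fun t =>
    (complex.Re (hform (M t) (a *: x t + y t) (a *: x t + y t)))%:E).
  apply/measurable_EFinP.
  by have [] := cmeas_hform mM (mxmeas_lin a mx my).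
apply/integrableP; split=> //.
set k := complex.Re (2 * (a * a^*)).
have ig : mu.-integrable E (fun t =>
    (k%:E * (complex.Re (hform (M t) (x t) (x t)))%:E +
     2%:E * (complex.Re (hform (M t) (y t) (y t)))%:E)%E).
  by apply: integrableD => //; exact: integrableZl.
have [mg] := integrableP _ _ _ ig.
apply: le_lt_trans; apply: ae_ge0_le_integral => //.
- exact: measurableT_comp.
- exact: measurableT_comp.
move: M0; apply: (@filterS _ _ (ae_filter_ringOfSetsType mu)) => t Mt Et; rewrite lee_fin.
rewrite ger0_norm; last first.
  by have := Mt Et (a *: x t + y t); rewrite lecE => /andP[].
exact: le_trans (hform_linle a (x t) (y t) (Mt Et)) (ler_norm _).
Qed.

Lemma hform1_ge0 n (z : 'cV[C]_n) : 0 <= hform 1%:M z z.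
Proof.
rewrite /hform mulmx1 mxE; apply: sumr_ge0 => i _.
by rewrite !mxE mulrC mul_conjC_ge0.
Qed.

End Closure.

Section L2H.
Variable R : realType.
Local Notation C := R[i].
Local Notation mu := (@lebesgue_measure R).
Variables (d : nat) (H : R -> 'M[C]_d) (hH : hamiltonian_density H).

(* Since x^* H x >= 0 almost everywhere, its integrability means that its
   integral is finite. *)
Definition in_L2H (x : R -> 'cV[C]_d) : Prop :=
  L2loc x /\
  mu.-integrable half_line (fun t => (complex.Re (hform (H t) (x t) (x t)))%:E).

Lemma hamiltonian_ae_ge0 :
  {ae mu, forall t, half_line t -> forall z, 0 <= hform (H t) z z}.
Proof.
have hn (k : nat) : {ae mu, forall t, `[0, k%:R]%classic t ->
    forall z, 0 <= hform (H t) z z}.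
  have [||m [M [m0 _]]] := hd_locally_coercive hH (K := `[0, k%:R]%classic).
  - exact: compact_bounded (@segment_compact _ _ _).
  - by move=> t; rewrite /half_line /= !in_itv /= => /andP[->].
  apply: (@filterS _ _ (ae_filter_ringOfSetsType mu)) => t Ht kt z; have [+ _] := Ht kt z.
  apply: le_trans; apply: mulr_ge0; last exact: hform1_ge0.
  by rewrite lecR ltW.
move: (ae_foralln hn); apply: (@filterS _ _ (ae_filter_ringOfSetsType mu)) => t ht t0 z.
have t0' : 0 <= t by move: t0; rewrite /half_line /= in_itv /= andbT.
apply: (ht (Num.bound t)); rewrite /= in_itv /= t0' /=.
by apply: ltW; apply: le_lt_trans (archi_boundP t0').
Qed.

Lemma in_L2H_lin (a : C) (x y : R -> 'cV[C]_d) :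
  in_L2H x -> in_L2H y -> in_L2H (a *: x + y).
Proof.
move=> [[mx lx] ix] [[my ly] iy]; split; first split.
- exact: (mxmeas_lin a mx my).
- move=> b; apply: (integrable_hform_lin (M := fun=> 1%:M) a) => //.
  + by move=> i j; apply: cmeas_sub (mx i j) => //;
      [exact: measurable_itv|move=> t; rewrite /half_line /= !in_itv /= => /andP[->]].
  + by move=> i j; apply: cmeas_sub (my i j) => //;
      [exact: measurable_itv|move=> t; rewrite /half_line /= !in_itv /= => /andP[->]].
  + by apply: aeW => t _ z; exact: hform1_ge0.
- apply: (integrable_hform_lin a) => //.
  + exact: measurable_itv.
  + exact: hd_measurable hH.
  + exact: hamiltonian_ae_ge0.
Qed.

Lemma in_L2H0 : in_L2H 0.
Proof.
have h0 (M : 'M[C]_d) : hform M 0 0 = 0 by rewrite /hform mulmx0 mxE.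
split; first split.
- exact: mxmeas_cst.
- move=> b; under [X in integrable _ _ X]funext do rewrite h0.
  exact: integrable0.
- under [X in integrable _ _ X]funext do rewrite h0.
  exact: integrable0.
Qed.

Definition L2H_pred (_ : hamiltonian_density H) : {pred R -> 'cV[C]_d} :=
  fun x => `[< in_L2H x >].

Lemma L2H_pred_submod_closed : submod_closed (L2H_pred hH).
Proof.
split; first by apply/asboolP; exact: in_L2H0.
by move=> a x y /asboolP hx /asboolP hy; apply/asboolP; exact: in_L2H_lin.
Qed.

HB.instance Definition _ := GRing.isSubmodClosed.Build C (R -> 'cV[C]_d)
  (L2H_pred hH) L2H_pred_submod_closed.

(* Functions that are square integrable with weight H, before a.e. equal
   functions are identified. *)
Record L2H_fun := MkL2H {
  L2H_val :> R -> 'cV[C]_d ;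
  _ : L2H_val \in L2H_pred hH }.

HB.instance Definition _ := [isSub for L2H_val].
HB.instance Definition _ := [Choice of L2H_fun by <:].
HB.instance Definition _ := [SubChoice_isSubLmodule of L2H_fun by <:].

Definition L2H_null : {pred L2H_fun} :=
  fun x => `[< {ae mu, forall t, half_line t -> x t = 0} >].

Lemma L2H_null_submod_closed : submod_closed L2H_null.
Proof.
split; first by apply/asboolP; apply: aeW.
move=> a x y /asboolP hx /asboolP hy; apply/asboolP.
apply: (@filterS2 _ _ (ae_filter_ringOfSetsType mu) _ _ _ _ hx hy) => t xt yt t0.
have -> : (a *: x + y) t = a *: x t + y t by [].
by rewrite xt // yt // scaler0 addr0.
Qed.

HB.instance Definition _ := GRing.isSubmodClosed.Build C L2H_fun
  L2H_null L2H_null_submod_closed.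

(* The space X = L^2_H(0, oo). *)
Definition L2H : Type := {ideal_quot (L2H_null : zmodClosed L2H_fun)}.

HB.instance Definition _ := GRing.Zmodule.on L2H.
HB.instance Definition _ := EqQuotient.on L2H.

Definition L2H_scale (a : C) (x : L2H) : L2H := \pi_(L2H) (a *: repr x).

Lemma pi_L2H_scale (a : C) (x : L2H_fun) :
  L2H_scale a (\pi_(L2H) x) = \pi_(L2H) (a *: x).
Proof.
apply/eqP; rewrite piE Quotient.equivE -scalerBr rpredZ //.
by rewrite Quotient.idealrBE reprK.
Qed.

Lemma L2H_piP (x : L2H) : exists y : L2H_fun, x = \pi_(L2H) y.
Proof. by exists (repr x); rewrite reprK. Qed.

Lemma L2H_scaleA (a b : C) (x : L2H) :
  L2H_scale a (L2H_scale b x) = L2H_scale (a * b) x.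
Proof. by have [y ->] := L2H_piP x; rewrite !pi_L2H_scale scalerA. Qed.

Lemma L2H_scale1 : left_id 1 L2H_scale.
Proof. by move=> x; have [y ->] := L2H_piP x; rewrite pi_L2H_scale scale1r. Qed.

Lemma L2H_scaleDr : right_distributive L2H_scale +%R.
Proof.
move=> a x y; have [u ->] := L2H_piP x; have [v ->] := L2H_piP y.
have piD (f g : L2H_fun) : \pi_(L2H) (f + g) = \pi_(L2H) f + \pi_(L2H) g.
  exact: (raddfD \pi_({ideal_quot (L2H_null : zmodClosed L2H_fun)})).
by rewrite -piD !pi_L2H_scale scalerDr piD.
Qed.

Lemma L2H_scaleDl (x : L2H) : {morph L2H_scale^~ x : a b / a + b}.
Proof.
move=> a b; have [u ->] := L2H_piP x; rewrite !pi_L2H_scale scalerDl.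
exact: (raddfD \pi_({ideal_quot (L2H_null : zmodClosed L2H_fun)})).
Qed.

HB.instance Definition _ := GRing.Zmodule_isLmodule.Build C L2H
  L2H_scaleA L2H_scale1 L2H_scaleDr L2H_scaleDl.

(* A representative of a class, and the class of a square integrable function
 . *)
Definition L2H_repr (x : L2H) : R -> 'cV[C]_d := repr x : L2H_fun.

Definition L2H_ip (x y : L2H) : C :=
  complex_integral half_line
    (fun t => hform (H t) (L2H_repr x t) (L2H_repr y t)).

End L2H.

Section PortHamiltonian.
Variable R : realType.
Local Notation C := R[i].
Local Notation mu := (@lebesgue_measure R).

Section Operator.
Variables (d : nat) (H : R -> 'M[C]_d) (hH : hamiltonian_density H).
Variables (P1 P0 : 'M[C]_d).

Definition ph_domain : set (L2H hH) :=
  [set x | (exists g : L2H hH,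
              distr_derivative (fun t => H t *m L2H_repr x t) (L2H_repr g)) /\
           has_value0 (fun t => H t *m L2H_repr x t) 0].

(* The graph of A : x |-> P1 (H x)' + P0 H x.  The weighted space need not be
   invariant under P1, so that P1 (H x)' + P0 H x is a priori only a locally
   square integrable function; cf. ph_maps_into. *)
Definition ph_graph : set (L2H hH * L2H hH) :=
  [set p | ph_domain p.1 /\
     exists2 g : L2H hH,
       distr_derivative (fun t => H t *m L2H_repr p.1 t) (L2H_repr g) &
       {ae mu, forall t, half_line t ->
          L2H_repr p.2 t = P1 *m L2H_repr g t + P0 *m (H t *m L2H_repr p.1 t)}].

(* A is an operator in X, i.e. it maps its domain into X. *)
Definition ph_maps_into : Prop :=
  forall x, ph_domain x -> exists y, ph_graph (x, y).

End Operator.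

(* The pair (pr_+ (S H x)(0), pr_- (S H x)(0)); it does not depend on the
   second component of p = (x, A^* x). *)
Definition boundary_map np nm (H : R -> 'M[C]_(np + nm))
    (hH : hamiltonian_density H) (S : 'M[C]_(np + nm))
    (p : L2H hH * L2H hH) : 'cV[C]_np * 'cV[C]_nm :=
  let v := value0 (fun t => S *m (H t *m L2H_repr p.1 t)) in
  (usubmx v, dsubmx v).

End PortHamiltonian.

Arguments L2H_ip {R d H} hH x y.
Arguments ph_domain {R d H} hH.
Arguments ph_graph {R d H} hH P1 P0.
Arguments boundary_map {R np nm H} hH S p.

(* Main.v *)
Require Import Defs.
From mathcomp Require Import all_boot all_order all_algebra.
From mathcomp Require Import complex.
From mathcomp Require Import all_classical all_reals all_analysis.
From mathcomp Require Import measurable_realfun ring lra.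
Set Implicit Arguments.
Unset Strict Implicit.
Unset Printing Implicit Defensive.
Import Order.TTheory GRing.Theory Num.Theory.
Import numFieldNormedType.Exports.
Local Open Scope classical_set_scope.
Local Open Scope ring_scope.
Local Open Scope complex_scope.
Local Open Scope sesquilinear_scope.

(** Call [(x, y)] maximal with boundary value [c] when [H x] agrees almost
    everywhere with a locally absolutely continuous [W] such that [W(0) = c] and
    [y = P1 W' + P0 W].  Integration by parts, the boundary term at infinity
    being absent because [H x] is square integrable on the half-line, gives
    Green's formula
      [<y1, x2> + <x1, y2> = - c1^* P1 c2]
    for maximal pairs, and every vector [c] is the boundary value of a compactly
    supported maximal pair.  Testing against [x = H^-1 (phi e_i)] for test
    functions [phi], the du Bois-Reymond lemma shows that [(u, v)] lies in the
    adjoint exactly when [(u, - v)] is maximal.  Green's formula is then the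
    identity of the boundary system, once [P1] is diagonalized by [S].

    Neither [X] nor its norm need be preserved by the matrices [P1] and [P1^-1],
    and a maximal pair with boundary value [0] lies in the graph of [A] only if
    [W'] belongs to [X].  This follows from [A] taking values in [X]: for [g] in
    [X] there are [x] in the domain of [A] and a unimodular function [e] such that
    [(H x)' - e g] is square integrable, [H x] being approximately
    [e^(iNt) g / (iN)] on [n, n + 1] with [N] growing fast with [n]; hence
    [P1 e g], and so [P1 g], belongs to [X].  By the Cayley-Hamilton theorem [P1^-1]
    is a polynomial in [P1], and [X] is invariant under it as well. *)

(** * Integrals on the half-line *)

Section RealIntegral.
Variable R : realType.
Local Notation mu := (@lebesgue_measure R).
Implicit Types (D : set R) (f g : R -> R).

(** The coercivity constant of [H] may tend to 0 along the half-line, at different rates in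
    different directions, and [P1] mixes directions; so neither a bound for [P1] on X nor an
    inclusion of X in the unweighted L2 is at hand. The inclusion of L2 in X does hold, [H] being
    bounded, and it is used twice. A compactly supported pair has a square integrable derivative,
    which is therefore in X; such pairs are enough to test the adjoint with, to reach every boundary
    value and to prove density. And in the oscillation argument the error may be measured in the
    unweighted norm. There the factor 1/N outweighs the size of [H^-1] on [n, n + 1], however large,
    while the derivative keeps the size of [g]; a scalar factor of modulus 1 changes no weighted
    norm and commutes with [P1], so it can be removed afterwards. Since [g] is only square
    integrable, it is replaced on each [n, n + 1] by an absolutely continuous function vanishing at
    both end points, which makes the pieces fit together and gives the value 0 at the origin. *)

Lemma aeS (P Q : R -> Prop) : {ae mu, forall t, P t} ->
  (forall t, P t -> Q t) -> {ae mu, forall t, Q t}.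
Proof.
by move=> HP PQ; apply: (@filterS _ _ (ae_filter_ringOfSetsType mu)) HP.
Qed.

Lemma aeS2 (P Q S : R -> Prop) : {ae mu, forall t, P t} ->
  {ae mu, forall t, Q t} -> (forall t, P t -> Q t -> S t) -> {ae mu, forall t, S t}.
Proof.
move=> HP HQ PQ.
by move: HP HQ; apply: (@filterS2 _ _ (ae_filter_ringOfSetsType mu)).
Qed.

Definition intg D f := mu.-integrable D (EFin \o f).

Definition loc_intg f := forall b : R, intg `[0, b] f.

Definition prim f (t : R) : R := \int[mu]_(s in `[0, t]) f s.

Lemma intg_meas D f : intg D f -> measurable_fun D f.
Proof. by move=> /integrableP[/measurable_EFinP]. Qed.

Lemma intgS D E f : measurable E -> measurable D -> D `<=` E ->
  intg E f -> intg D f.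
Proof. by move=> mE mD DE; exact: integrableS. Qed.

Lemma half_line0 : measurable (half_line : set R).
Proof. exact: measurable_itv. Qed.

Lemma half_lineP (t : R) : half_line t <-> 0 <= t.
Proof. by rewrite /half_line /= in_itv /= andbT. Qed.

Lemma sub_half_line (b : R) : `[0, b] `<=` half_line.
Proof. by move=> t; rewrite /= in_itv /= => /andP[t0 _]; apply/half_lineP. Qed.

Lemma sub_half_line_itv (a b : R) : 0 <= a -> `[a, b] `<=` half_line.
Proof.
move=> a0 t; rewrite /= in_itv /= => /andP[at_ _].
by apply/half_lineP; exact: le_trans at_.
Qed.

Lemma intg_loc f : intg half_line f -> loc_intg f.
Proof.
move=> fi b; apply: intgS fi => //; first exact: half_line0.
exact: sub_half_line.
Qed.

Lemma intgD D f g : measurable D -> intg D f -> intg D g ->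
  intg D (fun t => f t + g t).
Proof. by move=> mD fi gi; exact: (@integrableD _ _ _ mu _ mD _ _ fi gi). Qed.

Lemma intgN D f : measurable D -> intg D f -> intg D (fun t => - f t).
Proof. move=> mD fi; apply: (@eq_integrable _ _ _ mu D mD (-%E \o (EFin \o f))) => //.
exact: (@integrableN _ _ _ mu _ _ fi). Qed.

Lemma intgB D f g : measurable D -> intg D f -> intg D g ->
  intg D (fun t => f t - g t).
Proof. by move=> mD fi gi; apply: intgD => //; exact: intgN. Qed.

Lemma intgZ D f (k : R) : measurable D -> intg D f ->
  intg D (fun t => k * f t).
Proof. by move=> mD fi; exact: (@integrableZl _ _ _ mu _ mD k _ fi). Qed.

Lemma intg_le D f g : measurable D -> measurable_fun D f ->
  (forall t, D t -> `|f t| <= g t) -> intg D g -> intg D f.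
Proof.
move=> mD mf fg gi; apply: le_integrable gi => //; first exact/measurable_EFinP.
by move=> t Dt /=; rewrite lee_fin (le_trans (fg t Dt))// ler_norm.
Qed.

Lemma intg_aele D f g : measurable D -> measurable_fun D f ->
  {ae mu, forall t, D t -> `|f t| <= g t} -> intg D g -> intg D f.
Proof.
move=> mD mf fg gi; have mg := intg_meas gi.
apply/integrableP; split; first exact/measurable_EFinP.
have /integrableP[_] := gi; apply: le_lt_trans.
apply: ae_ge0_le_integral => //.
- by apply/measurable_EFinP; exact: measurableT_comp.
- by apply/measurable_EFinP; exact: measurableT_comp.
apply: (aeS fg) => t {}fg Dt.
by rewrite lee_fin (le_trans (fg Dt))// ler_norm.
Qed.

Lemma intg_aeeq D f g : measurable D -> measurable_fun D g ->
  {ae mu, forall t, D t -> f t = g t} -> intg D f -> intg D g.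
Proof.
move=> mD mg fg fi; apply: (@intg_aele _ _ (fun t => `|f t|)) => //.
  apply: (aeS fg) => t {}fg Dt.
  by rewrite fg.
exact: integrable_norm.
Qed.

Lemma intg_norm D f : intg D f -> intg D (fun t => `|f t|).
Proof. exact: integrable_norm. Qed.

Lemma intg_ext D f g : measurable D -> (forall t, D t -> f t = g t) ->
  intg D f -> intg D g.
Proof. by move=> mD fg; apply: (@eq_integrable _ _ _ mu D mD) => t /set_mem Dt /=; rewrite fg. Qed.

Lemma Rint_ae D f g : measurable D -> measurable_fun D f ->
  measurable_fun D g -> {ae mu, forall t, D t -> f t = g t} ->
  \int[mu]_(t in D) f t = \int[mu]_(t in D) g t.
Proof.
move=> mD mf mg fg; congr fine; apply: ae_eq_integral => //.
- exact/measurable_EFinP.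
- exact/measurable_EFinP.
apply: (aeS fg) => t {}fg Dt.
by rewrite /= fg.
Qed.

(** [Num.max (f t) (g t)] agrees with [g] almost everywhere and dominates [f] everywhere, which
    reduces the claim to the pointwise comparison. *)
Lemma le_Rint_ae (D : set R) (f g : R -> R) : measurable D -> intg D f -> intg D g ->
  {ae mu, forall t, D t -> f t <= g t} ->
  \int[mu]_(t in D) f t <= \int[mu]_(t in D) g t.
Proof.
move=> mE fi gi fg; have mf := intg_meas fi; have mg := intg_meas gi.
have mm : measurable_fun D (fun t => Num.max (f t) (g t)) by exact: measurable_maxr.
have gm : {ae mu, forall t, D t -> g t = Num.max (f t) (g t)}.
  by apply: (aeS fg) => t h Dt; rewrite max_r// h.
rewrite [leRHS](Rint_ae mE mg mm gm); apply: le_Rintegral => //.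
  exact: intg_aeeq gi.
by move=> t _; rewrite le_max lexx.
Qed.

Lemma Rint_ext D f g : (forall t, D t -> f t = g t) ->
  \int[mu]_(t in D) f t = \int[mu]_(t in D) g t.
Proof. by move=> fg; apply: eq_Rintegral => t /set_mem; exact: fg. Qed.

Lemma intg_bounded D f (M : R) : measurable D -> (mu D < +oo)%E ->
  measurable_fun D f -> (forall t, D t -> `|f t| <= M) -> intg D f.
Proof.
move=> mD Dfin mf fM; apply: measurable_bounded_integrable => //.
exists M; split; first by rewrite num_real.
by move=> x Mx t Dt /=; rewrite (le_trans (fM t Dt))// ltW.
Qed.

Lemma muitv (a b : R) : (mu `[a, b] < +oo)%E.
Proof. by rewrite lebesgue_measure_itv /=; case: ifPn => // _; rewrite -EFinD ltry. Qed.

Lemma intg_patch (D E : set R) f : measurable D -> measurable E ->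
  intg (E `&` D) f <-> intg E (f \_ D).
Proof.
move=> mD mE; rewrite /intg.
have -> : EFin \o (f \_ D) = (EFin \o f) \_ D.
  by apply/funext => t; rewrite /= !patchE; case: ifP.
exact: integrable_restrict.
Qed.

Lemma EFin_Rint D f : measurable D -> intg D f ->
  (\int[mu]_(t in D) f t)%:E = (\int[mu]_(t in D) (f t)%:E)%E.
Proof. by move=> mD fi; rewrite /Rintegral fineK//; exact: integrable_fin_num. Qed.

Lemma Rint_patch (D : set R) f :
  \int[mu]_(t in setT) (f \_ D) t = \int[mu]_(t in D) f t.
Proof. by rewrite [RHS]Rintegral_mkcond. Qed.

Lemma intgT_patch (D : set R) f : measurable D ->
  intg D f -> intg setT (f \_ D).
Proof. by move=> mD fi; apply/intg_patch => //; rewrite setTI. Qed.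

(** * Tensor products of integrable functions on the plane *)

Section Fubini.
Variables (F G : R -> R) (P : set (measurableTypeR R * measurableTypeR R)).
Hypotheses (Fi : intg setT F) (Gi : intg setT G) (mP : measurable P).

Let k (z : R * R) := F z.1 * G z.2.

Let mk : measurable_fun setT k.
Proof.
apply: measurable_funM.
  by apply: measurableT_comp; [exact: intg_meas Fi|exact: measurable_fst].
by apply: measurableT_comp; [exact: intg_meas Gi|exact: measurable_snd].
Qed.

(** Tonelli: the iterated integral of [|F x| |G y|] is the product of the two L1 norms, both
    finite. *)
Lemma integrable_tensor : (mu \x mu)%E.-integrable setT (EFin \o k).
Proof.
apply/integrable12ltyP; first exact/measurable_EFinP.
rewrite (_ : (fun x => _) = (fun x => (`|F x|)%:E *
    \int[mu]_y (`|G y|)%:E)%E); last first.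
  apply/funext => x; rewrite -ge0_integralZl//; last first.
    by apply/measurable_EFinP; apply: measurableT_comp => //; exact: intg_meas Gi.
  by apply: eq_integral => y _; rewrite /= /k /= normrM.
have /integrableP[_ Fy] := Fi.
have /integrableP[_ Gy] := Gi.
rewrite ge0_integralZr//.
- by rewrite lte_mul_pinfty//; [exact: integral_ge0|
    rewrite ge0_fin_numE//; exact: integral_ge0].
- by apply/measurable_EFinP; apply: measurableT_comp => //; exact: intg_meas Fi.
- exact: integral_ge0.
Qed.

Lemma integrable_tensor_indic :
  (mu \x mu)%E.-integrable setT (EFin \o (fun z => k z * \1_P z)).
Proof.
apply: le_integrable integrable_tensor => //.
  by apply/measurable_EFinP; apply: measurable_funM => //; exact: measurable_indic.
move=> z _ /=; rewrite lee_fin normrM -[leRHS]mulr1 ler_wpM2l//.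
by rewrite indicE; case: (_ \in _) => //=; rewrite ?normr1 ?normr0.
Qed.

End Fubini.

Lemma prim_continuous f (T : R) : 0 <= T -> loc_intg f ->
  {within `[0, T], continuous (prim f)}.
Proof. by move=> T0 fl; exact: (@parameterized_integral_continuous R 0 T f T0 (fl T)). Qed.

Lemma le_prim f (s t : R) : loc_intg f -> s <= t ->
  `|prim f s| <= prim (fun u => `|f u|) t.
Proof.
move=> fl st; rewrite /prim; apply: (le_trans (le_normr_Rintegral _ _)) => //; first exact: fl.
have fs := intg_norm (fl s); have ft := intg_norm (fl t).
rewrite -lee_fin !EFin_Rint//; apply: ge0_subset_integral => //.
- by apply/measurable_EFinP; exact: intg_meas ft.
- by move=> u; rewrite /= !in_itv /= => /andP[-> /le_trans]; exact.
Qed.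

Lemma measurable_prim f (T : R) : loc_intg f -> measurable_fun `[0, T] (prim f).
Proof.
move=> fl; have [T0|T0] := leP 0 T; last first.
  rewrite set_itv_ge ?bnd_simp -?ltNge//; exact: measurable_fun_set0.
apply: subspace_continuous_measurable_fun => //; exact: prim_continuous.
Qed.

Lemma intg_mul_bounded D f g (M : R) : measurable D -> intg D f ->
  measurable_fun D g -> (forall t, D t -> `|g t| <= M) ->
  intg D (fun t => f t * g t).
Proof.
move=> mD fi mg gM; apply: (@intg_le _ _ (fun t => M * `|f t|)) => //.
- by apply: measurable_funM => //; exact: intg_meas.
- by move=> t Dt; rewrite normrM mulrC ler_wpM2r// gM.
- by apply: intgZ => //; exact: intg_norm.
Qed.

Lemma intg_mul_prim f g : loc_intg f -> loc_intg g ->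
  loc_intg (fun t => f t * prim g t).
Proof.
move=> fl gl T.
apply: (@intg_mul_bounded _ _ _ (prim (fun u => `|g u|) T)) => //.
- exact: measurable_prim.
- by move=> t; rewrite /= in_itv /= => /andP[_]; exact: le_prim.
Qed.

(* Both sides are the integral of [f s * g t] over the square: split it along
   the diagonal. *)
Lemma prim_mul f g (T : R) : loc_intg f -> loc_intg g ->
  prim f T * prim g T =
  \int[mu]_(t in `[0, T]) (f t * prim g t + prim f t * g t).
Proof.
move=> fl gl.
have mT : measurable (`[0, T] : set R) by exact: measurable_itv.
pose F := f \_ `[0, T]; pose G := g \_ `[0, T].
have Fi : intg setT F by apply: intgT_patch.
have Gi : intg setT G by apply: intgT_patch.
pose P1 : set (measurableTypeR R * measurableTypeR R) := [set z | z.2 <= z.1].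
pose P2 : set (measurableTypeR R * measurableTypeR R) := [set z | z.1 < z.2].
have mP1 : measurable P1.
  rewrite -[P1]setTI; apply: measurable_fun_le => //.
have mP2 : measurable P2.
  have -> : P2 = ~` P1.
    by apply/seteqP; split => z; rewrite /P1 /P2 /= ltNge => /negP.
  exact: measurableC.
pose h (P : set (measurableTypeR R * measurableTypeR R)) (z : R * R) := F z.1 * G z.2 * \1_P z.
have h1i : (mu \x mu)%E.-integrable setT (EFin \o h P1) :=
  integrable_tensor_indic Fi Gi mP1.
have h2i : (mu \x mu)%E.-integrable setT (EFin \o h P2) :=
  integrable_tensor_indic Fi Gi mP2.
have ki := integrable_tensor Fi Gi.
have sumE : (\int[mu \x mu]_z (F z.1 * G z.2)%:E =
    \int[mu \x mu]_z (h P1 z)%:E + \int[mu \x mu]_z (h P2 z)%:E)%E.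
  rewrite -integralD//; apply: eq_integral => -[x y] _ /=.
  rewrite -EFinD; congr EFin; rewrite /h /= -mulrDr !indicE.
  have -> : ((x, y) \in P1) = (y <= x) by apply/idP/idP => [/set_mem//|?]; rewrite inE.
  have -> : ((x, y) \in P2) = (x < y) by apply/idP/idP => [/set_mem//|?]; rewrite inE.
  by case: ltP => _ /=; rewrite ?addr0 ?add0r mulr1.
have gprim u : u \in `[0, T] -> forall c,
    (\int[mu]_y (c * (g \_ `[0, u]) y)%:E)%E = (c * prim g u)%:E.
  move=> uT c; rewrite /prim -Rint_patch -RintegralZl//; last exact: intgT_patch.
  by rewrite EFin_Rint//; apply: intgZ => //; exact: intgT_patch.
(* The strict inequality in [P2] leaves half-open sections; the missing end point is null, so the
   primitive is unchanged. *)
have fprim u : u \in `[0, T] -> forall c,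
    (\int[mu]_y ((f \_ `[0, u[) y * c)%:E)%E = (prim f u * c)%:E.
  move=> uT c.
  have fu : intg `[0, u[ f.
    by apply: intgS (fl u) => // t /=; rewrite !in_itv /= => /andP[-> /ltW].
  rewrite /prim -Rintegral_itv_bndo_bndc// -Rint_patch -RintegralZr//; last exact: intgT_patch.
  rewrite EFin_Rint//; apply: (@intg_ext _ (fun y => c * (f \_ `[0, u[) y)) => //.
    by move=> t _; rewrite mulrC.
  by apply: intgZ => //; exact: intgT_patch.
have E1 : fubini_F mu (EFin \o h P1) = EFin \o (fun x => F x * prim g x).
  apply/funext => x; rewrite /fubini_F /=.
  have [xT|xT] := boolP (x \in `[0, T]); last first.
    have F0 : F x = 0 by rewrite /F patchE memNset//; exact/negP.
    rewrite F0 mul0r; apply: integral0_eq => y _.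
    by rewrite /h /= F0 !mul0r.
  rewrite -gprim//; apply: eq_integral => y _; congr EFin.
  rewrite /h /= -mulrA; congr (_ * _); rewrite /G !patchE indicE.
  have -> : ((x, y) \in P1) = (y <= x) by apply/idP/idP => [/set_mem//|?]; rewrite inE.
  move: xT; rewrite in_itv /= => /andP[x0 xT].
  rewrite !mem_setE !in_itv /=; case: (leP 0 y) => //= y0; last by rewrite mul0r.
  case: (leP y x) => yx; last by rewrite mulr0.
  by rewrite (le_trans yx xT) mulr1.
have E2 : fubini_G mu (EFin \o h P2) = EFin \o (fun x => prim f x * G x).
  apply/funext => y; rewrite /fubini_G /=.
  have [yT|yT] := boolP (y \in `[0, T]); last first.
    have G0 : G y = 0 by rewrite /G patchE memNset//; exact/negP.
    rewrite G0 mulr0; apply: integral0_eq => x _.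
    by rewrite /h /= G0 !(mulr0, mul0r).
  rewrite -fprim//; apply: eq_integral => x _; congr EFin.
  rewrite /h /= mulrAC; congr (_ * _); rewrite /F !patchE indicE.
  have -> : ((x, y) \in P2) = (x < y) by apply/idP/idP => [/set_mem//|?]; rewrite inE.
  move: yT; rewrite in_itv /= => /andP[y0 yT].
  rewrite !mem_setE !in_itv /=; case: (leP 0 x) => //= x0; last by rewrite mul0r.
  case: (ltP x y) => xy; last by rewrite mulr0.
  by rewrite (le_trans (ltW xy) yT) mulr1.
have E0 : fubini_F mu (EFin \o (fun z => F z.1 * G z.2)) =
    EFin \o (fun x => F x * prim g T).
  apply/funext => x; rewrite /fubini_F /=.
  rewrite /prim -Rint_patch -RintegralZl// EFin_Rint//; exact: intgZ.
have i1 := intg_mul_prim fl gl T.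
have i2 : intg `[0, T] (fun t => prim f t * g t).
  by apply: intg_ext (intg_mul_prim gl fl T) => // t _; rewrite mulrC.
rewrite RintegralD//; apply: EFin_inj.
rewrite EFinD !EFin_Rint//.
have J0 : (\int[mu]_x (F x * prim g T)%:E)%E = (\int[mu \x mu]_z (F z.1 * G z.2)%:E)%E.
  rewrite -[RHS](integral12_prod_meas1 ki); apply: eq_integral => x _.
  exact: (esym (congr1 (@^~ x) E0)).
have J1 : (\int[mu]_x (F x * prim g x)%:E)%E = (\int[mu \x mu]_z (h P1 z)%:E)%E.
  rewrite -[RHS](integral12_prod_meas1 h1i); apply: eq_integral => x _.
  exact: (esym (congr1 (@^~ x) E1)).
have J2 : (\int[mu]_x (prim f x * G x)%:E)%E = (\int[mu \x mu]_z (h P2 z)%:E)%E.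
  rewrite -[RHS](integral21_prod_meas1 h2i); apply: eq_integral => x _.
  exact: (esym (congr1 (@^~ x) E2)).
move: sumE; rewrite -J0 -J1 -J2.
rewrite /= -EFin_Rint//; last first.
  apply: (@intg_ext _ (fun x => prim g T * F x)) => //.
    by move=> t _; rewrite mulrC.
  exact: intgZ.
rewrite RintegralZr// Rint_patch => ->.
congr (_ + _)%E; rewrite [RHS]integral_mkcond; apply: eq_integral => x _.
  by rewrite /F !patchE; case: ifP => // _; rewrite mul0r.
by rewrite /G !patchE; case: ifP => // _; rewrite mulr0.
Qed.
End RealIntegral.

(** * Smooth functions and the du Bois-Reymond lemma *)

Section SmoothBump.
Variable R : realType.
Local Notation mu := (@lebesgue_measure R).

(** Differentiability of the functions [expinv k] at 0, where their two branches meet, rests on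
    this: the difference quotient is at most [M |h|]. *)
Lemma is_derive0_quadratic (f : R -> R) (M : R) :
  (forall t, `|f t| <= M * t ^+ 2) -> is_derive (0 : R) 1 f 0.
Proof.
move=> fM; have f0 : f 0 = 0.
  by apply/eqP; rewrite -normr_le0 (le_trans (fM 0))// expr0n mulr0.
have lim0 : (fun h : R => h^-1 *: ((f \o shift 0) (h *: 1) - f 0)) @ 0^' --> (0 : R).
  apply/cvgr0Pnorm_le => e e0; near=> h.
  rewrite f0 subr0 /= addr0 [h *: 1]mulr1 normrZ normfV.
  have h0 : 0 < `|h| by rewrite normr_gt0; near: h; exact: nbhs_dnbhs_neq.
  rewrite mulrC ler_pdivrMr// (le_trans (fM h))//.
  rewrite -real_normK ?num_real// expr2 mulrA ler_wpM2r//.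
  have : `|h| <= e / (`|M| + 1).
    by near: h; apply: dnbhs0_le; rewrite divr_gt0// ltr_pwDr.
  rewrite ler_pdivlMr ?ltr_pwDr// mulrC; apply: le_trans.
  by rewrite ler_wpM2r// (le_trans (ler_norm _))// lerDl.
apply: DeriveDef; first by apply/cvg_ex; exists 0.
exact/cvg_lim.
Unshelve. all: by end_near. Qed.

(** The powers of [t^-1] are those that differentiating [exp(-1/t)] produces: up to linear
    combinations the family is closed under differentiation. *)
Definition expinv (k : nat) (t : R) : R :=
  if 0 < t then (t^-1) ^+ k * expR (- t^-1) else 0.

Lemma expinv_ge0 k t : 0 <= expinv k t.
Proof.
rewrite /expinv; case: ifPn => // t0.
by rewrite mulr_ge0 ?expR_ge0// exprn_ge0// invr_ge0 ltW.
Qed.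

(** With [s = t^-1], one term of the exponential series gives [s^(k+2) <= (k+2)! e^s]; dividing by
    [s^2 e^s] yields the bound. *)
Lemma expinv_quadratic k t : `|expinv k t| <= (k.+2)`!%:R * t ^+ 2.
Proof.
rewrite ger0_norm ?expinv_ge0// /expinv; case: ifPn => t0; last first.
  by rewrite mulr_ge0// ?sqr_ge0.
have s0 : 0 < t^-1 by rewrite invr_gt0.
have fp : 0 < (k.+2)`!%:R :> R by rewrite ltr0n fact_gt0.
have := expR_ge1Dxn k.+1 (ltW s0); set s := t^-1 => Hs.
have {}Hs : s ^+ k.+2 <= (k.+2)`!%:R * expR s.
  by rewrite mulrC -ler_pdivrMr// (le_trans _ Hs)// lerDr.
rewrite expRN ler_pdivrMr ?expR_gt0//.
have -> : t ^+ 2 = s ^- 2 by rewrite /s exprVn invrK.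
rewrite mulrAC ler_pdivlMr ?exprn_gt0//.
by rewrite -exprD addn2.
Qed.

Lemma is_derive_expinv k (t : R) :
  is_derive t (1 : R) (expinv k) (expinv k.+2 t - k%:R * expinv k.+1 t).
Proof.
have [t0|t0|->] := ltgtP t 0.
- rewrite /expinv ltNge (ltW t0) /= mulr0 subr0.
  apply: (@near_eq_is_derive _ _ _ (cst 0)).
  near=> u; rewrite ifF//; apply/negbTE; rewrite -leNgt.
  apply: ltW; near: u; exact: lt_nbhsl.
- have tn0 : t != 0 by rewrite gt_eqF.
  apply: (@near_eq_is_derive R R R (fun u : R => (u^-1) ^+ k * expR (- u^-1))).
    near=> u; rewrite /expinv ifT//; near: u; exact: lt_nbhsr.
  have dV : is_derive t 1 (fun u : R => u^-1) (- t ^- 2).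
    by apply: is_derive_eq (is_deriveV (f:=id) (t:=1) _ _) _ => //; rewrite [LHS]mulr1.
  have dX : is_derive t 1 ((fun u : R => u^-1) ^+ k) ((k%:R * t^-1 ^+ k.-1) *: (- t ^- 2)).
    exact: is_deriveX.
  have dE : is_derive t 1 (expR \o (- (fun u : R => u^-1))) (expR (- t^-1) * (- (- t ^- 2))).
    by apply: is_derive1_comp.
  have := is_deriveM dX dE.
  have -> : (fun u : R => u^-1) ^+ k * (expR \o (- (fun u : R => u^-1))) =
     (fun u => (u^-1) ^+ k * expR (- u^-1)).
    by apply/funext => u; rewrite /= !fctE.
  move=> h; apply: (is_derive_eq h); rewrite /expinv t0 /= !fctE /=.
  rewrite /GRing.scale /= -exprVn; set s := t^-1; set E := expR _.
  case: k {dX h} => [|k] /=; first by rewrite !mul0r mulr0 subr0 addr0; ring.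
  by rewrite !exprS; ring.
- rewrite /expinv ltxx mulr0 subr0.
  exact: is_derive0_quadratic (expinv_quadratic k).
Unshelve. all: by end_near. Qed.

(** A class closed under differentiation, so that smoothness of all orders follows by induction from
    first derivatives alone. Constants, sums and products are included because bumps are multiplied
    and corrected by multiples of each other below. *)
Inductive elementary : (R -> R) -> Prop :=
| elementary_expinv k a b : elementary (fun t => expinv k (a * t + b))
| elementary_cst c : elementary (cst c)
| elementaryD f g : elementary f -> elementary g -> elementary (f + g)
| elementaryM f g : elementary f -> elementary g -> elementary (f * g).

Lemma elementary_derive f : elementary f ->
  exists2 g, elementary g & forall t : R, is_derive t (1 : R) f (g t).
Proof.
elim=> [k a b|c|{}f g ef [f' ef' df] eg [g' eg' dg]|{}f g ef [f' ef' df] eg [g' eg' dg]].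
- exists (cst a * ((fun t => expinv k.+2 (a * t + b)) +
    cst (- k%:R) * (fun t => expinv k.+1 (a * t + b)))).
    by do !constructor.
  move=> t; have dl : is_derive t 1 (fun u : R => a * u + b) a.
    have -> : (fun u : R => a * u + b) = a \*: id + cst b by [].
    by apply: is_derive_eq; rewrite addr0 [LHS]mulr1.
  have := @is_derive1_comp R (expinv k) (fun u : R => a * u + b) t _ _
    (is_derive_expinv k (a * t + b)) dl.
  by move=> h; apply: (is_derive_eq h); rewrite !fctE /=; ring.
- by exists (cst 0); [constructor|move=> t; exact: is_derive_cst].
- by exists (f' + g'); [constructor|move=> t; exact: is_deriveD].
- exists (f * g' + g * f'); first by do !constructor.
  by move=> t; exact: is_deriveM.
Qed.

Lemma elementary_smooth f : elementary f ->
  forall (k : nat) t, derivable (derive1n k f) t 1.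
Proof.
move=> + k; elim: k f => [|k IHk] f ef t.
  by have [g _ /(_ t)[]] := elementary_derive ef.
have [g eg df] := elementary_derive ef.
rewrite /derive1n iterSr (_ : derive1 f = g); first exact: IHk.
by apply/funext => u; rewrite derive1E; have [] := df u.
Qed.

Lemma elementary_continuous f : elementary f -> continuous f.
Proof.
move=> ef t; apply/differentiable_continuous/derivable1_diffP.
by have [g _ /(_ t)[]] := elementary_derive ef.
Qed.

(** The parameter [n] steepens the flanks at [a] and [b] without enlarging the support: the values
    stay in [0, 1] and converge pointwise to the indicator of the open interval. *)
Definition bump (n : nat) (a b t : R) : R :=
  expinv 0 (n%:R * (t - a)) * expinv 0 (n%:R * (b - t)).

Lemma elementary_bump n a b : elementary (bump n a b).
Proof.
have -> : bump n a b = (fun t => expinv 0 (n%:R * t + (- (n%:R * a)))) *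
    (fun t => expinv 0 (- n%:R * t + n%:R * b)).
  apply/funext => t; rewrite /bump !fctE; congr (expinv _ _ * expinv _ _); ring.
by do !constructor.
Qed.

Lemma bump_ge0 n a b t : 0 <= bump n a b t.
Proof. by rewrite mulr_ge0 ?expinv_ge0. Qed.

Lemma expinv0_le1 t : expinv 0 t <= 1.
Proof.
rewrite /expinv; case: ifPn => // t0; rewrite expr0 mul1r.
by rewrite expR_le1 oppr_le0 invr_ge0 ltW.
Qed.

Lemma bump_le1 n a b t : bump n a b t <= 1.
Proof. by rewrite mulr_ile1 ?expinv_ge0 ?expinv0_le1. Qed.

Lemma bump_out n a b t : t <= a \/ b <= t -> bump n a b t = 0.
Proof.
have N (x y : R) : x <= y -> expinv 0 (n%:R * (x - y)) = 0.
  move=> xy; rewrite /expinv ifF//; apply/negbTE; rewrite -leNgt.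
  by rewrite mulr_ge0_le0// subr_le0.
by rewrite /bump => -[/N|/N] ->; rewrite ?mul0r ?mulr0.
Qed.

Lemma bump_cvg a b t : (fun n => bump n a b t) @ \oo --> (\1_(`]a, b[) t : R).
Proof.
have N (x : R) : 0 < x -> (fun n : nat => expinv 0 (n%:R * x)) @ \oo --> (1 : R).
  move=> x0; have h0 : (fun n : nat => - (n%:R * x)^-1) @ \oo --> (0 : R).
    rewrite -oppr0; apply: cvgN.
    rewrite (_ : (fun n : nat => _) = (fun n => n%:R^-1 * x^-1)); last first.
      by apply/funext => n; rewrite invfM.
    rewrite (_ : nbhs 0 = nbhs (0 * x^-1)); last by rewrite mul0r.
    apply: cvgMl; apply/gtr0_cvgV0; last exact: cvgr_idn.
    by near=> n; rewrite ltr0n; near: n; exact: nbhs_infty_gt.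
  have h1 : (fun n : nat => expR (- (n%:R * x)^-1)) @ \oo --> (1 : R).
    have := continuous_cvg _ (@continuous_expR R 0) h0.
    by rewrite expR0; apply.
  apply: cvg_trans h1; apply: near_eq_cvg; near=> n.
  rewrite /expinv ifT ?expr0 ?mul1r//.
  by rewrite mulr_gt0// ltr0n; near: n; exact: nbhs_infty_gt.
rewrite indicE; have [|] := boolP (t \in `]a, b[).
  move=> tab; rewrite mem_setE tab /=; move: tab; rewrite in_itv /= => /andP[at_ tb].
  by rewrite -[1%:R]mulr1; apply: cvgM; apply: N; rewrite subr_gt0.
move=> tab; rewrite mem_setE (negbTE tab) /=.
rewrite (_ : (fun n => _) = cst 0); first exact: cvg_cst.
apply/funext => n; apply: bump_out; move: tab; rewrite in_itv /= negb_and -!leNgt.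
by move=> /orP.
Unshelve. all: by end_near. Qed.

End SmoothBump.

(** * Weak derivatives on the half-line *)

Section DuBoisReymond.
Variable R : realType.
Local Notation mu := (@lebesgue_measure R).
Implicit Types (f g : R -> R).

Lemma test_function_itv (phi : R -> R) : test_function phi ->
  exists2 b, 0 < b & forall t, t <= 0 \/ b <= t -> phi t = 0 /\ derive1 phi t = 0.
Proof.
(* The bound lies strictly beyond the support, so that [phi] vanishes near every [t] past it and its
   derivative vanishes as well. *)
move=> [_ [a a0 [b ab]]]; exists (Num.max b 0 + 1).
  by rewrite ltr_pwDr// le_max lexx orbT.
have out t : t < a \/ b < t -> phi t = 0.
  move=> tab; apply/eqP/negPn/negP => /ab; case: tab => ?.
    by rewrite leNgt (_ : t < a).
  by rewrite [t <= b]leNgt (_ : b < t) ?andbF.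
move=> t tab.
have {tab} [ta|bt] : t < a \/ b < t.
  case: tab => [t0|tb]; [left|right]; first exact: le_lt_trans a0.
  by rewrite (lt_le_trans _ tb)// ltr_pwDr// le_max lexx.
- split; first by apply: out; left.
  rewrite derive1E (@near_eq_derive _ _ _ _ (cst 0)) ?derive_cst//.
  near=> u; apply: out; left; near: u; exact: lt_nbhsl.
- split; first by apply: out; right.
  rewrite derive1E (@near_eq_derive _ _ _ _ (cst 0)) ?derive_cst//.
  near=> u; apply: out; right; near: u; exact: lt_nbhsr.
Unshelve. all: by end_near. Qed.

Lemma test_function_continuous (phi : R -> R) : test_function phi ->
  continuous phi /\ continuous (derive1 phi).
Proof.
move=> [d _]; split=> t; apply/differentiable_continuous/derivable1_diffP.
  exact: (d 0%N).
exact: (d 1%N).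
Qed.

Lemma continuous_intg f : continuous f -> loc_intg f.
Proof.
move=> cf b; apply: continuous_compact_integrable; first exact: segment_compact.
by apply: continuous_subspaceT => x; exact: cf.
Qed.

Lemma continuous_bounded f (b : R) : continuous f ->
  exists M, forall t, `[0, b]%classic t -> `|f t| <= M.
Proof.
move=> cf; have : compact [set f t | t in `[0, b]].
  apply: continuous_compact; last exact: segment_compact.
  by apply: continuous_subspaceT => x; exact: cf.
move=> /compact_bounded[M [_ HM]]; exists (M + 1) => t tb.
by apply: HM; [rewrite ltrDl|exists t].
Qed.

Lemma measurable_continuous f D : measurable D -> continuous f -> measurable_fun D f.
Proof.
move=> mD cf; apply: (@measurable_funS _ _ _ _ setT) => //.
exact: continuous_measurable_fun.
Qed.

Lemma test_function_prim (phi : R -> R) t : test_function phi -> 0 <= t ->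
  phi t = prim (derive1 phi) t.
Proof.
move=> tphi; have [cphi cphi'] := test_function_continuous tphi.
have [b _ out] := test_function_itv tphi.
have phi0 : phi 0 = 0 by apply: (proj1 (out 0 _)); left.
rewrite le_eqVlt => /predU1P[<-|t0].
  by rewrite phi0 /prim set_itv1 Rintegral_set1.
rewrite /prim /Rintegral (@continuous_FTC2 _ _ phi)// ?phi0 ?oppr0 ?subr0//=.
- by rewrite subr0.
- by apply: continuous_subspaceT => x; exact: cphi'.
- split.
  + by move=> x _; have [d _] := tphi; exact: (d 0%N).
  + by apply: cvg_at_right_filter; exact: cphi.
  + by apply: cvg_at_left_filter; exact: cphi.
Qed.

Lemma Rint_half_line f (b : R) :
  (forall t, b < t -> f t = 0) ->
  \int[mu]_(t in half_line) f t = \int[mu]_(t in `[0, b]) f t.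
Proof.
move=> out; rewrite Rintegral_mkcond [RHS]Rintegral_mkcond.
apply: eq_Rintegral => t _; rewrite !patchE.
have [tb|bt] := leP t b; last first.
  by rewrite out//; case: ifP; case: ifP.
congr (if _ then _ else _); apply/idP/idP => /set_mem; rewrite inE /half_line /= !in_itv /=.
  by rewrite andbT tb andbT.
by rewrite andbT => /andP[].
Qed.

(** This is [prim_mul] for [derive1 phi] and [g] on a segment reaching past the support of [phi]:
    the product [phi b * prim g b] and the contribution [c * phi b] of the constant both vanish. *)
Lemma ibp_test f g (c : R) (phi : R -> R) : loc_intg g ->
  measurable_fun half_line f ->
  {ae mu, forall t, half_line t -> f t = c + prim g t} -> test_function phi ->
  \int[mu]_(t in half_line) (derive1 phi t * f t) =
  - \int[mu]_(t in half_line) (phi t * g t).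
Proof.
move=> gl mf fE tphi; have [cphi cphi'] := test_function_continuous tphi.
have [b b0 out] := test_function_itv tphi.
rewrite !(@Rint_half_line _ b); last 2 first.
- by move=> t bt; rewrite (proj1 (out t _)) ?mul0r//; right; exact: ltW.
- by move=> t bt; rewrite (proj2 (out t _)) ?mul0r//; right; exact: ltW.
have li : loc_intg (derive1 phi) by exact: continuous_intg.
have mphi' : measurable_fun `[0, b] (derive1 phi) by exact: measurable_continuous.
rewrite (@Rint_ae _ _ _ (fun t => c * derive1 phi t + derive1 phi t * prim g t))//; last 3 first.
- apply: measurable_funM => //.
  by apply: measurable_funS mf => //; [exact: half_line0|exact: sub_half_line].
- apply: measurable_funD; apply: measurable_funM => //; exact: measurable_prim.
- apply: (aeS fE) => t {}fE tb.
  by rewrite fE; [ring|exact: sub_half_line tb].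
have i1 := intg_mul_prim li gl b.
have [M HM] := continuous_bounded b cphi.
have i2 : intg `[0, b] (fun t => phi t * g t).
  apply: (@intg_ext _ _ (fun t => g t * phi t)) => //; first by move=> t _; rewrite mulrC.
  by apply: (intg_mul_bounded _ (gl b) _ HM) => //; exact: measurable_continuous.
rewrite RintegralD//; last exact: intgZ.
rewrite (_ : \int[mu]_(x in _) (c * _) = c * prim (derive1 phi) b); last first.
  by rewrite /prim -RintegralZl//; exact: li.
rewrite -test_function_prim ?ltW//.
rewrite (proj1 (out b _)) ?mulr0 ?add0r//; last by right.
have := prim_mul b li gl; rewrite -test_function_prim ?ltW//.
rewrite (proj1 (out b _)) ?mul0r//; last by right.
rewrite RintegralD//; last first.
  apply: (@intg_ext _ _ (fun t => phi t * g t)) => // t.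
  by rewrite /= in_itv /= => /andP[t0 _]; rewrite -test_function_prim.
rewrite (@Rint_ext _ _ (fun t => prim _ t * g t) (fun t => phi t * g t)); last first.
  by move=> t; rewrite /= in_itv /= => /andP[t0 _]; rewrite -test_function_prim.
by move/esym/eqP; rewrite addr_eq0 => /eqP.
Qed.

(** The primitive of [h] vanishes before [a] because [h] does, and after [b] because the total
    integral of [h] is 0. *)
Lemma prim_test (h : R -> R) (a b : R) : elementary h -> 0 < a -> a < b ->
  (forall t, t <= a \/ b <= t -> h t = 0) ->
  \int[mu]_(t in half_line) h t = 0 ->
  exists2 phi, test_function phi & derive1 phi = h.
Proof.
move=> eh a0 ab out h0; have ch := elementary_continuous eh.
have ih u : intg `]-oo, u] h.
  have : intg `]-oo, u] (h \_ `[a, b]).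
    apply/intg_patch => //; apply: (@intgS _ _ `[0, b]) => //.
      exact: measurableI.
      move=> t [_] /=; rewrite !in_itv /= => /andP[at_ ->].
      by rewrite (le_trans _ at_)// ltW.
    exact: continuous_intg.
  apply: intg_ext => // t _; rewrite patchE; case: ifPn => // /negP tab.
  apply/esym/out; apply/orP; rewrite !leNgt -negb_and; apply/negP => /andP[ta tb].
  by apply: tab; rewrite inE /= in_itv /= !ltW.
(* Integrating from minus infinity rather than from 0 makes the fundamental theorem apply at every
   real [t], as [test_function] demands. *)
pose phi (t : R) := \int[mu]_(s in `]-oo, t]) h s.
have dphi t : derivable phi t 1 /\ derive1 phi t = h t.
  have tt1 : t < t + 1 by rewrite ltrDl.
  exact: (@continuous_FTC1 R h -oo%O t (t + 1) tt1 (ih _) (ltNyr t) (ch t)).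
have phi'E : derive1 phi = h by apply/funext => t; exact: (dphi t).2.
exists phi => //; split.
  case=> [|k] t; first exact: (dphi t).1.
  by rewrite /derive1n iterSr phi'E; exact: elementary_smooth.
exists a => //; exists b => t phit0; apply/andP; split; rewrite leNgt; apply: contra phit0.
  move=> ta; apply/eqP; rewrite /phi (@Rint_ext _ _ _ (cst 0)).
    by rewrite Rintegral_cst// mul0r.
  move=> s; rewrite /= in_itv /= => st; apply: out; left.
  exact: le_trans st (ltW ta).
move=> bt; apply/eqP; rewrite /phi -h0 Rintegral_mkcond [RHS]Rintegral_mkcond.
apply: eq_Rintegral => s _; rewrite !patchE.
have [sa|as_] := leP s a; first by rewrite out; [do 2 case: ifP|left].
have [bs|sb] := leP b s; first by rewrite out; [do 2 case: ifP|right].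
rewrite !mem_set//; first by apply/half_lineP/ltW; exact: lt_trans as_.
by rewrite /= in_itv /= ltW// (lt_trans sb).
Qed.

Lemma Rint_dominated D (f_ : nat -> R -> R) f g : measurable D ->
  (forall n, measurable_fun D (f_ n)) -> measurable_fun D f ->
  {ae mu, forall t, D t -> (fun n => f_ n t) @ \oo --> f t} ->
  intg D g -> {ae mu, forall t, D t -> forall n, `|f_ n t| <= g t} ->
  intg D f /\
  (fun n => \int[mu]_(t in D) f_ n t) @ \oo --> \int[mu]_(t in D) f t.
Proof.
move=> mD mf_ mf cf ig fg.
have := @dominated_convergence _ _ R mu D mD (fun n t => (f_ n t)%:E)
  (fun t => (f t)%:E) (fun t => (g t)%:E).
case=> [n|||||i1 _ lim].
- by apply/measurable_EFinP; exact: mf_.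
- exact/measurable_EFinP.
- apply: (aeS cf) => t {}cf Dt.
  by apply: cvg_EFin; [exact: nearW|exact: cf].
- exact: ig.
- apply: (aeS fg) => t {}fg n Dt.
  by rewrite lee_fin fg.
split; first exact: i1.
apply: fine_cvg; rewrite EFin_Rint//; exact: lim.
Qed.

Lemma Rint_cst_itv (a b c : R) : a <= b ->
  \int[mu]_(t in `[a, b]) (cst c t : R) = c * (b - a).
Proof.
move=> ab; rewrite Rintegral_cst//; congr (_ * _).
have : fine (@lebesgue_measure R `[a, b]) = b - a; last by [].
rewrite lebesgue_measure_itv /= lte_fin.
by case: ltgtP ab => // -> _; rewrite subrr.
Qed.

(** Dominated convergence with bound [|f|]; the limit is the integral over the open interval, which
    equals that over the closed one. *)
Lemma bump_limit f (a b : R) : loc_intg f -> 0 <= a -> a <= b ->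
  (fun n => \int[mu]_(t in half_line) (bump n a b t * f t)) @ \oo -->
  \int[mu]_(t in `[a, b]) f t.
Proof.
move=> fl a0 ab; have fb := fl b.
rewrite (_ : (fun n => _) = (fun n => \int[mu]_(t in `[0, b]) (bump n a b t * f t))); last first.
  apply/funext => n; apply: Rint_half_line => t bt.
  by rewrite bump_out ?mul0r//; right; exact: ltW.
have mb n : measurable_fun `[0, b] (bump n a b).
  by apply: measurable_continuous => //; exact/elementary_continuous/elementary_bump.
have mf := intg_meas fb.
have mab : measurable (`]a, b[ : set R) by [].
have mlim : measurable_fun `[0, b] (fun t => \1_(`]a, b[) t * f t).
  apply: measurable_funM => //.
have [//|||||_ lim] := @Rint_dominated `[0, b] (fun n t => bump n a b t * f t)
  (fun t => \1_(`]a, b[) t * f t) (fun t => `|f t|) _ _ mlim.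
- by move=> n; exact: measurable_funM.
- by apply: aeW => t _; apply: cvgMl; exact: bump_cvg.
- exact: intg_norm.
- apply: aeW => t _ n; rewrite normrM ger0_norm ?bump_ge0//.
  by rewrite ler_piMl// bump_le1.
have -> // : \int[mu]_(t in `[a, b]) f t = \int[mu]_(t in `[0, b]) (\1_(`]a, b[) t * f t).
rewrite -Rintegral_itv_obnd_cbnd; last first.
  apply: intgS fb => // t /=; rewrite !in_itv /= => /andP[at_ ->].
  by rewrite (le_trans a0 (ltW at_)).
rewrite -Rintegral_itv_bndo_bndc; last first.
  apply: intgS fb => // t /=; rewrite !in_itv /= => /andP[at_ /ltW->].
  by rewrite (le_trans a0 (ltW at_)).
rewrite Rintegral_mkcond [RHS]Rintegral_mkcond; apply: eq_Rintegral => t _.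
rewrite !patchE indicE; case: ifPn => [tab|]; last by case: ifP => //; rewrite mul0r.
rewrite mul1r ifT//; move/set_mem: tab; rewrite inE /= !in_itv /= => /andP[at_ /ltW->].
by rewrite (le_trans a0 (ltW at_)).
Qed.

Lemma measurable_half_line f : (forall b : R, measurable_fun `[0, b] f) ->
  measurable_fun half_line f.
Proof.
move=> mf; rewrite (_ : half_line = \bigcup_n `[0, n%:R]%classic); last first.
  apply/seteqP; split=> t; last by move=> [n _]; exact: sub_half_line.
  move=> /half_lineP t0; exists (Num.bound t) => //=.
  by rewrite in_itv /= t0 ltW// archi_boundP.
by apply/measurable_fun_bigcup.
Qed.

Lemma locally_integrable_patch f : loc_intg f ->
  locally_integrable [set: R] (f \_ half_line).
Proof.
move=> fl; split; [|exact: openT|].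
  apply/(measurable_restrictT _ _).1; first exact: half_line0.
  by apply: measurable_half_line => b; exact: intg_meas (fl _).
move=> K _ cK; have [M [_ HM]] := compact_bounded cK.
have mK : measurable K by apply: compact_measurable.
have KM : forall t, K t -> `|t| <= `|M| + 1.
  by move=> t Kt; apply: HM Kt; rewrite ltr_pwDr// ler_norm.
have /integrableP[_] : intg K (f \_ half_line).
  apply/intg_patch => //; first exact: half_line0.
  apply: intgS (fl (`|M| + 1)) => //; first by apply: measurableI => //; exact: half_line0.
  move=> t [Kt /half_lineP t0]; rewrite /= in_itv /= t0 /=.
  exact: le_trans (ler_norm _) (KM t Kt).
exact.
Qed.

(** Lebesgue's differentiation theorem, applied to [f] extended by 0 to the whole line. *)
Lemma prim_ae_derive f : loc_intg f ->
  {ae mu, forall t : R, 0 < t -> is_derive t (1 : R) (prim f) (f t)}.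
Proof.
move=> fl; have li := locally_integrable_patch fl.
have fl' b : intg `[0, b] (f \_ half_line).
  apply: intg_ext (fl b) => // t t0; rewrite patchE ifT// inE.
  exact: sub_half_line t0.
have := @FTC1 R (f \_ half_line) (BLeft 0) fl' li.
apply: (@filterS _ _ (ae_filter_ringOfSetsType mu)) => t /[swap] t0 H.
have [|] := H; first by rewrite lte_fin.
have -> : (fun x => \int[mu]_(u in [set` Interval (BLeft 0) (BRight x)])
   ((f \_ half_line) u)) = prim f.
  apply/funext => x; apply: Rint_ext => u u0; rewrite patchE ifT// inE.
  exact: sub_half_line u0.
rewrite patchE ifT; last by rewrite inE; apply/half_lineP/ltW.
move=> d; rewrite derive1E => e; exact: (DeriveDef d e).
Qed.

Lemma primB f (a b : R) : loc_intg f -> 0 <= a -> a <= b ->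
  prim f b - prim f a = \int[mu]_(t in `[a, b]) f t.
Proof.
move=> fl a0 ab; have fb := fl b.
rewrite /prim Rintegral_itvB// ?bnd_simp// Rintegral_itv_obnd_cbnd//.
apply: intgS fb => // t /=; rewrite !in_itv /= => /andP[at_ ->].
by rewrite (le_trans a0 (ltW at_)).
Qed.

Lemma ae_neq (x : R) : {ae mu, forall t : R, t != x}.
Proof.
exists [set x]; split => //; first exact: lebesgue_measure_set1.
by move=> t /= /negP; rewrite negbK => /eqP.
Qed.

(** Almost everywhere [f] is the derivative of its primitive, and the latter is locally constant on
    the open half-line. *)
Lemma prim_cst_ae0 f (c : R) : loc_intg f ->
  (forall t, 0 < t -> prim f t = c) -> {ae mu, forall t, half_line t -> f t = 0}.
Proof.
move=> fl fc; move: (prim_ae_derive fl) (ae_neq 0).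
apply: (@filterS2 _ _ (ae_filter_ringOfSetsType mu)) => t df tn0 /half_lineP t0.
have {}t0 : 0 < t by rewrite lt_neqAle eq_sym tn0.
have [_ <-] := df t0; rewrite (@near_eq_derive _ _ _ _ (cst c)) ?derive_cst//.
by near=> u; apply: fc; near: u; exact: lt_nbhsr.
Unshelve. all: by end_near. Qed.

Lemma Rint_itv_eq0_ae f : loc_intg f ->
  (forall a b, 0 < a -> a < b -> \int[mu]_(t in `[a, b]) f t = 0) ->
  {ae mu, forall t, half_line t -> f t = 0}.
Proof.
move=> fl f0; apply: (@prim_cst_ae0 _ (prim f 1)) => // t t0.
have [t1|t1|->//] := ltgtP t 1.
  apply/esym/eqP; rewrite -subr_eq0; apply/eqP.
  by rewrite primB ?f0 ?(ltW t0) ?(ltW t1).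
by apply/eqP; rewrite -subr_eq0; apply/eqP; rewrite primB ?f0 ?(ltW t1).
Qed.

Lemma Rint_bump_cvg (a b : R) : 0 <= a -> a <= b ->
  (fun n => \int[mu]_(t in half_line) bump n a b t) @ \oo --> b - a.
Proof.
move=> a0 ab; have := @bump_limit (cst (1 : R)) a b (continuous_intg (@cst_continuous R R 1)) a0 ab.
rewrite Rint_cst_itv// mul1r.
by under eq_fun do under eq_Rintegral do rewrite mulr1.
Qed.

Lemma intg_half_line_itv f (b : R) : intg `[0, b] f ->
  (forall t, b < t -> f t = 0) -> intg half_line f.
Proof.
move=> fi out; have mD := @half_line0 R.
have : intg half_line (f \_ `[0, b]).
  by apply/intg_patch => //; apply: intgS fi => //; exact: measurableI.
apply: intg_ext => // t /half_lineP t0; rewrite patchE; case: ifPn => // /negP tb.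
apply/esym/out; rewrite ltNge; apply/negP => tb'.
by apply: tb; rewrite inE /= in_itv /= t0.
Qed.

(** The constant is the mean of [f] against one fixed bump [chi]. Every other bump then integrates
    [f] to [c] times its own integral, and letting bumps tend to indicators gives integral 0 of
    [f - c] over every interval. *)
Lemma cst_of_weak_derivative0 f : loc_intg f ->
  (forall phi, test_function phi ->
     \int[mu]_(t in half_line) (derive1 phi t * f t) = 0) ->
  exists c, {ae mu, forall t, half_line t -> f t = c}.
Proof.
move=> fl f0.
(* The integrals tend to the length of [1, 2], so some bump on this interval has positive integral;
   only the sign matters, in order to divide by it. *)
have [N kN] : exists N, 0 < \int[mu]_(t in half_line) bump N 1 2 t.
  have /cvgr_gt : (fun n => \int[mu]_(t in half_line) bump n 1 2 t) @ \oo --> (2 - 1 : R).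
    by apply: Rint_bump_cvg => //; rewrite ler1n.
  move=> /(_ 0 (ltac:(lra))) [n _ Hn]; exists n; exact: Hn (leqnn n).
pose chi : R -> R := bump N 1 2; pose k := \int[mu]_(t in half_line) chi t.
rewrite -/chi -/k in kN.
pose c := (\int[mu]_(t in half_line) (chi t * f t)) / k.
exists c.
have mD := @half_line0 R.
have bumpfi n a b g : loc_intg g -> 0 < a ->
    intg half_line (fun t => bump n a b t * g t).
  move=> gl a0; apply: (@intg_half_line_itv _ b); last first.
    by move=> t bt; rewrite bump_out ?mul0r//; right; exact: ltW.
  apply: (@intg_le _ _ _ (fun t => `|g t|)) => //; last exact: intg_norm.
    apply: measurable_funM; last exact: intg_meas (gl b).
    by apply: measurable_continuous => //; exact/elementary_continuous/elementary_bump.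
  by move=> t _; rewrite normrM ger0_norm ?bump_ge0// ler_piMl// bump_le1.
have bumpi n (a b : R) : 0 < a -> intg half_line (bump n a b).
  move=> a0; have := bumpfi n a b (cst 1) (continuous_intg (@cst_continuous R R 1)) a0.
  by apply: intg_ext => // t _; rewrite mulr1.
(* A bump minus the multiple of [chi] with the same integral is the derivative
   of a test function. *)
have E n a b : 0 < a -> a < b ->
    \int[mu]_(t in half_line) (bump n a b t * f t) =
    c * \int[mu]_(t in half_line) bump n a b t.
  move=> a0 ab; set I := \int[mu]_(t in half_line) bump n a b t.
  pose h := bump n a b + cst (- (I / k)) * chi.
  have eh : elementary h := elementaryD (elementary_bump n a b)
    (elementaryM (elementary_cst _) (elementary_bump N 1 2)).
  have hE t : h t = bump n a b t - (I / k) * chi t by rewrite /h !fctE mulNr.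
  have [||||phi tphi dphi] := @prim_test h (Num.min a 1) (Num.max b 2) eh.
  - by rewrite lt_min a0 ltr01.
  - by rewrite lt_max gt_min ab.
  - move=> t H; rewrite hE /chi !bump_out ?mulr0 ?subr0//.
      by case: H; rewrite ?le_min ?ge_max => /andP[? ?]; [left|right].
    by case: H; rewrite ?le_min ?ge_max => /andP[? ?]; [left|right].
  - rewrite (@Rint_ext _ _ _ (fun t => bump n a b t - (I / k) * chi t)) => [|t _]; last exact: hE.
    rewrite RintegralB//; [|exact: bumpi|by apply: intgZ => //; exact: bumpi].
    by rewrite RintegralZl//; [rewrite -/k divfK ?gt_eqF// subrr|exact: bumpi].
  have := f0 _ tphi; rewrite dphi.
  rewrite (@Rint_ext _ _ _
    (fun t => bump n a b t * f t - (I / k) * (chi t * f t))) => [|t _]; last first.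
    by rewrite hE; ring.
  rewrite RintegralB//; [|exact: bumpfi|by apply: intgZ => //; exact: bumpfi].
  rewrite RintegralZl//; last exact: bumpfi.
  by move=> /eqP; rewrite subr_eq0 => /eqP ->; rewrite /c; ring.
have fcl : loc_intg (fun t => f t - c).
  by move=> b; apply: intgB => //; exact: (continuous_intg (@cst_continuous R R c)).
have fc0 : {ae mu, forall t, half_line t -> f t - c = 0}.
  apply: Rint_itv_eq0_ae => // a b a0 ab.
  have ia : intg `[a, b] f.
    apply: intgS (fl b) => // t /=; rewrite !in_itv /= => /andP[at_ ->].
    by rewrite (le_trans (ltW a0) at_).
  rewrite RintegralB//; last first.
    apply: intgS (continuous_intg (@cst_continuous R R c) b) => // t /=.
    by rewrite !in_itv /= => /andP[at_ ->]; rewrite (le_trans (ltW a0) at_).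
  rewrite Rint_cst_itv ?(ltW ab)//.
  apply/eqP; rewrite subr_eq0; apply/eqP.
  have l1 := bump_limit fl (ltW a0) (ltW ab).
  have l2 : (fun n => c * \int[mu]_(t in half_line) bump n a b t) @ \oo --> c * (b - a).
    by apply: cvgMr; apply: Rint_bump_cvg; exact: ltW.
  rewrite (_ : (fun n => _) =
    (fun n => c * \int[mu]_(t in half_line) bump n a b t)) in l1; last first.
    by apply/funext => n; exact: E.
  exact: cvg_unique l1 l2.
apply: (aeS fc0) => t {}fc0 t0.
by apply/eqP; rewrite -subr_eq0 fc0.
Qed.

(** By [ibp_test] the primitive of [g] has weak derivative [g], so [f - prim g] has weak derivative
    0 and is constant. *)
Lemma du_bois_reymond f g : loc_intg f -> loc_intg g ->
  (forall phi, test_function phi ->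
     \int[mu]_(t in half_line) (derive1 phi t * f t) =
     - \int[mu]_(t in half_line) (phi t * g t)) ->
  exists c, {ae mu, forall t, half_line t -> f t = c + prim g t}.
Proof.
move=> fl gl fg.
have mD := @half_line0 R.
have pl : loc_intg (prim g).
  move=> b; apply: (@intg_bounded _ _ _ (prim (fun u => `|g u|) b)) => //.
  - exact: muitv.
  - exact: measurable_prim.
  - by move=> t; rewrite /= in_itv /= => /andP[_]; exact: le_prim.
have mp : measurable_fun half_line (prim g).
  by apply: measurable_half_line => b; exact: measurable_prim.
have [b|phi tphi|c Hc] := @cst_of_weak_derivative0 (fun t => f t - prim g t).
- exact: intgB.
- have [cphi cphi'] := test_function_continuous tphi.
  have [b b0 out] := test_function_itv tphi.
  have ii h : loc_intg h -> intg half_line (fun t => derive1 phi t * h t).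
    move=> hl; apply: (@intg_half_line_itv _ b) => [|t bt]; last first.
      by rewrite (proj2 (out t _)) ?mul0r//; right; exact: ltW.
    have [M HM] := continuous_bounded b cphi'.
    apply: (@intg_ext _ _ (fun t => h t * derive1 phi t)) => //.
      by move=> t _; rewrite mulrC.
    by apply: (intg_mul_bounded _ (hl b) _ HM) => //; exact: measurable_continuous.
  under eq_Rintegral do rewrite mulrBr.
  rewrite RintegralB//; [|exact: ii|exact: ii].
  rewrite fg// (@ibp_test _ g 0) ?subrr//.
  by apply: aeW => t _; rewrite add0r.
- exists c; apply: (aeS Hc) => t {}Hc t0.
  by rewrite -(Hc t0) subrK.
Qed.


End DuBoisReymond.

(** * Square integrable functions are limits of absolutely continuous ones *)

Section Approximation.
Variable R : realType.
Local Notation mu := (@lebesgue_measure R).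
Implicit Types (f g : R -> R).

(** The approximants: [xi] is Lipschitz with derivative [zeta]. Vanishing outside the interval keeps
    [xi] a primitive starting at 0, so that approximants on adjacent intervals can be joined. *)
Definition prim_supported (a b : R) (xi zeta : R -> R) : Prop :=
  [/\ forall t, 0 <= t -> xi t = prim zeta t,
      forall t, t <= a \/ b <= t -> xi t = 0 /\ zeta t = 0,
      exists M, forall t, `|zeta t| <= M &
      measurable_fun half_line zeta].

(** The square of the distance; without the root, the triangle inequality costs a factor 2. *)
Definition L2dist (a b : R) f g := \int[mu]_(t in `[a, b]) (f t - g t) ^+ 2.

Definition square_intg D f := measurable_fun D f /\ intg D (fun t => f t ^+ 2).

Lemma square_intgM D f g : measurable D -> square_intg D f ->
  square_intg D g -> intg D (fun t => f t * g t).
Proof.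
move=> mD [mf f2] [mg g2].
apply: (@intg_le _ _ _ (fun t => f t ^+ 2 + g t ^+ 2)) => //.
- exact: measurable_funM.
- move=> t _; rewrite normrM -(real_normK (num_real (f t))) -(real_normK (num_real (g t))).
  have := sqr_ge0 (`|f t| - `|g t|); have := normr_ge0 (f t); have := normr_ge0 (g t).
  nra.
- exact: intgD.
Qed.

Lemma square_intgB D f g : measurable D -> square_intg D f ->
  square_intg D g -> square_intg D (fun t => f t - g t).
Proof.
move=> mD hf hg; have fg := square_intgM mD hf hg; move: hf hg => [mf f2] [mg g2].
split; first exact: measurable_funB.
apply: (@intg_ext _ _ (fun t => (f t ^+ 2 + g t ^+ 2) - 2 * (f t * g t))) => //.
  by move=> t _; ring.
by apply: intgB => //; [exact: intgD|exact: intgZ].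
Qed.

Lemma L2dist_triangle (a b : R) f g h : square_intg `[a, b] f ->
  square_intg `[a, b] g -> square_intg `[a, b] h ->
  L2dist a b f h <= 2 * (L2dist a b f g + L2dist a b g h).
Proof.
move=> hf hg hh.
have [_ fg] := square_intgB (measurable_itv `[a, b]) hf hg.
have [_ gh] := square_intgB (measurable_itv `[a, b]) hg hh.
have [_ fh] := square_intgB (measurable_itv `[a, b]) hf hh.
rewrite /L2dist -RintegralD// -RintegralZl//; last exact: intgD.
apply: le_Rintegral => //; first by apply: intgZ => //; exact: intgD.
move=> t _; have := sqr_ge0 ((f t - g t) - (g t - h t)); nra.
Qed.

Definition approximable (a b : R) f :=
  square_intg `[a, b] f /\
  forall e, 0 < e -> exists xi zeta, prim_supported a b xi zeta /\ L2dist a b f xi < e.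

Lemma prim_supported_loc (a b : R) xi zeta : prim_supported a b xi zeta ->
  loc_intg zeta.
Proof.
move=> [_ _ [M HM] mz] c; apply: (@intg_bounded _ _ _ M) => //; first exact: muitv.
by apply: measurable_funS mz => //; [exact: half_line0|exact: sub_half_line].
Qed.

Lemma prim_supported_square_intg (a b : R) xi zeta : 0 <= a ->
  prim_supported a b xi zeta -> square_intg `[a, b] xi.
Proof.
move=> a0 H; have zl := prim_supported_loc H; have [xE _ _ _] := H.
have sub : `[a, b] `<=` `[0, b].
  by move=> t /=; rewrite !in_itv /= => /andP[/(le_trans a0)-> ->].
have mx : measurable_fun `[a, b] xi.
  have mp : measurable_fun `[a, b] (prim zeta).
    by apply: measurable_funS sub (measurable_prim zl).
  apply: (eq_measurable_fun (prim zeta)) => //.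
  by move=> t /set_mem /sub; rewrite /= in_itv /= => /andP[t0 _]; rewrite xE.
split=> //; set M := prim (fun u => `|zeta u|) b.
apply: (@intg_bounded _ _ _ (M ^+ 2)) => //; first exact: muitv.
  by apply: measurable_funX.
move=> t /sub; rewrite /= in_itv /= => /andP[t0 tb].
have xM : `|xi t| <= M by rewrite xE//; exact: le_prim.
by rewrite normrX lerXn2r ?nnegrE// (le_trans _ xM).
Qed.

Lemma approximable_closed (a b : R) f : 0 <= a -> square_intg `[a, b] f ->
  (forall e, 0 < e -> exists g, approximable a b g /\ L2dist a b f g < e) ->
  approximable a b f.
Proof.
(* [L2dist_triangle] doubles the sum of the two errors, each below [e / 4]. *)
move=> a0 f2 H; split=> // e e0; have e4 : 0 < e / 4 by lra.
have [g [[g2 Hg] fg]] := H _ e4; have [xi [zeta [xz gx]]] := Hg _ e4.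
exists xi, zeta; split=> //; apply: le_lt_trans (L2dist_triangle f2 g2 _) _; last by lra.
exact: prim_supported_square_intg xz.
Qed.

Lemma L2dist_dominated (a b : R) (f_ : nat -> R -> R) f g :
  (forall n, measurable_fun `[a, b] (f_ n)) -> measurable_fun `[a, b] f ->
  {ae mu, forall t, `[a, b]%classic t -> (fun n => f_ n t) @ \oo --> f t} ->
  square_intg `[a, b] g ->
  (forall t, `[a, b]%classic t -> `|f t| <= g t) ->
  (forall n t, `[a, b]%classic t -> `|f_ n t| <= g t) ->
  forall e, 0 < e -> exists n, L2dist a b f (f_ n) < e.
Proof.
move=> mf_ mf cf [mg g2] fg f_g e e0.
have [//||||||_] := @Rint_dominated R `[a, b] (fun n t => (f t - f_ n t) ^+ 2) (cst 0)
  (fun t => 4 * g t ^+ 2).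
- by move=> n; apply: measurable_funX; exact: measurable_funB.
- exact: measurable_cst.
- apply: (aeS cf) => t {}cf tab.
  have -> : cst 0 t = (f t - f t) * (f t - f t) :> R by rewrite subrr mul0r.
  under eq_fun do rewrite expr2.
  by apply: cvgM; apply: cvgB; [exact: cvg_cst|exact: cf|exact: cvg_cst|exact: cf].
- exact: intgZ.
- apply: aeW => t tab n; have h1 := fg t tab; have h2 := f_g n t tab.
  rewrite normrX; have : `|f t - f_ n t| <= 2 * g t.
    by rewrite (le_trans (ler_normB _ _))//; lra.
  have := normr_ge0 (f t - f_ n t); nra.
rewrite Rintegral_cst// mul0r => /cvgr_lt /(_ e e0) [n _ Hn].
by exists n; exact: Hn (leqnn n).
Qed.

(** The Steklov means: averages of [c] over [[t, t + h]] with [h = 1 / (n + 1)]. They inherit the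
    bound of [c], have the continuous derivative [(c (t + h) - c t) / h], and converge to [c]. The
    antiderivative [G] starts at -1 so that derivatives at 0 are two-sided. *)
Lemma steklov (c : R -> R) (M : R) : continuous c -> (forall t, `|c t| <= M) ->
  exists S S' : nat -> R -> R,
  [/\ forall n (t : R), -1 < t -> is_derive t (1 : R) (S n) (S' n t),
      forall n (t : R), -1 < t -> {for t, continuous (S' n)},
      forall n (t : R), -1 < t -> `|S n t| <= M &
      forall t : R, -1 < t -> (fun n => S n t) @ \oo --> c t].
Proof.
move=> cc cM.
pose G (t : R) := \int[mu]_(s in `[-1, t]) c s.
have ic u v : intg `[u, v] c.
  apply: continuous_compact_integrable; first exact: segment_compact.
  by apply: continuous_subspaceT => x; exact: cc.
have dG (t : R) : -1 < t -> is_derive t (1 : R) G (c t).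
  move=> t1; have tt : t < t + 1 by rewrite ltrDl.
  have [d] := @continuous_FTC1_closed R c (-1) t (t + 1) tt (ic _ _) t1 (cc t).
  by rewrite derive1E => e; exact: (DeriveDef d e).
pose h n : R := n.+1%:R^-1.
have h0 n : 0 < h n by rewrite invr_gt0 ltr0n.
exists (fun n t => (h n)^-1 * (G (t + h n) - G t)).
exists (fun n t => (h n)^-1 * (c (t + h n) - c t)); split.
- move=> n t t1.
  have d1 : is_derive t (1 : R) (fun u => G (u + h n)) (c (t + h n)).
    have ds : is_derive t (1 : R) (fun u : R => u + h n) 1.
      have -> : (fun u : R => u + h n) = id + cst (h n) by [].
      by apply: is_derive_eq; rewrite addr0.
    have dG' : is_derive (t + h n) (1 : R) G (c (t + h n)).
      by apply: dG; rewrite (lt_trans t1)// ltrDl.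
    have := @is_derive1_comp R G (fun u : R => u + h n) t _ _ dG' ds.
    by move=> d; apply: (is_derive_eq d); rewrite mulr1.
  exact: is_deriveZ (is_deriveB d1 (dG t t1)).
- move=> n t t1; apply: cvgMr; apply: cvgB; last exact: cc.
  apply: (@continuous_comp _ _ _ (fun u : R => u + h n) c); last exact: cc.
  by apply: cvgD; [exact: cvg_id|exact: cvg_cst].
- move=> n t t1; rewrite normrM gtr0_norm ?invr_gt0// mulrC ler_pdivrMr//.
  have -> : G (t + h n) - G t = \int[mu]_(s in `]t, t + h n]) c s.
    rewrite /G Rintegral_itvB//; first exact: ic.
    + by rewrite bnd_simp ltW.
    + by rewrite bnd_simp lerDl ltW.
  have tth : t <= t + h n by rewrite lerDl ltW.
  rewrite Rintegral_itv_obnd_cbnd//; last first.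
    by apply: intgS (ic t (t + h n)) => // u; rewrite /= !in_itv /= => /andP[/ltW-> ->].
  rewrite (le_trans (le_normr_Rintegral _ _))//; first exact: ic.
  apply: (@le_trans _ _ (\int[mu]_(s in `[t, t + h n]) cst M s)); last first.
    by rewrite Rint_cst_itv// addrAC subrr add0r.
  apply: le_Rintegral => //; first exact: (intg_norm (ic _ _)).
  by apply: continuous_compact_integrable; [exact: segment_compact|exact: cst_continuous].
- move=> t t1; have [d e] := dG t t1.
  have hc : h @ \oo --> 0^'.
    have h00 : h @ \oo --> (0 : R) by exact: cvg_harmonic.
    move=> P HP; have H : \forall n \near \oo, h n != 0 -> P (h n) := h00 _ HP.
    by apply: filterS H => n; apply; rewrite gt_eqF.
  have := cvg_comp _ _ hc d; rewrite -[lim _]/('D_1 G t) e.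
  apply: cvg_trans; apply: near_eq_cvg; apply: nearW => n /=.
  by rewrite [_ *: 1]mulr1 [h n + t]addrC.
Qed.

(** Two limits, both dominated by the constant [M]: a bump times a Steklov mean is continuously
    differentiable with the right support; it tends to the bump times [c], and this in turn to [c]
    as the bump steepens. *)
Lemma approximable_continuous (a b : R) (c : R -> R) (M : R) : 0 <= a -> a < b ->
  continuous c -> (forall t, `|c t| <= M) -> approximable a b c.
Proof.
move=> a0 ab cc cM; have M0 : 0 <= M by exact: le_trans (cM 0).
have [S [S' [dS cS' SM cS]]] := steklov cc cM.
have mc : measurable_fun `[a, b] c by exact: measurable_continuous.
have msq f : measurable_fun `[a, b] f ->
    (forall t, `[a, b]%classic t -> `|f t| <= M) -> square_intg `[a, b] f.
  move=> mf fM; split=> //; apply: (@intg_bounded _ _ _ (M ^+ 2)) => //; first exact: muitv.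
    exact: measurable_funX.
  by move=> t tab; rewrite normrX lerXn2r ?nnegrE// fM.
have sqM : square_intg `[a, b] (cst M).
  by apply: msq => [|t _]; [exact: measurable_cst|rewrite /= ger0_norm].
have t1P t : `[a, b]%classic t -> -1 < t.
  by rewrite /= in_itv /= => /andP[at_ _]; rewrite (lt_le_trans _ (le_trans a0 at_)).
have cS0 n t : -1 < t -> {for t, continuous (S n)}.
  move=> t1; apply/differentiable_continuous/derivable1_diffP.
  by have [] := dS n t t1.
have mS n : measurable_fun `[a, b] (S n).
  apply: subspace_continuous_measurable_fun => //.
  by apply: continuous_in_subspaceT => t /set_mem /t1P; exact: cS0.
have mb n : measurable_fun `[a, b] (bump n a b).
  by apply: measurable_continuous => //; exact/elementary_continuous/elementary_bump.
have bM n f t : `|f t| <= M -> `|bump n a b t * f t| <= M.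
  by move=> fM; rewrite normrM ger0_norm ?bump_ge0// (le_trans _ fM)// ler_piMl// bump_le1.
have bS m n : approximable a b (fun t => bump m a b t * S n t).
  split.
    apply: msq => [|t tab]; first exact: measurable_funM.
    by apply: (bM _ (S n)); apply: SM; exact: t1P.
  move=> e e0; exists (fun t => bump m a b t * S n t).
  have [B' eB' dB] := elementary_derive (elementary_bump m a b).
  have cB' := elementary_continuous eB'.
  have cB := elementary_continuous (elementary_bump m a b).
  pose z t := bump m a b t * S' n t + S n t * B' t.
  (* Outside the open interval the bump attains its minimum 0, so its derivative vanishes there, end
     points included. *)
  have out t : t <= a \/ b <= t -> bump m a b t = 0 /\ B' t = 0.
    move=> tab; have b0 := bump_out m tab; split=> //.
    have [_ <-] := dB t.
    have : is_derive t (1 : R) (bump m a b) 0; last by case.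
    apply: (@derive1_at_min R (bump m a b) (t - 1) (t + 1) t); first lra.
    - by move=> u _; have [] := dB u.
    - by rewrite in_itv /=; lra.
    - by move=> u _; rewrite b0 bump_ge0.
  have cz (t : R) : -1 < t -> {for t, continuous z}.
    move=> t1; apply: cvgD; apply: cvgM.
    - exact: cB.
    - exact: cS'.
    - exact: cS0.
    - exact: cB'.
  have wz T : {within `[0, T], continuous z}.
    apply: continuous_in_subspaceT => t /set_mem.
    rewrite /= in_itv /= => /andP[t0 _]; apply: cz; lra.
  have dz (t : R) : -1 < t -> is_derive t (1 : R) (fun t => bump m a b t * S n t) (z t).
    by move=> t1; exact: is_deriveM (dB t) (dS n t t1).
  have cz0 (t : R) : -1 < t -> {for t, continuous (fun t => bump m a b t * S n t)}.
    move=> t1; apply/differentiable_continuous/derivable1_diffP.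
    by have [] := dz t t1.
  exists z; split; first split.
  - move=> t; rewrite le_eqVlt => /predU1P[<-|t0].
      by rewrite (out 0 _).1 ?mul0r ?/prim ?set_itv1 ?Rintegral_set1//; left.
    rewrite /prim /Rintegral (@continuous_FTC2 _ _ (fun t => bump m a b t * S n t))//.
    + by rewrite /= (out 0 (or_introl a0)).1 mul0r subr0.
    + split.
      * move=> x; rewrite in_itv /= => /andP[x0 _].
        have x1 : -1 < x by lra.
        by have [] := dz x x1.
      * by apply: cvg_at_right_filter; apply: cz0; lra.
      * by apply: cvg_at_left_filter; apply: cz0; lra.
    + move=> x; rewrite in_itv /= => /andP[x0 _].
      have x1 : -1 < x by lra.
      by rewrite derive1E; have [] := dz x x1.
  - by move=> t /out [b0 b'0]; rewrite /z b0 b'0 !mul0r mulr0 addr0.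
  - have : compact [set z t | t in `[0, b]].
      by apply: continuous_compact; [exact: wz|exact: segment_compact].
    move=> /compact_bounded[K [_ HK]]; exists (`|K| + 1) => t.
    have [ta|at_] := leP t a.
      by rewrite /z !(out t _).1 ?(out t _).2 ?mul0r ?mulr0 ?addr0 ?normr0 ?addr_ge0//; left.
    have [bt|tb] := leP b t.
      by rewrite /z !(out t _).1 ?(out t _).2 ?mul0r ?mulr0 ?addr0 ?normr0 ?addr_ge0//; right.
    apply: HK; first by rewrite ltr_pwDr// ler_norm.
    by exists t => //; rewrite /= in_itv /= (ltW tb) (le_trans a0 (ltW at_)).
  - by apply: measurable_half_line => T; exact: subspace_continuous_measurable_fun.
  rewrite /L2dist (@Rint_ext _ _ _ (cst 0)) => [|t _]; last by rewrite subrr expr0n.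
  by rewrite Rintegral_cst// mul0r.
have bc m : approximable a b (fun t => bump m a b t * c t).
  apply: approximable_closed => //.
    by apply: msq => [|t tab]; [exact: measurable_funM|exact: (bM _ c)].
  move=> e e0; have [||||||n Hn] := @L2dist_dominated a b
      (fun n t => bump m a b t * S n t) (fun t => bump m a b t * c t) (cst M) _ _ _ _ _ _ e e0.
  - by move=> n; exact: measurable_funM.
  - exact: measurable_funM.
  - by apply: aeW => t tab; apply: cvgMr; apply: cS; exact: t1P.
  - exact: sqM.
  - by move=> t _; exact: (bM _ c).
  - by move=> n t tab; apply: (bM _ (S n)); apply: SM; exact: t1P.
  - by exists (fun t => bump m a b t * S n t).
apply: approximable_closed => //; first exact: msq.
move=> e e0; have [||||||n Hn] := @L2dist_dominated a b
    (fun n t => bump n a b t * c t) c (cst M) _ _ _ _ _ _ e e0.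
- by move=> n; exact: measurable_funM.
- exact: mc.
- move: (ae_neq a) (ae_neq b).
  apply: (@filterS2 _ _ (ae_filter_ringOfSetsType mu)) => t ta tb tab.
  have ct : \1_(`]a, b[) t * c t = c t.
    rewrite indicE mem_set ?mul1r//; move: tab; rewrite /= !in_itv /= => /andP[at_ tb'].
    by rewrite !lt_neqAle eq_sym ta at_ tb tb'.
  have : (fun n => bump n a b t * c t) @ \oo --> \1_(`]a, b[) t * c t.
    by apply: cvgMl; exact: bump_cvg.
  by rewrite ct.
- exact: sqM.
- by move=> t _; exact: cM.
- by move=> n t _; exact: (bM _ c).
- by exists (fun t => bump n a b t * c t).
Qed.

(** Cutting off the values above height [n] reduces to bounded functions. A bounded function is an
    L1 limit of continuous ones, and between functions bounded by [M] the squared L2 distance is at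
    most [2 M] times the L1 distance. *)
Lemma square_intg_approximable (a b : R) f : 0 <= a -> a < b ->
  square_intg `[a, b] f -> approximable a b f.
Proof.
move=> a0 ab f2; have [mf if2] := f2.
have bounded (g : R -> R) (M : R) : 0 <= M -> measurable_fun `[a, b] g ->
    (forall t, `|g t| <= M) -> approximable a b g.
  move=> M0 mg gM.
  have ig : intg `[a, b] g.
    by apply: (@intg_bounded _ _ _ M) => //; exact: muitv.
  have g2 : square_intg `[a, b] g.
    split=> //; apply: (@intg_bounded _ _ _ (M ^+ 2)) => //; first exact: muitv.
      exact: measurable_funX.
    by move=> t _; rewrite normrX lerXn2r ?nnegrE.
  apply: approximable_closed => // e e0.
  have [//||h_ [ch ih lim]] := @approximation_continuous_integrable R `[a, b] g _ _ ig.
    exact: muitv.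
  (* The L1 error will be multiplied by [2 * M]; the added 1 keeps the denominator positive when
     [M = 0]. *)
  have e2 : 0 < e / (2 * M + 1) by rewrite divr_gt0//; lra.
  have [n Hn] : exists n, \int[mu]_(t in `[a, b]) `|g t - h_ n t| < e / (2 * M + 1).
    have : (fun n => \int[mu]_(t in `[a, b]) `|g t - h_ n t|) @ \oo --> (0 : R).
      by apply: fine_cvg; exact: lim.
    move=> /cvgr_lt /(_ _ e2) [n _ Hn].
    by exists n; exact: Hn (leqnn n).
  (* Clamping to [[-M, M]] gives a bounded continuous function and brings it no farther from [g],
     whose values lie in that interval. *)
  pose c t := Num.max (- M) (Num.min M (h_ n t)).
  have cc : continuous c.
    move=> t; apply: (@continuous_max _ R (cst (- M)) (fun u => Num.min M (h_ n u))).
      exact: cst_continuous.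
    by apply: (@continuous_min _ R (cst M) (h_ n)); [exact: cst_continuous|exact: ch].
  have cM t : `|c t| <= M.
    by rewrite ler_norml le_max lexx /= ge_max ge_min lexx /= andbT; lra.
  exists c; split; first exact: approximable_continuous cM.
  have ihn : intg `[a, b] (fun t => `|g t - h_ n t|).
    by apply: intg_norm; apply: intgB => //; exact: ih.
  apply: le_lt_trans (_ : 2 * M * \int[mu]_(t in `[a, b]) `|g t - h_ n t| < _).
    rewrite -RintegralZl//; apply: le_Rintegral => //.
    + apply: (square_intgB _ g2 _).2 => //.
      split; first exact: measurable_continuous.
      apply: (@intg_bounded _ _ _ (M ^+ 2)) => //; first exact: muitv.
        by apply: measurable_funX; exact: measurable_continuous.
      by move=> t _; rewrite normrX lerXn2r ?nnegrE.
    + exact: intgZ.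
    move=> t _; have := gM t; have := cM t; rewrite !ler_norml => /andP[c1 c2] /andP[g1 g2'].
    have : `|g t - c t| <= `|g t - h_ n t|.
      rewrite /c; have [hM|Mh] := leP (h_ n t) M; last first.
        rewrite max_r; last lra.
        by rewrite ler0_norm ?ler_normr; [apply/orP; right; lra|lra].
      have [hM'|Mh'] := leP (- M) (h_ n t); first by [].
      by rewrite ger0_norm ?ler_normr; [apply/orP; left; lra|lra].
    rewrite -(real_normK (num_real (g t - c t))).
    have : `|g t - c t| <= 2 * M by rewrite ler_norml; apply/andP; lra.
    have := normr_ge0 (g t - c t); nra.
  move: Hn; rewrite ltr_pdivlMr; last lra.
  have : 0 <= \int[mu]_(t in `[a, b]) `|g t - h_ n t| by apply: Rintegral_ge0.
  nra.
apply: approximable_closed => // e e0.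
pose f_ (n : nat) t := f t * \1_(`[- n%:R, n%:R]) (f t).
have mf_ n : measurable_fun `[a, b] (f_ n).
  apply: measurable_funM => //; apply: measurableT_comp => //.
have f_E n t : `|f t| <= n%:R -> f_ n t = f t.
  by move=> fn; rewrite /f_ indicE mem_set ?mulr1// /= in_itv /= -ler_norml.
have f_0 n t : ~~ (`|f t| <= n%:R) -> f_ n t = 0.
  move=> fn; rewrite /f_ indicE memNset ?mulr0// /= in_itv /= -ler_norml.
  exact/negP.
have [||||||n Hn] := @L2dist_dominated a b f_ f (fun t => `|f t|) _ _ _ _ _ _ e e0.
- exact: mf_.
- exact: mf.
- apply: aeW => t _; apply: cvg_near_cst; exists (Num.bound `|f t|) => // n /= Hn.
  by rewrite f_E// (le_trans (ltW (archi_boundP _)))// ler_nat.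
- split; first exact: measurableT_comp.
  by apply: intg_ext if2 => // t _; rewrite real_normK ?num_real.
- by [].
- move=> n t _; have [fn|fn] := boolP (`|f t| <= n%:R); first by rewrite f_E.
  by rewrite f_0// normr0.
exists (f_ n); split=> //; apply: (bounded _ n%:R) => // t.
have [fn|fn] := boolP (`|f t| <= n%:R); first by rewrite f_E.
by rewrite f_0// normr0.
Qed.

End Approximation.

(** * Complex and vector valued functions *)

Section ComplexIntegral.
Variable R : realType.
Local Notation C := R[i].
Local Notation mu := (@lebesgue_measure R).
Local Notation Re := complex.Re.
Local Notation Im := complex.Im.
Implicit Types (D : set R) (f g w : R -> C).

Lemma complex_ext (x y : C) : Re x = Re y -> Im x = Im y -> x = y.
Proof. by case: x y => a b [c d] /= -> ->. Qed.

Lemma ReM (x y : C) : Re (x * y) = Re x * Re y - Im x * Im y.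
Proof. by case: x y => a b [c d]. Qed.

Lemma ImM (x y : C) : Im (x * y) = Re x * Im y + Im x * Re y.
Proof. by case: x y => a b [c d]. Qed.

Lemma Re_conj (x : C) : Re x^* = Re x.
Proof. by case: x. Qed.

Lemma Im_conj (x : C) : Im x^* = - Im x.
Proof. by case: x. Qed.

Lemma ReD (x y : C) : Re (x + y) = Re x + Re y.
Proof. by case: x y => a b [c d]. Qed.

Lemma ImD (x y : C) : Im (x + y) = Im x + Im y.
Proof. by case: x y => a b [c d]. Qed.

(** The squared modulus, taken in [R] so that it can be integrated and compared there. *)
Definition sqnorm (x : C) : R := Re x ^+ 2 + Im x ^+ 2.

Lemma sqnorm_ge0 x : 0 <= sqnorm x.
Proof. by rewrite addr_ge0// sqr_ge0. Qed.

Lemma sqnormE (x : C) : x^* * x = (sqnorm x)%:C.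
Proof. by apply: complex_ext; rewrite ?ReM ?ImM Re_conj Im_conj /sqnorm /=; ring. Qed.

Definition cintg D f := intg D (fun t => Re (f t)) /\ intg D (fun t => Im (f t)).

Definition cloc f := forall b : R, cintg `[0, b] f.

Lemma cintg_meas D f : cintg D f -> complex_measurable D f.
Proof. by move=> [r i]; split; exact: intg_meas. Qed.

Lemma cintgD D f g : measurable D -> cintg D f -> cintg D g ->
  cintg D (fun t => f t + g t).
Proof.
move=> mD [fr fi] [gr gi]; split.
  by apply: intg_ext (intgD mD fr gr) => // t _; rewrite raddfD.
by apply: intg_ext (intgD mD fi gi) => // t _; rewrite raddfD.
Qed.

Lemma cintgZ D (a : C) f : measurable D -> cintg D f -> cintg D (fun t => a * f t).
Proof.
move=> mD [fr fi]; split.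
  apply: intg_ext (intgB mD (intgZ (Re a) mD fr) (intgZ (Im a) mD fi)) => // t _.
  by rewrite ReM.
apply: intg_ext (intgD mD (intgZ (Re a) mD fi) (intgZ (Im a) mD fr)) => // t _.
by rewrite ImM.
Qed.

Lemma cintgN D f : measurable D -> cintg D f -> cintg D (fun t => - f t).
Proof.
move=> mE [fr fi]; split.
  by apply: intg_ext (intgN mE fr) => // t _; rewrite raddfN.
by apply: intg_ext (intgN mE fi) => // t _; rewrite raddfN.
Qed.

Lemma cintg_conj D f : measurable D -> cintg D f -> cintg D (fun t => (f t)^*).
Proof.
move=> mD [fr fi]; split.
  by apply: intg_ext fr => // t _; rewrite Re_conj.
by apply: intg_ext (intgN mD fi) => // t _; rewrite Im_conj.
Qed.

Lemma cintg0 D : measurable D -> cintg D (fun=> 0).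
Proof. by move=> mD; split; exact: integrable0. Qed.

Lemma cintg_sum D (I : Type) (s : seq I) (f : I -> R -> C) : measurable D ->
  (forall i, cintg D (f i)) -> cintg D (fun t => \sum_(i <- s) f i t).
Proof.
move=> mD fi; elim: s => [|i s IHs].
  by under [X in cintg _ X]funext do rewrite big_nil; exact: cintg0.
by under [X in cintg _ X]funext do rewrite big_cons; exact: cintgD.
Qed.

Lemma cintg_aeeq D f g : measurable D -> complex_measurable D g ->
  {ae mu, forall t, D t -> f t = g t} -> cintg D f -> cintg D g.
Proof.
move=> mD [mr mi] fg [fr fi]; split.
  apply: intg_aeeq fr => //.
  by apply: (aeS fg) => t {}fg Dt; rewrite fg.
apply: intg_aeeq fi => //.
by apply: (aeS fg) => t {}fg Dt; rewrite fg.
Qed.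

Lemma cintg_ext D f g : measurable D -> (forall t, D t -> f t = g t) ->
  cintg D f -> cintg D g.
Proof.
move=> mD fg [fr fi].
by split; [apply: intg_ext fr|apply: intg_ext fi] => // t Dt; rewrite fg.
Qed.

Lemma cint_ext D f g : (forall t, D t -> f t = g t) ->
  complex_integral D f = complex_integral D g.
Proof. by move=> fg; congr (_ +i* _); apply: Rint_ext => t Dt; rewrite fg. Qed.

Lemma cint_ae D f g : measurable D -> complex_measurable D f ->
  complex_measurable D g -> {ae mu, forall t, D t -> f t = g t} ->
  complex_integral D f = complex_integral D g.
Proof.
move=> mD [fr fi] [gr gi] fg; congr (_ +i* _); apply: Rint_ae => //.
  by apply: (aeS fg) => t {}fg Dt; rewrite fg.
by apply: (aeS fg) => t {}fg Dt; rewrite fg.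
Qed.

Lemma cintD D f g : measurable D -> cintg D f -> cintg D g ->
  complex_integral D (fun t => f t + g t) =
  complex_integral D f + complex_integral D g.
Proof.
move=> mD [fr fi] [gr gi]; apply: complex_ext; rewrite raddfD /= -RintegralD//.
  by apply: Rint_ext => t _; rewrite raddfD.
by apply: Rint_ext => t _; rewrite raddfD.
Qed.

Lemma cintZ D (a : C) f : measurable D -> cintg D f ->
  complex_integral D (fun t => a * f t) = a * complex_integral D f.
Proof.
move=> mD [fr fi]; apply: complex_ext; rewrite ?ReM ?ImM /= -!RintegralZl//.
  rewrite -RintegralB//; [|exact: intgZ|exact: intgZ].
  by apply: Rint_ext => t _; rewrite ReM.
rewrite -RintegralD//; [|exact: intgZ|exact: intgZ].
by apply: Rint_ext => t _; rewrite ImM.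
Qed.

Lemma cintN D f : measurable D -> cintg D f ->
  complex_integral D (fun t => - f t) = - complex_integral D f.
Proof.
move=> mD fi; rewrite -mulN1r -cintZ//.
by apply: cint_ext => t _; rewrite mulN1r.
Qed.

Lemma cint_conj D f : measurable D -> cintg D f ->
  complex_integral D (fun t => (f t)^*) = (complex_integral D f)^*.
Proof.
move=> mD [fr fi]; apply: complex_ext; rewrite ?Re_conj ?Im_conj /=.
  by apply: Rint_ext => t _; rewrite Re_conj.
rewrite -mulN1r -RintegralZl//; apply: Rint_ext => t _.
by rewrite Im_conj mulN1r.
Qed.

Definition csq D f := square_intg D (fun t => Re (f t)) /\
  square_intg D (fun t => Im (f t)).

Lemma csqP D f : measurable D ->
  csq D f <-> complex_measurable D f /\ intg D (fun t => sqnorm (f t)).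
Proof.
move=> mD; split=> [[[mr r2] [mi i2]]|[[mr mi] f2]].
  by split=> //; exact: (intgD mD r2 i2).
split; split=> //; apply: intg_le f2 => //; try exact: measurable_funX.
  by move=> t _; rewrite ger0_norm ?sqr_ge0// /sqnorm lerDl sqr_ge0.
by move=> t _; rewrite ger0_norm ?sqr_ge0// /sqnorm lerDr sqr_ge0.
Qed.

Lemma csq_meas D f : csq D f -> complex_measurable D f.
Proof. by move=> [[mr _] [mi _]]. Qed.

Lemma sqnormD (x y : C) : sqnorm (x + y) <= 2 * (sqnorm x + sqnorm y).
Proof.
rewrite /sqnorm !raddfD /=.
have := sqr_ge0 (Re x - Re y); have := sqr_ge0 (Im x - Im y); nra.
Qed.

Lemma sqnormN (x : C) : sqnorm (- x) = sqnorm x.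
Proof. by rewrite /sqnorm !raddfN /= !sqrrN. Qed.

Lemma sqnormM (x y : C) : sqnorm (x * y) = sqnorm x * sqnorm y.
Proof. by rewrite /sqnorm ReM ImM; ring. Qed.

Lemma csq_le D f g : measurable D -> complex_measurable D f -> csq D g ->
  (forall t, D t -> sqnorm (f t) <= sqnorm (g t)) -> csq D f.
Proof.
move=> mD mf /csqP[//|mg g2] fg; apply/csqP => //; split=> //.
apply: intg_le g2 => //.
  by apply: measurable_funD; apply: measurable_funX; case: mf.
by move=> t Dt; rewrite ger0_norm ?sqnorm_ge0// fg.
Qed.

Lemma csqD D f g : measurable D -> csq D f -> csq D g -> csq D (fun t => f t + g t).
Proof.
move=> mD /csqP[//|mf f2] /csqP[//|mg g2]; apply/csqP => //.
have mfg := cmeasD mf mg; split=> //.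
apply: (@intg_le _ _ _ (fun t => 2 * (sqnorm (f t) + sqnorm (g t)))) => //.
- by apply: measurable_funD; apply: measurable_funX; case: mfg.
- by move=> t _; rewrite ger0_norm ?sqnorm_ge0// sqnormD.
- by apply: intgZ => //; exact: intgD.
Qed.

Lemma csq_mul_bounded D f g (M : R) : measurable D -> csq D f ->
  complex_measurable D g -> (forall t, D t -> sqnorm (g t) <= M) ->
  csq D (fun t => g t * f t).
Proof.
move=> mD /csqP[//|mf f2] mg gM; apply/csqP => //.
have mfg := cmeasM mg mf; split=> //.
apply: (@intg_le _ _ _ (fun t => M * sqnorm (f t))) => //.
- by apply: measurable_funD; apply: measurable_funX; case: mfg.
- by move=> t Dt; rewrite ger0_norm ?sqnorm_ge0// sqnormM ler_wpM2r ?sqnorm_ge0// gM.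
- exact: intgZ.
Qed.

Lemma csqZ D (a : C) f : measurable D -> csq D f -> csq D (fun t => a * f t).
Proof.
move=> mD f2; apply: (@csq_mul_bounded _ _ (fun=> a) (sqnorm a)) => //.
Qed.

Lemma csq0 D : measurable D -> csq D (fun=> 0).
Proof.
move=> mD; apply/csqP => //; split; first exact: cmeas_cst.
apply: intg_ext (cintg0 mD).1 => // t _.
by rewrite /sqnorm /= expr0n addr0.
Qed.

Lemma csq_sum D (I : Type) (s : seq I) (f : I -> R -> C) : measurable D ->
  (forall i, csq D (f i)) -> csq D (fun t => \sum_(i <- s) f i t).
Proof.
move=> mD fi; elim: s => [|i s IHs].
  by under [X in csq _ X]funext do rewrite big_nil; exact: csq0.
by under [X in csq _ X]funext do rewrite big_cons; exact: csqD.
Qed.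

Lemma csq_aeeq D f g : measurable D -> complex_measurable D g ->
  {ae mu, forall t, D t -> f t = g t} -> csq D f -> csq D g.
Proof.
move=> mD mg fg /csqP[//|mf f2]; apply/csqP => //; split=> //.
apply: intg_aeeq f2 => //.
  by apply: measurable_funD; apply: measurable_funX; case: mg.
by apply: (aeS fg) => t {}fg Dt; rewrite fg.
Qed.

Lemma csq_ext D f g : measurable D ->
  (forall t, D t -> f t = g t) -> csq D f -> csq D g.
Proof.
move=> mE fg /csqP[//|[mr mi] f2]; apply/csqP => //; split; first split.
- by apply: eq_measurable_fun mr => t /set_mem Dt; rewrite fg.
- by apply: eq_measurable_fun mi => t /set_mem Dt; rewrite fg.
- by apply: intg_ext f2 => // t Dt; rewrite fg.
Qed.

Lemma csqS D E f : measurable E -> measurable D -> D `<=` E -> csq E f -> csq D f.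
Proof.
move=> mE mD DE /csqP[//|mf f2]; apply/csqP => //; split; last exact: intgS f2.
exact: cmeas_sub mf.
Qed.

Lemma csqM D f g : measurable D -> csq D f -> csq D g -> cintg D (fun t => f t * g t).
Proof.
move=> mD [fr fi] [gr gi]; split.
  apply: (@intg_ext _ _ (fun t => Re (f t) * Re (g t) - Im (f t) * Im (g t))) => //.
    by move=> t _; rewrite ReM.
  by apply: intgB => //; exact: square_intgM.
apply: (@intg_ext _ _ (fun t => Re (f t) * Im (g t) + Im (f t) * Re (g t))) => //.
  by move=> t _; rewrite ImM.
by apply: intgD => //; exact: square_intgM.
Qed.

Lemma csq_conj D f : measurable D -> csq D f -> csq D (fun t => (f t)^*).
Proof.
move=> mD f2; apply: (csq_le mD _ f2); first exact/cmeas_conj/csq_meas.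
by move=> t _; rewrite /sqnorm Re_conj Im_conj sqrrN.
Qed.

(** On a bounded interval the constant 1 is square integrable, and [csqM] applies. *)
Lemma csq_cintg f (b : R) : csq `[0, b] f -> cintg `[0, b] f.
Proof.
move=> f2; apply: (@cintg_ext _ (fun t => 1 * f t)) => //.
  by move=> t _; rewrite mul1r.
apply: csqM => //; split; split=> //=.
  by apply: (@intg_bounded _ _ _ 1) => //; [exact: muitv|move=> t _; rewrite expr1n normr1].
by apply: (@intg_bounded _ _ _ 0) => //; [exact: muitv|move=> t _; rewrite expr0n normr0].
Qed.

Definition cprim f (t : R) : C := complex_integral `[0, t] f.

Lemma cprimZ (a : C) f t : cloc f -> cprim (fun s => a * f s) t = a * cprim f t.
Proof. by move=> fl; rewrite /cprim cintZ. Qed.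

Lemma cprimD f g (t : R) : cintg `[0, t] f -> cintg `[0, t] g ->
  cprim (fun s => f s + g s) t = cprim f t + cprim g t.
Proof. by move=> fl gl; rewrite /cprim cintD. Qed.

(* [w] is locally absolutely continuous on the half-line, with derivative [g]. *)
Definition cac w g := cloc g /\ forall t, 0 <= t -> w t = w 0 + cprim g t.

Lemma cac_cst (c : C) : cac (fun=> c) (fun=> 0).
Proof.
split=> [b|t _]; first exact: cintg0.
by apply: complex_ext; rewrite raddfD /= Rintegral_cst// mul0r addr0.
Qed.

Lemma cacD w1 g1 w2 g2 : cac w1 g1 -> cac w2 g2 ->
  cac (fun t => w1 t + w2 t) (fun t => g1 t + g2 t).
Proof.
move=> [l1 e1] [l2 e2]; split=> [b|t t0]; first exact: cintgD.
by rewrite e1// e2// /cprim cintD//; ring.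
Qed.

Lemma cacZ (a : C) w g : cac w g -> cac (fun t => a * w t) (fun t => a * g t).
Proof.
move=> [l e]; split=> [b|t t0]; first exact: cintgZ.
by rewrite e// /cprim cintZ//; ring.
Qed.

Lemma cac_conj w g : cac w g -> cac (fun t => (w t)^*) (fun t => (g t)^*).
Proof.
move=> [l e]; split=> [b|t t0]; first exact: cintg_conj.
by rewrite e// rmorphD /= /cprim cint_conj.
Qed.

Lemma cac_sum (I : Type) (s : seq I) (w g : I -> R -> C) :
  (forall i, cac (w i) (g i)) ->
  cac (fun t => \sum_(i <- s) w i t) (fun t => \sum_(i <- s) g i t).
Proof.
move=> wg; elim: s => [|i s IHs].
  under [X in cac X _]funext do rewrite big_nil.
  under [X in cac _ X]funext do rewrite big_nil.
  exact: cac_cst.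
under [X in cac X _]funext do rewrite big_cons.
under [X in cac _ X]funext do rewrite big_cons.
exact: cacD.
Qed.

Lemma cac_intgM w1 g1 w2 g2 : cac w1 g1 -> cac w2 g2 ->
  cloc (fun t => g1 t * w2 t).
Proof.
move=> [l1 e1] [l2 e2] b.
have pr (h k : R -> R) : loc_intg h -> loc_intg k -> forall c : R,
    intg `[0, b] (fun t => h t * (c + prim k t)).
  move=> hl kl c; apply: (@intg_ext _ _ (fun t => c * h t + h t * prim k t)) => //.
    by move=> t _; ring.
  by apply: intgD => //; [exact: intgZ|exact: intg_mul_prim].
have l1r : loc_intg (fun t => Re (g1 t)) by move=> u; case: (l1 u).
have l1i : loc_intg (fun t => Im (g1 t)) by move=> u; case: (l1 u).
have l2r : loc_intg (fun t => Re (g2 t)) by move=> u; case: (l2 u).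
have l2i : loc_intg (fun t => Im (g2 t)) by move=> u; case: (l2 u).
split.
  apply: intg_ext (intgB _ (pr _ _ l1r l2r (Re (w2 0))) (pr _ _ l1i l2i (Im (w2 0)))) => //.
  by move=> t; rewrite /= in_itv /= => /andP[t0 _]; rewrite (e2 t t0) ReM ReD ImD.
apply: intg_ext (intgD _ (pr _ _ l1r l2i (Im (w2 0))) (pr _ _ l1i l2r (Re (w2 0)))) => //.
by move=> t; rewrite /= in_itv /= => /andP[t0 _]; rewrite (e2 t t0) ImM ReD ImD.
Qed.

Lemma cprim_mul g1 g2 (t : R) : cloc g1 -> cloc g2 ->
  cprim g1 t * cprim g2 t = cprim (fun s => g1 s * cprim g2 s + cprim g1 s * g2 s) t.
Proof.
move=> l1 l2.
have l1r : loc_intg (fun t => Re (g1 t)) by move=> u; case: (l1 u).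
have l1i : loc_intg (fun t => Im (g1 t)) by move=> u; case: (l1 u).
have l2r : loc_intg (fun t => Re (g2 t)) by move=> u; case: (l2 u).
have l2i : loc_intg (fun t => Im (g2 t)) by move=> u; case: (l2 u).
have ii h k : loc_intg h -> loc_intg k ->
    intg `[0, t] (fun s => h s * prim k s + prim h s * k s).
  move=> hl kl; apply: intgD => //; first exact: intg_mul_prim.
  by apply: intg_ext (intg_mul_prim kl hl t) => // s _; rewrite mulrC.
apply: complex_ext; rewrite ?ReM ?ImM /=.
  rewrite -![Rintegral _ _ _]/(prim _ _) !prim_mul// -RintegralB//; [|exact: ii|exact: ii].
  by apply: Rint_ext => s _; rewrite ReD !ReM /=; rewrite /prim; ring.
rewrite -![Rintegral _ _ _]/(prim _ _) !prim_mul// -RintegralD//; [|exact: ii|exact: ii].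
by apply: Rint_ext => s _; rewrite ImD !ImM /=; rewrite /prim; ring.
Qed.

(** Once each factor is written as its value at 0 plus a primitive, the only nonlinear term is the
    product of the two primitives, which is [cprim_mul]. *)
Lemma cacM w1 g1 w2 g2 : cac w1 g1 -> cac w2 g2 ->
  cac (fun t => w1 t * w2 t) (fun t => g1 t * w2 t + w1 t * g2 t).
Proof.
move=> h1 h2; have i1 := cac_intgM h1 h2; have i2 := cac_intgM h2 h1.
have [l1 e1] := h1; have [l2 e2] := h2; split=> [b|t t0].
  apply: cintgD => //; apply: cintg_ext (i2 b) => // t _; exact: mulrC.
have p1 : cac (cprim g1) g1.
  split=> // s s0; rewrite [cprim g1 0](_ : _ = 0) ?add0r//.
  by rewrite /cprim /complex_integral set_itv1 !Rintegral_set1.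
have p2 : cac (cprim g2) g2.
  split=> // s s0; rewrite [cprim g2 0](_ : _ = 0) ?add0r//.
  by rewrite /cprim /complex_integral set_itv1 !Rintegral_set1.
have j1 := cac_intgM p1 p2 t; have j2 := cac_intgM p2 p1 t.
have -> : cprim (fun s => g1 s * w2 s + w1 s * g2 s) t =
  w2 0 * cprim g1 t + w1 0 * cprim g2 t + cprim g1 t * cprim g2 t.
  rewrite cprim_mul// -!cprimZ// -!cprimD//.
  - apply: cint_ext => s; rewrite /= in_itv /= => /andP[s0 _].
    by rewrite (e1 s s0) (e2 s s0); ring.
  - by apply: cintgD => //; exact: cintgZ.
  - by apply: cintgD => //; apply: cintg_ext j2 => // s _; exact: mulrC.
  - exact: cintgZ.
  - exact: cintgZ.
by rewrite (e1 t t0) (e2 t t0); ring.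
Qed.

End ComplexIntegral.

(** * Behaviour at infinity and values at the origin *)

Section HalfLine.
Variable R : realType.
Local Notation C := R[i].
Local Notation mu := (@lebesgue_measure R).
Local Notation Re := complex.Re.
Local Notation Im := complex.Im.

Lemma prim_cvg (h : R -> R) : intg half_line h ->
  (fun n : nat => prim h n%:R) @ \oo --> \int[mu]_(t in half_line) h t.
Proof.
move=> hi; have mD := @half_line0 R.
have := @Rint_dominated R half_line (fun n => h \_ `[0, n%:R]) h (fun t => `|h t|) mD.
case=> [n||||| _].
- apply/measurable_restrict => //.
  by apply: measurable_funS (intg_meas hi) => //; exact: subIsetl.
- exact: intg_meas hi.
- apply: aeW => t /half_lineP t0; apply: cvg_near_cst.
  exists (Num.bound t) => // n /= tn; rewrite patchE mem_set//= in_itv /= t0 /=.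
  by rewrite (le_trans (ltW (archi_boundP t0)))// ler_nat.
- exact: intg_norm.
- by apply: aeW => t _ n; rewrite patchE; case: ifP => // _; rewrite normr0.
apply: cvg_trans; apply: near_eq_cvg; apply: nearW => n.
rewrite [LHS](_ : _ = \int[mu]_(t in half_line) (h \_ `[0, n%:R]) t)// -Rintegral_mkcondr.
congr Rintegral; apply/seteqP; split=> t; first by move=> [].
by move=> tn; split=> //; exact: sub_half_line tn.
Qed.

(* The mean of [f] over [n, n + 1] tends both to [0], as [f] is integrable, and
   to the limit [c + \int g] of [f]. *)
Lemma prim_integrable_limit (f g : R -> R) (c : R) : intg half_line f ->
  intg half_line g -> (forall t, 0 <= t -> f t = c + prim g t) ->
  c + \int[mu]_(t in half_line) g t = 0.
Proof.
move=> fi gi fE; have mD := @half_line0 R.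
have gl := intg_loc gi; have fl := intg_loc fi.
pose g' t := `|g t|; have g'i : intg half_line g' by exact: intg_norm.
have g'l := intg_loc g'i.
have S (h : R -> R) : intg half_line h ->
    (fun n : nat => prim h n.+1%:R - prim h n%:R) @ \oo --> (0 : R).
  move=> hi; have hc := prim_cvg hi.
  rewrite (_ : nbhs 0 = nbhs (\int[mu]_(t in half_line) h t -
    \int[mu]_(t in half_line) h t)); last by rewrite subrr.
  apply: cvgB => //.
  have := cvg_shiftS (fun n : nat => prim h n%:R) (nbhs (\int[mu]_(t in half_line) h t)).
  by move=> ->.
have lim1 : (fun n : nat => f n%:R) @ \oo --> c + \int[mu]_(t in half_line) g t.
  rewrite (_ : (fun n : nat => f n%:R) = (fun n => c + prim g n%:R)); last first.
    by apply/funext => n; rewrite fE// ler0n.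
  by apply: cvgD; [exact: cvg_cst|exact: prim_cvg].
suff : (fun n : nat => f n%:R) @ \oo --> (0 : R) by move=> l0; exact: cvg_unique lim1 l0.
(* [f n] is the integral of [f] over [n, n + 1] minus that of [f - f n], and on this segment
   [|f t - f n|] is at most the integral of [|g|]; both bounds are increments of convergent
   primitives. *)
have bound (n : nat) : `|f n%:R| <= `|prim f n.+1%:R - prim f n%:R| +
    (prim g' n.+1%:R - prim g' n%:R).
  have n0 : (0 : R) <= n%:R by rewrite ler0n.
  have nn1 : (n%:R : R) <= n.+1%:R by rewrite ler_nat.
  have sub : `[n%:R : R, n.+1%:R] `<=` half_line.
    by move=> t; rewrite /= in_itv /= => /andP[nt _]; apply/half_lineP/(le_trans n0).
  have ia : intg `[n%:R, n.+1%:R] f by apply: intgS fi.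
  have ic : intg `[n%:R, n.+1%:R] (cst (f n%:R)).
    by apply: (@intg_bounded _ _ _ `|f n%:R|) => //; exact: muitv.
  rewrite !primB//; set J := \int[mu]_(t in _) g' t.
  have -> : f n%:R = \int[mu]_(t in `[n%:R, n.+1%:R]) f t -
      \int[mu]_(t in `[n%:R, n.+1%:R]) (f t - cst (f n%:R) t).
    rewrite -RintegralB//; last exact: intgB.
    rewrite (@Rint_ext _ _ _ (cst (f n%:R))) => [|t _]; last by rewrite opprB addrC subrK.
    by rewrite Rint_cst_itv// -natr1 addrAC subrr add0r mulr1.
  rewrite (le_trans (ler_normB _ _))// lerD2l.
  rewrite (le_trans (le_normr_Rintegral _ _))//; first exact: intgB.
  apply: (@le_trans _ _ (\int[mu]_(t in `[n%:R, n.+1%:R]) cst J t)); last first.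
    by rewrite Rint_cst_itv// -natr1 addrAC subrr add0r mulr1.
  apply: le_Rintegral => //.
  - by apply: intg_norm; exact: intgB.
  - by apply: (@intg_bounded _ _ _ `|J|) => //; exact: muitv.
  move=> t; rewrite /= in_itv /= => /andP[nt tn].
  rewrite !fE ?(le_trans n0 nt)// opprD addrACA subrr add0r primB//.
  have sub2 : `[n%:R, t] `<=` `[n%:R : R, n.+1%:R].
    by move=> u; rewrite /= !in_itv /= => /andP[-> /le_trans]; exact.
  rewrite (le_trans (le_normr_Rintegral _ _))//.
    by apply: intgS gi => //; exact: subset_trans sub2 sub.
  rewrite -/(Rintegral _ _ g') -lee_fin !EFin_Rint//.
  - apply: ge0_subset_integral => //.
    apply/measurable_EFinP; apply: (@intg_meas _ _ g').
    by apply: intgS g'i.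
  - by apply: intgS g'i.
  - by apply: intgS g'i => //; exact: subset_trans sub2 sub.
apply/norm_cvg0P.
have lim2 : (fun n : nat => `|prim f n.+1%:R - prim f n%:R| +
    (prim g' n.+1%:R - prim g' n%:R)) @ \oo --> (0 : R).
  rewrite (_ : nbhs 0 = nbhs (0 + 0)); last by rewrite addr0.
  by apply: cvgD; [apply/norm_cvg0P; exact: S|exact: S].
apply: squeeze_cvgr (@cvg_cst _ (0 : R) _ _ _) lim2.
by apply: nearW => n; rewrite normr_ge0 bound.
Qed.

(** For [w = W1^* P1 W2], formed from two maximal pairs, this evaluates the boundary terms of
    Green's formula. *)
Lemma cac_integrable_limit (w g : R -> C) : cac w g -> cintg half_line w ->
  cintg half_line g -> w 0 = - complex_integral half_line g.
Proof.
move=> [gl e] [wr wi] [gr gi]; apply/eqP; rewrite -addr_eq0; apply/eqP.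
apply: complex_ext; rewrite ?ReD ?ImD /=.
  by apply: prim_integrable_limit wr gr _ => t t0; rewrite e// ReD.
by apply: prim_integrable_limit wi gi _ => t t0; rewrite e// ImD.
Qed.

(** Test functions are real, so the hypothesis splits into real and imaginary parts. *)
Lemma complex_du_bois_reymond (f g : R -> C) : cloc f -> cloc g ->
  (forall phi : R -> R, test_function phi ->
    complex_integral half_line (fun t => (derive1 phi t)%:C * f t) =
    - complex_integral half_line (fun t => (phi t)%:C * g t)) ->
  exists c, {ae mu, forall t, half_line t -> f t = c + cprim g t}.
Proof.
move=> fl gl fg.
have ReZ (a : R) z : Re (a%:C * z) = a * Re z by rewrite ReM /=; ring.
have ImZ (a : R) z : Im (a%:C * z) = a * Im z by rewrite ImM /=; ring.
have [||phi tphi|cr Hr] := @du_bois_reymond R (fun t => Re (f t)) (fun t => Re (g t)).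
- by move=> b; case: (fl b).
- by move=> b; case: (gl b).
- have /(congr1 (fun z => Re z)) /= := fg _ tphi.
  by under eq_Rintegral do rewrite ReZ; under [X in - X]eq_Rintegral do rewrite ReZ.
have [||phi tphi|ci Hi] := @du_bois_reymond R (fun t => Im (f t)) (fun t => Im (g t)).
- by move=> b; case: (fl b).
- by move=> b; case: (gl b).
- have /(congr1 (fun z => Im z)) /= := fg _ tphi.
  by under eq_Rintegral do rewrite ImZ; under [X in - X]eq_Rintegral do rewrite ImZ.
exists (cr +i* ci); move: Hr Hi.
apply: (@filterS2 _ _ (ae_filter_ringOfSetsType mu)) => t Hr Hi t0.
by apply: complex_ext; rewrite ?ReD ?ImD /=; [exact: Hr|exact: Hi].
Qed.

Lemma complex_ibp_test (f g : R -> C) (c : C) : complex_measurable half_line f ->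
  cloc g -> {ae mu, forall t, half_line t -> f t = c + cprim g t} ->
  forall phi : R -> R, test_function phi ->
    complex_integral half_line (fun t => (derive1 phi t)%:C * f t) =
    - complex_integral half_line (fun t => (phi t)%:C * g t).
Proof.
move=> [mr mi] gl fE phi tphi.
have ReZ (a : R) z : Re (a%:C * z) = a * Re z by rewrite ReM /=; ring.
have ImZ (a : R) z : Im (a%:C * z) = a * Im z by rewrite ImM /=; ring.
apply: complex_ext => /=.
  under eq_Rintegral do rewrite ReZ; under [X in - X]eq_Rintegral do rewrite ReZ.
  apply: (@ibp_test _ _ _ (Re c)) => //; first by move=> b; case: (gl b).
  by apply: (aeS fE) => t {}fE t0; rewrite fE// ReD.
under eq_Rintegral do rewrite ImZ; under [X in - X]eq_Rintegral do rewrite ImZ.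
apply: (@ibp_test _ _ _ (Im c)) => //; first by move=> b; case: (gl b).
by apply: (aeS fE) => t {}fE t0; rewrite fE// ImD.
Qed.

Lemma prim_continuous_half_line (f : R -> R) (c : R) : loc_intg f ->
  {within half_line, continuous (fun t => c + prim f t)}.
Proof.
move=> fl; have cont (b : R) : 0 < b ->
    {within `[0, b], continuous (fun t => c + prim f t)}.
  move=> b0 x; apply: cvgD; first exact: cvg_cst.
  exact: (prim_continuous (ltW b0) fl).
apply/continuous_within_itvcyP; split.
  move=> t; rewrite in_itv /= andbT => t0.
  have tt : 0 < t + 1 by rewrite addr_gt0.
  have /(continuous_within_itvP _ tt)[H _ _] := cont _ tt.
  by apply: H; rewrite in_itv /= t0 /= ltrDl ltr01.
by have /(continuous_within_itvP _ ltr01)[_ + _] := cont _ ltr01.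
Qed.

Lemma ae_half_line_ex (P : R -> Prop) (e : R) : 0 < e ->
  {ae mu, forall t, half_line t -> P t} -> exists2 t, 0 < t < e & P t.
Proof.
move=> e0 [N [mN N0 PN]]; apply: contrapT => nex.
pose I : set R := `]0, e[%classic; have sub : I `<=` N.
  move=> t; rewrite /I /= in_itv /= => te; apply: PN => /= Pt; apply: nex.
  by exists t => //; apply: Pt; apply/half_lineP; case/andP: te => /ltW.
have : (mu I <= mu N)%E 
  by apply: le_measure; [rewrite inE; exact: measurable_itv|rewrite inE|exact: sub].
rewrite N0 lebesgue_measure_itv /= lte_fin e0 -EFinD lee_fin subr0.
by rewrite leNgt e0.
Qed.

(** No interval ]0, e[ is null, so the points where [f] and [g] agree accumulate at 0 from the
    right. *)
Lemma continuous_ae_eq0 (f g : R -> R) : {within half_line, continuous f} ->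
  {within half_line, continuous g} ->
  {ae mu, forall t, half_line t -> f t = g t} -> f 0 = g 0.
Proof.
move=> /continuous_within_itvcyP[_ f0] /continuous_within_itvcyP[_ g0] fg.
apply/eqP; rewrite -subr_eq0; apply/negPn/negP => d0.
have lim : (f - g) x @[x --> 0^'+] --> f 0 - g 0 by exact: cvgB.
move/cvgrPdist_lt : lim => /(_ `|f 0 - g 0|).
rewrite normr_gt0 => /(_ d0) [e /= e0 He].
have [t /andP[t0 te] tfg] := ae_half_line_ex e0 fg.
have := He t; rewrite /= sub0r normrN gtr0_norm// => /(_ te t0).
by rewrite !fctE tfg subrr subr0 ltxx.
Qed.

Lemma has_value0_unique n (y : R -> 'cV[C]_n) v v' :
  has_value0 y v -> has_value0 y v' -> v = v'.
Proof.
move=> [z [cr ci ze <-]] [z' [cr' ci' ze' <-]].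
have zz' : {ae mu, forall t, half_line t -> z t = z' t}.
  move: ze ze'; apply: (@filterS2 _ _ (ae_filter_ringOfSetsType mu)) => t e e' t0.
  by rewrite e// e'.
apply/matrixP => i j; rewrite (ord1 j); apply: complex_ext.
  apply: (continuous_ae_eq0 (cr i) (cr' i)).
  by apply: (@filterS _ _ (ae_filter_ringOfSetsType mu)) zz' => t e t0; rewrite e.
apply: (continuous_ae_eq0 (ci i) (ci' i)).
by apply: (@filterS _ _ (ae_filter_ringOfSetsType mu)) zz' => t e t0; rewrite e.
Qed.

Lemma has_value0P n (y : R -> 'cV[C]_n) v : has_value0 y v -> value0 y = v.
Proof. by move=> yv; apply: xget_unique => // v' /has_value0_unique; exact. Qed.

Definition vac n (W G : R -> 'cV[C]_n) : Prop :=
  forall i, cac (fun t => W t i 0) (fun t => G t i 0).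

Lemma vac_has_value0 n (W G y : R -> 'cV[C]_n) : vac W G ->
  {ae mu, forall t, half_line t -> W t = y t} -> has_value0 y (W 0).
Proof.
(* [W] is prescribed only at nonnegative arguments; [Z] is the same function there, in a form whose
   continuity is that of a primitive. *)
move=> WG Wy; pose Z t : 'cV[C]_n := \col_i (W 0 i 0 + cprim (fun s => G s i 0) t).
have ZW t : 0 <= t -> Z t = W t.
  move=> t0; apply/matrixP => i j; rewrite (ord1 j) mxE.
  by have [_ e] := WG i; rewrite (e t t0).
exists Z; split.
- move=> i; rewrite (_ : (fun t => _) = (fun t => Re (W 0 i 0) + prim (fun s => Re (G s i 0)) t)).
    by apply: prim_continuous_half_line => b; have [l _] := WG i; case: (l b).
  by apply/funext => t; rewrite mxE ReD.
- move=> i; rewrite (_ : (fun t => _) = (fun t => Im (W 0 i 0) + prim (fun s => Im (G s i 0)) t)).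
    by apply: prim_continuous_half_line => b; have [l _] := WG i; case: (l b).
  by apply/funext => t; rewrite mxE ImD.
- apply: (aeS Wy) => t {}Wy t0.
  by rewrite ZW ?Wy//; exact/half_lineP.
- exact: ZW.
Qed.

Lemma hformE m n (M : 'M[C]_(m, n)) u v :
  hform M u v = \sum_j \sum_i (u i 0)^* * M i j * v j 0.
Proof.
rewrite /hform mxE; apply: eq_bigr => j _; rewrite mxE mulr_suml.
by apply: eq_bigr => i _; rewrite !mxE.
Qed.

Lemma hform_cac m n (M : 'M[C]_(m, n)) W1 G1 W2 G2 : vac W1 G1 -> vac W2 G2 ->
  cac (fun t => hform M (W1 t) (W2 t))
      (fun t => hform M (G1 t) (W2 t) + hform M (W1 t) (G2 t)).
Proof.
move=> h1 h2.
have -> : (fun t => hform M (W1 t) (W2 t)) =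
    (fun t => \sum_j \sum_i M i j * ((W1 t i 0)^* * W2 t j 0)).
  apply/funext => t; rewrite hformE; apply: eq_bigr => j _; apply: eq_bigr => i _.
  ring.
have -> : (fun t => hform M (G1 t) (W2 t) + hform M (W1 t) (G2 t)) =
    (fun t => \sum_j \sum_i M i j *
      ((G1 t i 0)^* * W2 t j 0 + (W1 t i 0)^* * G2 t j 0)).
  apply/funext => t; rewrite !hformE -big_split; apply: eq_bigr => j _ /=.
  rewrite -big_split; apply: eq_bigr => i _ /=; ring.
apply: cac_sum => j; apply: cac_sum => i; apply: cacZ; apply: cacM.
  exact/cac_conj/h1.
exact: h2.
Qed.

End HalfLine.

(** * Hermitian forms, square integrable vector functions, measurable inverses *)

Section Forms.
Variable R : realType.
Local Notation C := R[i].
Local Notation mu := (@lebesgue_measure R).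
Local Notation Re := complex.Re.
Local Notation Im := complex.Im.

(** Positivity at [v - s c u], with [c = b u v] and [s] real, is a quadratic inequality in [s]; the
    choice [s = 1 / b u u] is optimal. The form is only semidefinite, so [b u u = 0] is treated
    apart. *)
Lemma form_cauchy_schwarz (V : lmodType C) (b : V -> V -> C) (u v : V) :
  sesquilinear_form b -> (forall x y, b x y = (b y x)^*) ->
  (forall x, 0 <= Re (b x x)) ->
  sqnorm (b u v) <= Re (b u u) * Re (b v v).
Proof.
move=> [bl br] bh b0; set c := b u v.
have key (s : R) : 0 <= s ^+ 2 * sqnorm c * Re (b u u) - 2 * s * sqnorm c + Re (b v v).
  have := b0 ((- s%:C * c) *: u + v); rewrite bl !br (bh v u) -/c.
  have Iu : Im (b u u) = 0.
    by have := congr1 (fun z => Im z) (bh u u); rewrite Im_conj => /eqP;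
      rewrite -addr_eq0 -mulr2n mulrn_eq0 => /eqP.
  move: Iu; case: (b u u) => a a' /= ->; case: (b v v) => p q /=; case: c => x y /=.
  by rewrite /sqnorm /=; congr (_ <= _); ring.
have A0 := b0 u; have B0 := b0 v; have n0 := sqnorm_ge0 c.
move: A0; rewrite le_eqVlt => /predU1P[A0|A0].
  rewrite -A0 mul0r leNgt; apply/negP => n1.
  (* The quadratic polynomial has degenerated to an affine one, and this [s] gives it the value
     -1. *)
  have := key ((Re (b v v) + 1) / (2 * sqnorm c)); rewrite -A0 mulr0 sub0r.
  have -> : 2 * ((Re (b v v) + 1) / (2 * sqnorm c)) * sqnorm c = Re (b v v) + 1.
    by field; rewrite gt_eqF.
  by lra.
have := key (Re (b u u))^-1.
have -> : (Re (b u u))^-1 ^+ 2 * sqnorm c * Re (b u u) - 2 * (Re (b u u))^-1 * sqnorm c =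
   - (sqnorm c / Re (b u u)) by field; rewrite gt_eqF.
by rewrite addrC subr_ge0 ler_pdivrMr// mulrC.
Qed.

Lemma sqnorm_Re (z : C) (M : R) : 0 <= M -> sqnorm z <= M ^+ 2 -> `|Re z| <= M.
Proof.
move=> M0 zM; rewrite -(@ler_pXn2r _ 2) ?nnegrE// real_normK ?num_real//.
by rewrite (le_trans _ zM)// lerDl sqr_ge0.
Qed.

Lemma sqnorm_Im (z : C) (M : R) : 0 <= M -> sqnorm z <= M ^+ 2 -> `|Im z| <= M.
Proof.
move=> M0 zM; rewrite -(@ler_pXn2r _ 2) ?nnegrE// real_normK ?num_real//.
by rewrite (le_trans _ zM)// lerDr sqr_ge0.
Qed.

Lemma sqnorm_le_norm (z : C) (B : R) : `|z| <= B%:C -> 0 <= B /\ sqnorm z <= B ^+ 2.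
Proof.
move=> zB; have B0 : 0 <= B%:C :> C by exact: le_trans zB.
split; first by move: B0; rewrite -[0 : C]/(0%:C) lecR.
rewrite -lecR -sqnormE mulrC -normCK rmorphXn /=.
by rewrite lerXn2r ?nnegrE.
Qed.

Lemma trmxCM m n p (A : 'M[C]_(m, n)) (B : 'M[C]_(n, p)) :
  (A *m B)^t* = B^t* *m A^t*.
Proof. by rewrite trmx_mul map_mxM. Qed.

Lemma trmxCK m n (A : 'M[C]_(m, n)) : (A^t*)^t* = A.
Proof. by apply/matrixP => i j; rewrite !mxE conjCK. Qed.

Lemma trmxCD m n (A B : 'M[C]_(m, n)) : (A + B)^t* = A^t* + B^t*.
Proof. by apply/matrixP => i j; rewrite !mxE rmorphD. Qed.

Lemma trmxCZ m n a (A : 'M[C]_(m, n)) : (a *: A)^t* = a^* *: A^t*.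
Proof. by apply/matrixP => i j; rewrite !mxE rmorphM. Qed.

Lemma hform_sesquilinear n (M : 'M[C]_n) : sesquilinear_form (hform M).
Proof.
split=> a u v w; rewrite /hform.
  by rewrite trmxCD trmxCZ !mulmxDl -!scalemxAl mxE [in X in X + _]mxE.
by rewrite mulmxDr -scalemxAr !mxE.
Qed.

Lemma hform_conj m n (M : 'M[C]_(m, n)) u v : hform M u v = (hform (M^t*) v u)^*.
Proof.
have trE (A : 'M[C]_1) : (A^t*) 0 0 = (A 0 0)^* by rewrite !mxE.
by rewrite {2}/hform -trE !trmxCM !trmxCK mulmxA.
Qed.

Lemma hform_mulr m n p (M : 'M[C]_(m, n)) (A : 'M[C]_(n, p)) u v :
  hform M u (A *m v) = hform (M *m A) u v.
Proof. by rewrite /hform !mulmxA. Qed.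

Lemma hform_mull m n p (M : 'M[C]_(m, n)) (A : 'M[C]_(m, p)) u v :
  hform M (A *m u) v = hform (A^t* *m M) u v.
Proof. by rewrite /hform trmxCM !mulmxA. Qed.

Lemma hformDl m n (M : 'M[C]_(m, n)) u v w :
  hform M (u + v) w = hform M u w + hform M v w.
Proof. by rewrite /hform trmxCD !mulmxDl mxE. Qed.

Lemma hformDr m n (M : 'M[C]_(m, n)) u v w :
  hform M w (u + v) = hform M w u + hform M w v.
Proof. by rewrite /hform mulmxDr mxE. Qed.

Lemma hform1E n (u v : 'cV[C]_n) : hform 1%:M u v = \sum_i (u i 0)^* * v i 0.
Proof. by rewrite /hform mulmx1 mxE; apply: eq_bigr => i _; rewrite !mxE. Qed.

Definition vsqnorm n (z : 'cV[C]_n) : R := \sum_i sqnorm (z i 0).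

Lemma vsqnorm_ge0 n (z : 'cV[C]_n) : 0 <= vsqnorm z.
Proof. by apply: sumr_ge0 => i _; exact: sqnorm_ge0. Qed.

Lemma vsqnormE n (z : 'cV[C]_n) : hform 1%:M z z = (vsqnorm z)%:C.
Proof. by rewrite hform1E rmorph_sum; apply: eq_bigr => i _; rewrite sqnormE. Qed.

Lemma vsqnormZ n (a : C) (z : 'cV[C]_n) : vsqnorm (a *: z) = sqnorm a * vsqnorm z.
Proof. by rewrite /vsqnorm mulr_sumr; apply: eq_bigr => i _; rewrite mxE sqnormM. Qed.

Lemma vsqnormD n (y z : 'cV[C]_n) : vsqnorm (y + z) <= 2 * (vsqnorm y + vsqnorm z).
Proof.
rewrite /vsqnorm -big_split /= mulr_sumr; apply: ler_sum => i _.
by rewrite mxE sqnormD.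
Qed.

Lemma sqnorm_eq0 (z : C) : sqnorm z = 0 -> z = 0.
Proof.
move=> /eqP; rewrite paddr_eq0 ?sqr_ge0// !sqrf_eq0 => /andP[/eqP r0 /eqP i0].
exact: complex_ext.
Qed.

Lemma vsqnorm_eq0 n (z : 'cV[C]_n) : vsqnorm z = 0 -> z = 0.
Proof.
move=> /eqP; rewrite psumr_eq0 => [/allP z0|i _]; last exact: sqnorm_ge0.
apply/matrixP => i j; rewrite (ord1 j) mxE; apply: sqnorm_eq0.
by apply/eqP/z0; rewrite mem_index_enum.
Qed.

Lemma hform_trmxC_id n (M : 'M[C]_n) : M^t* = M -> forall u v, hform M u v = (hform M v u)^*.
Proof. by move=> MM u v; rewrite hform_conj MM. Qed.

Lemma hform_cauchy_schwarz n (M : 'M[C]_n) u v : M^t* = M ->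
  (forall z, 0 <= hform M z z) ->
  sqnorm (hform M u v) <= Re (hform M u u) * Re (hform M v v).
Proof.
move=> MM M0; apply: form_cauchy_schwarz; first exact: hform_sesquilinear.
  exact: hform_trmxC_id.
by move=> x; have := M0 x; rewrite lecE => /andP[].
Qed.

Lemma hform1_cauchy_schwarz n (u v : 'cV[C]_n) :
  sqnorm (hform 1%:M u v) <= vsqnorm u * vsqnorm v.
Proof.
have H1 : (1%:M : 'M[C]_n)^t* = 1%:M by rewrite trmx1 map_mx1.
by have := hform_cauchy_schwarz u v H1 (@hform1_ge0 _ _); rewrite !vsqnormE.
Qed.

Lemma hform_delta n (M : 'M[C]_n) i v : hform M (delta_mx i 0) v = (M *m v) i 0.
Proof.
rewrite -[M in LHS]mul1mx -hform_mulr hform1E (bigD1 i)//= big1 => [|j ji].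
  by rewrite mxE !eqxx conjC1 mul1r addr0.
by rewrite mxE (negbTE ji) conjC0 mul0r.
Qed.

(** The entry is [e_i^* M v], so Cauchy-Schwarz for the form of [M] bounds its square by [M_ii]
    times [v^* M v]. The weighted density thus controls [M v] without any lower bound on [M]. *)
Lemma sqnorm_mulmx n (M : 'M[C]_n) (B : R) i v : M^t* = M ->
  (forall z, 0 <= hform M z z) -> Re (M i i) <= B ->
  sqnorm ((M *m v) i 0) <= B * Re (hform M v v).
Proof.
move=> MM M0 MB; rewrite -hform_delta.
rewrite (le_trans (hform_cauchy_schwarz _ _ MM M0))//.
rewrite ler_wpM2r//; first by have := M0 v; rewrite lecE => /andP[].
rewrite hform_delta (_ : (M *m delta_mx i 0) i 0 = M i i)//.
by rewrite -colE mxE.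
Qed.

Definition vsq n (D : set R) (x : R -> 'cV[C]_n) := forall i, csq D (fun t => x t i 0).

Lemma vsqP n (D : set R) (x : R -> 'cV[C]_n) : measurable D ->
  vsq D x <-> mx_measurable D x /\ intg D (fun t => vsqnorm (x t)).
Proof.
move=> mD; split=> [x2|[mx x2] i].
  split=> [i j|]; first by rewrite (ord1 j); exact/csq_meas/x2.
  have S (s : seq 'I_n) : intg D (fun t => \sum_(i <- s) sqnorm (x t i 0)).
    elim: s => [|i s IHs].
      by under [X in intg _ X]funext do rewrite big_nil; exact: integrable0.
    under [X in intg _ X]funext do rewrite big_cons.
    by apply: intgD => //; have /csqP[] := x2 i.
  exact: S.
apply/csqP => //; split; first exact: mx.
have [mr mi] := mx i 0.
apply: intg_le x2 => //; first by apply: measurable_funD; exact: measurable_funX.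
move=> t _; rewrite ger0_norm ?sqnorm_ge0// /vsqnorm (bigD1 i)//= lerDl.
by apply: sumr_ge0 => j _; exact: sqnorm_ge0.
Qed.

Lemma vsq_meas n (D : set R) (x : R -> 'cV[C]_n) : vsq D x -> mx_measurable D x.
Proof. by move=> x2 i j; rewrite (ord1 j); exact/csq_meas/x2. Qed.

Lemma vsq_lin n (D : set R) (a : C) (x y : R -> 'cV[C]_n) : measurable D ->
  vsq D x -> vsq D y -> vsq D (fun t => a *: x t + y t).
Proof.
move=> mD hx hy i; under [X in csq _ X]funext do rewrite !mxE.
by apply: csqD => //; exact: csqZ.
Qed.

Lemma vsq_mulmx m n (D : set R) (M : 'M[C]_(m, n)) (x : R -> 'cV[C]_n) :
  measurable D -> vsq D x -> vsq D (fun t => M *m x t).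
Proof.
move=> mD hx i; under [X in csq _ X]funext do rewrite mxE.
by apply: csq_sum => // j; exact: csqZ.
Qed.

Lemma vsqS n (D E : set R) (x : R -> 'cV[C]_n) : measurable E -> measurable D ->
  D `<=` E -> vsq E x -> vsq D x.
Proof. by move=> mE mD DE hx i; exact: csqS (hx i). Qed.

Lemma vsq_aeeq n (D : set R) (x y : R -> 'cV[C]_n) : measurable D ->
  mx_measurable D y -> {ae mu, forall t, D t -> x t = y t} -> vsq D x -> vsq D y.
Proof.
move=> mD my xy hx i; apply: (csq_aeeq mD (my i 0) _ (hx i)).
by apply: (aeS xy) => t e Dt; rewrite e.
Qed.

Lemma vsq_cintg_hform n (D : set R) (M : 'M[C]_n) (x y : R -> 'cV[C]_n) :
  measurable D -> vsq D x -> vsq D y -> cintg D (fun t => hform M (x t) (y t)).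
Proof.
move=> mD hx hy.
apply: (@cintg_ext _ _ (fun t => \sum_j \sum_i M i j * ((x t i 0)^* * y t j 0))) => //.
  move=> t _; rewrite hformE; apply: eq_bigr => j _; apply: eq_bigr => i _; ring.
apply: cintg_sum => // j; apply: cintg_sum => // i; apply: cintgZ => //.
by apply: csqM => //; exact: csq_conj.
Qed.

Lemma vsq_cloc n (x : R -> 'cV[C]_n) : (forall b, vsq `[0, b] x) ->
  forall i, cloc (fun t => x t i 0).
Proof. by move=> hx i b; exact/csq_cintg/hx. Qed.

Lemma mx_measurable_sub m n (D E : set R) (M : R -> 'M[C]_(m, n)) :
  measurable E -> D `<=` E -> mx_measurable E M -> mx_measurable D M.
Proof. by move=> mE DE mM i j; exact: cmeas_sub (mM i j). Qed.

Lemma cmeas_prod (D : set R) (I : finType) (f : I -> R -> C) :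
  (forall i, complex_measurable D (f i)) ->
  complex_measurable D (fun t => \prod_i f i t).
Proof.
move=> mf; elim: (index_enum I) => [|i s IHs].
  by under [X in complex_measurable _ X]funext do rewrite big_nil; exact: cmeas_cst.
by under [X in complex_measurable _ X]funext do rewrite big_cons; exact: cmeasM.
Qed.

Lemma cmeas_det n (D : set R) (M : R -> 'M[C]_n) : mx_measurable D M ->
  complex_measurable D (fun t => \det (M t)).
Proof.
move=> mM; apply: cmeas_sum => s; apply: cmeasM; first exact: cmeas_cst.
by apply: cmeas_prod => i; exact: mM.
Qed.

Lemma cmeasV (D : set R) (f : R -> C) : measurable D -> complex_measurable D f ->
  complex_measurable D (fun t => (f t)^-1).
Proof.
move=> mD [mr mi].
have mn : measurable_fun D (fun t => (sqnorm (f t)) `^ (-1)).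
  apply: (@measurableT_comp _ _ _ _ _ _ (fun x : R => x `^ (-1)));
    first exact: measurable_powR.
  by apply: measurable_funD; exact: measurable_funX.
(* The formula also holds at [z = 0], where both sides are 0, so the inverse is measurable on all of
   [D]. *)
have E (z : C) : z^-1 = z^* * ((sqnorm z) `^ (-1))%:C.
  have [->|z0] := eqVneq z 0.
    by rewrite invr0 conjC0 mul0r.
  rewrite powR_inv1 ?sqnorm_ge0//; apply: (mulfI z0).
  rewrite mulfV// mulrA [z * _]mulrC sqnormE -rmorphM /= mulfV//.
  by apply/eqP => /sqnorm_eq0 z0'; rewrite z0' eqxx in z0.
split.
  apply: (eq_measurable_fun (fun t => Re (f t) * (sqnorm (f t)) `^ (-1))).
    by move=> t _; rewrite E ReM Re_conj /=; ring.
  exact: measurable_funM.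
apply: (eq_measurable_fun (fun t => - Im (f t) * (sqnorm (f t)) `^ (-1))).
  by move=> t _; rewrite E ImM Im_conj /=; ring.
by apply: measurable_funM => //; exact: measurableT_comp.
Qed.

(* Total substitute for [invmx] whose measurability is read off Cramer's rule. *)
Definition cramer_inv n (M : 'M[C]_n) : 'M[C]_n := (\det M)^-1 *: \adj M.

Lemma cramer_invE n (M : 'M[C]_n) : \det M != 0 -> M *m cramer_inv M = 1%:M.
Proof. by move=> M0; rewrite -scalemxAr mul_mx_adj scale_scalar_mx mulVf. Qed.

Lemma mxmeas_cramer_inv n (D : set R) (M : R -> 'M[C]_n) : measurable D ->
  mx_measurable D M -> mx_measurable D (fun t => cramer_inv (M t)).
Proof.
move=> mD mM i j; under [X in complex_measurable _ X]funext do rewrite !mxE.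
apply: cmeasM; first by apply: cmeasV => //; exact: cmeas_det.
apply: cmeasM; first exact: cmeas_cst.
apply: cmeas_det => k l; under [X in complex_measurable _ X]funext do rewrite !mxE.
exact: mM.
Qed.

End Forms.

(** * The weighted space *)

Section WeightedSpace.
Local Open Scope quotient_scope.
Variable R : realType.
Local Notation C := R[i].
Local Notation mu := (@lebesgue_measure R).
Local Notation Re := complex.Re.
Local Notation Im := complex.Im.
Variables (d : nat) (H : R -> 'M[C]_d) (hH : hamiltonian_density H).
Let mD : measurable (half_line : set R) := @half_line0 R.
Implicit Types (x y xi : R -> 'cV[C]_d).

Lemma ae_hermitian_psd : {ae mu, forall t, half_line t ->
  (H t)^t* = H t /\ forall z, 0 <= hform (H t) z z}.
Proof.
apply: (aeS2 (hd_hermitian hH) (hamiltonian_ae_ge0 hH)) => t h1 h2 t0.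
by split; [exact: h1|exact: h2].
Qed.

Lemma hamiltonian_entry_bound : exists2 B : R, 0 <= B &
  forall t, half_line t -> forall i j, sqnorm (H t i j) <= B ^+ 2 /\ Re (H t i j) <= B.
Proof.
have [B HB] := hd_bounded hH; exists `|B| => // t t0 i j.
have [B0 sB] := sqnorm_le_norm (HB t t0 i j).
rewrite ger0_norm//; split=> //.
exact: le_trans (ler_norm _) (sqnorm_Re B0 sB).
Qed.

Lemma mx_measurable_hamiltonian D : D `<=` half_line -> mx_measurable D H.
Proof. by move=> DE; exact: mx_measurable_sub mD DE (hd_measurable hH). Qed.

Lemma cmeas_hform2 n (D : set R) (M : R -> 'M[C]_n) (u v : R -> 'cV[C]_n) :
  mx_measurable D M -> mx_measurable D u -> mx_measurable D v ->
  complex_measurable D (fun t => hform (M t) (u t) (v t)).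
Proof.
by move=> mM mu_ mv; have := mxmeasM (mxmeasM (mxmeas_tr mu_) mM) mv; move=> /(_ 0 0).
Qed.

Lemma in_L2H_meas x : in_L2H H x -> mx_measurable half_line x.
Proof. by move=> [[]]. Qed.

Lemma in_L2H_vsq_loc x : in_L2H H x -> forall b : R, vsq `[0, b] x.
Proof.
move=> [[mx lx] _] b; apply/vsqP => //; split.
  exact: mx_measurable_sub mD (@sub_half_line _ b) mx.
by apply: intg_ext (lx b) => // t _; rewrite vsqnormE.
Qed.

(** By [sqnorm_mulmx], each entry of [H x] is bounded in square by the density [x^* H x] times a
    bound for the diagonal of [H]. *)
Lemma in_L2H_mul_vsq x : in_L2H H x -> vsq half_line (fun t => H t *m x t).
Proof.
move=> [[mx _] ix] i; have [B B0 HB] := hamiltonian_entry_bound.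
apply/csqP => //; have mHx := mxmeasM (hd_measurable hH) mx.
split; first exact: mHx.
apply: (@intg_aele _ _ _ (fun t => B * Re (hform (H t) (x t) (x t)))) => //.
- by have [mr mi] := mHx i 0; apply: measurable_funD; exact: measurable_funX.
- apply: (aeS ae_hermitian_psd) => t Ht t0; have [h1 h2] := Ht t0.
  rewrite ger0_norm ?sqnorm_ge0// sqnorm_mulmx//.
  by have [] := HB t t0 i i.
- exact: intgZ.
Qed.

Lemma vsq_mul_hamiltonian x : vsq half_line x -> vsq half_line (fun t => H t *m x t).
Proof.
move=> hx i; have [B B0 HB] := hamiltonian_entry_bound.
under [X in csq _ X]funext do rewrite mxE.
apply: csq_sum => // j; apply: (@csq_mul_bounded _ _ _ _ (B ^+ 2)) => //.
  exact: hd_measurable hH i j.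
by move=> t t0; have [] := HB t t0 i j.
Qed.

(** Boundedness of [H] puts the unweighted L2 inside X; terms such as [P0 H x] and functions of
    compact support enter X this way. *)
Lemma vsq_in_L2H x : vsq half_line x -> in_L2H H x.
Proof.
move=> hx; have mx := vsq_meas hx; split; first split=> //.
  move=> b; have := vsqS mD (measurable_itv `[0, b]) (@sub_half_line _ b) hx.
  move=> /vsqP[//|_]; apply: intg_ext => // t _; by rewrite vsqnormE.
have [] := vsq_cintg_hform 1%:M mD hx (vsq_mul_hamiltonian hx).
by move=> ir _; apply: intg_ext ir => // t _; rewrite hform_mulr mul1mx.
Qed.

(** Cauchy-Schwarz for [H t] bounds [|x^* H y|] by the sum of the two integrable densities. *)
Lemma in_L2H_cintg x y : in_L2H H x -> in_L2H H y ->
  cintg half_line (fun t => hform (H t) (x t) (y t)).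
Proof.
move=> [[mx _] ix] [[my _] iy].
have [mr mi] := cmeas_hform2 (hd_measurable hH) mx my.
have ixy := intgD mD ix iy.
have key : {ae mu, forall t, half_line t ->
    let S := Re (hform (H t) (x t) (x t)) + Re (hform (H t) (y t) (y t)) in
    0 <= S /\ sqnorm (hform (H t) (x t) (y t)) <= S ^+ 2}.
  apply: (aeS ae_hermitian_psd) => t Ht t0 S; have [h1 h2] := Ht t0.
  have a0 : 0 <= Re (hform (H t) (x t) (x t)) by have := h2 (x t); rewrite lecE => /andP[].
  have b0 : 0 <= Re (hform (H t) (y t) (y t)) by have := h2 (y t); rewrite lecE => /andP[].
  split; first exact: addr_ge0.
  by rewrite (le_trans (hform_cauchy_schwarz _ _ h1 h2))// /S; nra.
split.
  apply: intg_aele ixy => //; apply: (aeS key) => t kt t0.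
  by have [S0 ?] := kt t0; exact: sqnorm_Re.
apply: intg_aele ixy => //; apply: (aeS key) => t kt t0.
by have [S0 ?] := kt t0; exact: sqnorm_Im.
Qed.

Lemma coercive_on_segment (b : R) : exists2 m : R, 0 < m &
  {ae mu, forall t, `[0, b]%classic t -> forall z,
    m * vsqnorm z <= Re (hform (H t) z z)}.
Proof.
have [||m [M [m0 _ HM]]] := hd_locally_coercive hH (K := `[0, b]%classic).
- exact: compact_bounded (@segment_compact _ _ _).
- exact: sub_half_line.
exists m => //; apply: (aeS HM) => t Ht tb z; have [+ _] := Ht tb z.
by rewrite vsqnormE -rmorphM lecE /= => /andP[].
Qed.

Lemma ae_half_line (P : R -> Prop) :
  (forall b : R, {ae mu, forall t, `[0, b]%classic t -> P t}) ->
  {ae mu, forall t, half_line t -> P t}.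
Proof.
move=> Pb; have := ae_foralln (fun n : nat => Pb n%:R).
move=> HP; apply: (aeS HP) => t Ht /half_lineP t0.
by apply: (Ht (Num.bound t)); rewrite /= in_itv /= t0 ltW// archi_boundP.
Qed.

(** A null vector of [H t] would contradict coercivity on a segment containing [t]; countably many
    segments exhaust the half-line. *)
Lemma ae_det_hamiltonian : {ae mu, forall t, half_line t -> \det (H t) != 0}.
Proof.
apply: ae_half_line => b; have [m m0 Hm] := coercive_on_segment b.
apply: (aeS Hm) => t Ht tb; apply/negP => /det0P[v v0 vH].
have := Ht tb (v^t*); rewrite /hform trmxCK vH mul0mx mxE /=.
rewrite pmulr_rle0// => z0.
have /vsqnorm_eq0 : vsqnorm (v^t*) = 0 by apply/eqP; rewrite eq_le z0 vsqnorm_ge0.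
by move=> /(congr1 (fun z => z^t*)); rewrite trmxCK trmx0 map_mx0 => /eqP; apply/negP.
Qed.

Definition unweight xi t : 'cV[C]_d := cramer_inv (H t) *m xi t.

Lemma mul_unweight xi : {ae mu, forall t, half_line t -> H t *m unweight xi t = xi t}.
Proof.
apply: (aeS ae_det_hamiltonian) => t Ht t0.
by rewrite /unweight mulmxA cramer_invE ?mul1mx// Ht.
Qed.

Lemma mx_measurable_unweight xi : mx_measurable half_line xi ->
  mx_measurable half_line (unweight xi).
Proof.
by move=> mxi; apply: mxmeasM => //; apply: mxmeas_cramer_inv => //; exact: hd_measurable hH.
Qed.

(** Let [x = H^-1 xi] and [h = x^* H x = x^* xi]. Cauchy-Schwarz gives [h^2 <= |x|^2 |xi|^2] and
    coercivity gives [m |x|^2 <= h]; together [m^2 |x|^2 <= |xi|^2] and [m h <= |xi|^2]. The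
    constant depends on the segment only, not on [xi]. *)
Lemma unweight_le (b : R) : exists2 m : R, 0 < m & forall xi,
  {ae mu, forall t, `[0, b]%classic t ->
    m * vsqnorm (unweight xi t) <= vsqnorm (xi t) /\
    m * Re (hform (H t) (unweight xi t) (unweight xi t)) <= vsqnorm (xi t)}.
Proof.
have [m m0 Hm] := coercive_on_segment b.
exists (Num.min (m ^+ 2) m); first by rewrite lt_min m0 exprn_gt0.
move=> xi; apply: (aeS2 Hm (mul_unweight xi)) => t Ht xt tb.
have t0 := sub_half_line tb; set x := unweight xi t.
have Hx : hform (H t) x x = hform 1%:M x (xi t).
  by rewrite -(xt t0) hform_mulr mul1mx.
have := hform1_cauchy_schwarz x (xi t); rewrite -Hx.
have := Ht tb x; set h := hform (H t) x x => mh.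
have := vsqnorm_ge0 x; have := vsqnorm_ge0 (xi t).
set X := vsqnorm x in mh *; set Y := vsqnorm (xi t) => Y0 X0 hXY.
have hh : Re h ^+ 2 <= X * Y by rewrite (le_trans _ hXY)// lerDl sqr_ge0.
have {}mh : m * X <= Re h by exact: mh.
have h0 : 0 <= Re h by rewrite (le_trans _ mh)// mulr_ge0// ltW.
have mXY : m ^+ 2 * X <= Y.
  move: X0; rewrite le_eqVlt => /predU1P[<-|X0]; first by rewrite mulr0.
  rewrite -(ler_pM2r X0) [Y * X]mulrC (le_trans _ hh)//.
  have mX0 : 0 <= m * X by rewrite mulr_ge0// ltW.
  nra.
have mhY : m * Re h <= Y.
  move: h0; rewrite le_eqVlt => /predU1P[<-|h0]; first by rewrite mulr0.
  rewrite -(ler_pM2r h0); nra.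
split.
  by rewrite (le_trans _ mXY)// ler_wpM2r// ge_min lexx.
by rewrite (le_trans _ mhY)// ler_wpM2r// ge_min lexx orbT.
Qed.

Lemma unweight_vsq (b : R) xi : mx_measurable half_line xi ->
  vsq `[0, b] xi -> vsq `[0, b] (unweight xi).
Proof.
move=> mxi xi2; have [m m0 Hm] := unweight_le b.
have mu_ := mx_measurable_sub mD (@sub_half_line _ b) (mx_measurable_unweight mxi).
apply/vsqP => //; split=> //.
have /vsqP[//|_ ixi] := xi2.
apply: (@intg_aele _ _ _ (fun t => m^-1 * vsqnorm (xi t))) => //.
- have S (s : seq 'I_d) : measurable_fun `[0, b]
      (fun t => \sum_(i <- s) sqnorm (unweight xi t i 0)).
    elim: s => [|i s IHs].
      by under [X in measurable_fun _ X]funext do rewrite big_nil; exact: measurable_cst.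
    under [X in measurable_fun _ X]funext do rewrite big_cons.
    apply: measurable_funD => //; have [mr mi] := mu_ i 0.
    by apply: measurable_funD; exact: measurable_funX.
  exact: S.
- apply: (aeS (Hm xi)) => t Ht tb; have [h1 _] := Ht tb.
  by rewrite ger0_norm ?vsqnorm_ge0// mulrC ler_pdivlMr// mulrC.
- exact: intgZ.
Qed.

Lemma unweight_in_L2H xi : mx_measurable half_line xi ->
  (forall b, vsq `[0, b] xi) ->
  intg half_line (fun t => Re (hform (H t) (unweight xi t) (unweight xi t))) ->
  in_L2H H (unweight xi).
Proof.
move=> mxi xi2 ii; split=> //; split; first exact: mx_measurable_unweight.
move=> b; have /vsqP[//|_] := unweight_vsq mxi (xi2 b).
by apply: intg_ext => // t _; rewrite vsqnormE.
Qed.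

(** On [[0, b]] the density of [x = H^-1 xi] is [x^* xi], a product of square integrable functions,
    and beyond [b] it is 0. *)
Lemma unweight_supported xi (b : R) : vsq half_line xi ->
  (forall t, b < t -> xi t = 0) -> in_L2H H (unweight xi).
Proof.
move=> xi2 out; have mxi := vsq_meas xi2.
have xil (c : R) : vsq `[0, c] xi by exact: vsqS mD _ (@sub_half_line _ c) xi2.
apply: unweight_in_L2H => //; apply: (@intg_half_line_itv _ _ b); last first.
  by move=> t bt; rewrite /unweight out// mulmx0 /hform mulmx0 mxE.
have mH := mx_measurable_hamiltonian (@sub_half_line _ b).
have uv := unweight_vsq mxi (xil b).
have [ir _] := vsq_cintg_hform 1%:M (measurable_itv `[0, b]) uv (xil b).
apply: intg_aeeq ir => //.
  by have [] := cmeas_hform2 mH (vsq_meas uv) (vsq_meas uv).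
apply: (aeS (mul_unweight xi)) => t xt tb.
by rewrite -(xt (sub_half_line tb)) hform_mulr mul1mx.
Qed.

Lemma L2H_repr_in (x : L2H hH) : in_L2H H (L2H_repr x).
Proof. by have /asboolP := valP (repr x : L2H_fun hH). Qed.

Lemma L2H_repr_pi (w : L2H_fun hH) :
  {ae mu, forall t, half_line t -> L2H_repr (\pi_(L2H hH) w) t = w t}.
Proof.
have : \pi_(L2H hH) (repr (\pi_(L2H hH) w)) = \pi_(L2H hH) w by rewrite reprK.
move=> /eqP; rewrite piE Quotient.equivE => /asboolP Hw.
apply: (aeS Hw) => t Ht t0; have := Ht t0.
by move=> /eqP; rewrite subr_eq0 => /eqP.
Qed.

Lemma L2H_class x : in_L2H H x ->
  exists u : L2H hH, {ae mu, forall t, half_line t -> L2H_repr u t = x t}.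
Proof.
move=> hx; have px : x \in L2H_pred hH by apply/asboolP.
exists (\pi_(L2H hH) (MkL2H px)); exact: L2H_repr_pi.
Qed.

Lemma L2H_eq (u v : L2H hH) :
  {ae mu, forall t, half_line t -> L2H_repr u t = L2H_repr v t} -> u = v.
Proof.
move=> uv; rewrite -(reprK u) -(reprK v); apply/eqP.
rewrite piE Quotient.equivE; apply/asboolP; apply: (aeS uv) => t Ht t0.
by apply/eqP; rewrite subr_eq0; apply/eqP; exact: Ht.
Qed.

Lemma L2H_repr_lin (a : C) (u v : L2H hH) : {ae mu, forall t, half_line t ->
  L2H_repr (a *: u + v) t = a *: L2H_repr u t + L2H_repr v t}.
Proof.
have piD (f g : L2H_fun hH) :
    \pi_(L2H hH) (f + g) = \pi_(L2H hH) f + \pi_(L2H hH) g.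
  exact: (raddfD \pi_({ideal_quot (@L2H_null R d H hH : zmodClosed (L2H_fun hH))})).
have -> : a *: u + v = \pi_(L2H hH) (a *: (repr u : L2H_fun hH) + repr v).
  by rewrite piD reprK.
exact: L2H_repr_pi.
Qed.

Lemma L2H_repr0 : {ae mu, forall t, half_line t -> L2H_repr (0 : L2H hH) t = 0}.
Proof.
apply: (aeS (L2H_repr_lin (-1) 0 0)) => t Ht t0; have := Ht t0.
by rewrite scaler0 addr0 scaleN1r addNr.
Qed.

Lemma L2H_ip_cintg (u v : L2H hH) :
  cintg half_line (fun t => hform (H t) (L2H_repr u t) (L2H_repr v t)).
Proof. exact: in_L2H_cintg (L2H_repr_in u) (L2H_repr_in v). Qed.

Lemma L2H_ip_sesquilinear : sesquilinear_form (L2H_ip hH).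
Proof.
split=> a u v w; rewrite /L2H_ip -cintZ//; try exact: L2H_ip_cintg.
  rewrite -cintD//; [|by apply: cintgZ => //; exact: L2H_ip_cintg|exact: L2H_ip_cintg].
  apply: cint_ae => //; first exact/cintg_meas/L2H_ip_cintg.
    apply/cintg_meas/cintgD => //; last exact: L2H_ip_cintg.
    by apply: cintgZ => //; exact: L2H_ip_cintg.
  apply: (aeS (L2H_repr_lin a u v)) => t Ht t0.
  by rewrite Ht// (hform_sesquilinear _).1.
rewrite -cintD//; [|by apply: cintgZ => //; exact: L2H_ip_cintg|exact: L2H_ip_cintg].
apply: cint_ae => //; first exact/cintg_meas/L2H_ip_cintg.
  apply/cintg_meas/cintgD => //; last exact: L2H_ip_cintg.
  by apply: cintgZ => //; exact: L2H_ip_cintg.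
apply: (aeS (L2H_repr_lin a u v)) => t Ht t0.
by rewrite Ht// (hform_sesquilinear _).2.
Qed.

Lemma L2H_ip_conj (u v : L2H hH) : L2H_ip hH u v = (L2H_ip hH v u)^*.
Proof.
rewrite /L2H_ip -cint_conj//; last exact: L2H_ip_cintg.
apply: cint_ae => //; first exact/cintg_meas/L2H_ip_cintg.
  by apply/cintg_meas/cintg_conj => //; exact: L2H_ip_cintg.
apply: (aeS ae_hermitian_psd) => t Ht t0; have [h1 _] := Ht t0.
exact: hform_trmxC_id.
Qed.

Lemma Re_L2H_ip_ge0 (u : L2H hH) : 0 <= Re (L2H_ip hH u u).
Proof.
have [ir _] := L2H_ip_cintg u u.
rewrite /L2H_ip /= (@Rint_ae _ _ _ (fun t => `|Re (hform (H t) (L2H_repr u t) (L2H_repr u t))|))//.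
- exact: Rintegral_ge0.
- exact: intg_meas ir.
- exact: intg_meas (intg_norm ir).
apply: (aeS ae_hermitian_psd) => t Ht t0; have [_ h2] := Ht t0.
by rewrite ger0_norm//; have := h2 (L2H_repr u t); rewrite lecE => /andP[].
Qed.

End WeightedSpace.

(** * The maximal operator and Green's formula *)

Section SesquilinearForm.
Variables (R : realType) (V : lmodType R[i]) (b : V -> V -> R[i]).
Hypothesis hb : sesquilinear_form b.

Lemma form0r w : b w 0 = 0.
Proof.
have := proj2 hb 1 0 0 w; rewrite scale1r addr0 mul1r => /eqP.
by rewrite -subr_eq0 opprD addNKr oppr_eq0 => /eqP.
Qed.

Lemma form0l w : b 0 w = 0.
Proof.
have := proj1 hb 1 0 0 w; rewrite scale1r addr0 conjC1 mul1r => /eqP.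
by rewrite -subr_eq0 opprD addNKr oppr_eq0 => /eqP.
Qed.

Lemma formZr a u w : b w (a *: u) = a * b w u.
Proof. by have := proj2 hb a u 0 w; rewrite addr0 form0r addr0. Qed.

Lemma formZl a u w : b (a *: u) w = a^* * b u w.
Proof. by have := proj1 hb a u 0 w; rewrite addr0 form0l addr0. Qed.

Lemma formBr u v w : b w (u - v) = b w u - b w v.
Proof. by rewrite addrC -scaleN1r (proj2 hb) mulN1r addrC. Qed.

Lemma formBl u v w : b (u - v) w = b u w - b v w.
Proof. by rewrite addrC -scaleN1r (proj1 hb) rmorphN1 mulN1r addrC. Qed.

Lemma formNr u w : b w (- u) = - b w u.
Proof. by rewrite -sub0r formBr form0r sub0r. Qed.

Lemma formNl u w : b (- u) w = - b u w.
Proof. by rewrite -sub0r formBl form0l sub0r. Qed.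

End SesquilinearForm.

(** * Absolutely continuous functions and distributional derivatives *)

Section AbsolutelyContinuous.
Variable R : realType.
Local Notation C := R[i].
Local Notation mu := (@lebesgue_measure R).
Local Notation Re := complex.Re.
Local Notation Im := complex.Im.
Let mD : measurable (half_line : set R) := @half_line0 R.

Lemma test_function_bump n (a b : R) : 0 < a -> test_function (bump n a b).
Proof.
move=> a0; split; first exact/elementary_smooth/elementary_bump.
exists a => //; exists b => t b0; apply/andP; split; rewrite leNgt; apply: contra b0 => tab;
  apply/eqP/bump_out; [left|right]; exact: ltW.
Qed.

(** Bumps are test functions, and in the limit they give the integrals of [g] over all intervals. *)
Lemma ae0_of_test (g : R -> R) : loc_intg g ->
  (forall phi, test_function phi -> \int[mu]_(t in half_line) (phi t * g t) = 0) ->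
  {ae mu, forall t, half_line t -> g t = 0}.
Proof.
move=> gl g0; apply: Rint_itv_eq0_ae => // a b a0 ab.
have := bump_limit gl (ltW a0) (ltW ab).
rewrite (_ : (fun n => _) = cst 0) => [l|].
  exact: (cvg_unique _ l (@cvg_cst _ _ _ _ _)).
by apply/funext => n; apply: g0; exact: test_function_bump.
Qed.

Lemma derive_prim (f g : R -> R) : continuous f -> continuous g ->
  (forall t : R, is_derive t (1 : R) f (g t)) ->
  forall t, 0 <= t -> f t = f 0 + prim g t.
Proof.
move=> cf cg df t; rewrite le_eqVlt => /predU1P[<-|t0].
  by rewrite /prim set_itv1 Rintegral_set1 addr0.
rewrite /prim /Rintegral (@continuous_FTC2 _ _ f)//=; first by rewrite addrCA subrr addr0.
- by apply: continuous_subspaceT => x; exact: cg.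
- split.
  + by move=> x _; have [] := df x.
  + by apply: cvg_at_right_filter; exact: cf.
  + by apply: cvg_at_left_filter; exact: cf.
- by move=> x _; rewrite derive1E; have [] := df x.
Qed.

Lemma elementary_prim (f : R -> R) : elementary f ->
  exists g, [/\ elementary g, forall t : R, is_derive t (1 : R) f (g t) &
    forall t, 0 <= t -> f t = f 0 + prim g t].
Proof.
move=> ef; have [g eg df] := elementary_derive ef; exists g; split=> //.
by apply: derive_prim => //; exact: elementary_continuous.
Qed.

Lemma cac_real (f g : R -> R) : loc_intg g ->
  (forall t, 0 <= t -> f t = f 0 + prim g t) ->
  cac (fun t => (f t)%:C) (fun t => (g t)%:C).
Proof.
move=> gl e; split=> [b|t t0].
  by split; [exact: gl|exact: integrable0].
rewrite e// /cprim /complex_integral /= Rintegral_cst// mul0r.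
by rewrite rmorphD.
Qed.

Lemma vac_const n (w g : R -> C) (v : 'cV[C]_n) : cac w g ->
  vac (fun t => w t *: v) (fun t => g t *: v).
Proof.
move=> wg i.
rewrite (_ : (fun t => (w t *: v) i 0) = (fun t => v i 0 * w t)); last first.
  by apply/funext => t; rewrite mxE mulrC.
rewrite (_ : (fun t => (g t *: v) i 0) = (fun t => v i 0 * g t)); last first.
  by apply/funext => t; rewrite mxE mulrC.
exact: cacZ.
Qed.

Lemma vac_mulmx m n (M : 'M[C]_(m, n)) (W G : R -> 'cV[C]_n) : vac W G ->
  vac (fun t => M *m W t) (fun t => M *m G t).
Proof.
move=> WG i; under [X in cac X _]funext do rewrite mxE.
under [X in cac _ X]funext do rewrite mxE.
by apply: cac_sum => j; apply: cacZ; exact: WG.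
Qed.

Lemma vac_lin n (a : C) (W1 G1 W2 G2 : R -> 'cV[C]_n) : vac W1 G1 -> vac W2 G2 ->
  vac (fun t => a *: W1 t + W2 t) (fun t => a *: G1 t + G2 t).
Proof.
move=> h1 h2 i; under [X in cac X _]funext do rewrite !mxE.
under [X in cac _ X]funext do rewrite !mxE.
by apply: cacD; [apply: cacZ; exact: h1|exact: h2].
Qed.

Lemma cmeas_half_line (f : R -> C) : (forall b : R, complex_measurable `[0, b] f) ->
  complex_measurable half_line f.
Proof.
by move=> mf; split; apply: measurable_half_line => b; case: (mf b).
Qed.

Lemma vac_meas n (W G : R -> 'cV[C]_n) : vac W G ->
  mx_measurable half_line W /\ mx_measurable half_line G.
Proof.
move=> WG; split=> i j; rewrite (ord1 j); have [l e] := WG i; last first.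
  by apply: cmeas_half_line => b; exact: cintg_meas.
apply: cmeas_half_line => b.
have lr : loc_intg (fun s => Re (G s i 0)) by move=> c; case: (l c).
have li : loc_intg (fun s => Im (G s i 0)) by move=> c; case: (l c).
split.
  apply: (eq_measurable_fun (fun t => Re (W 0 i 0) + prim (fun s => Re (G s i 0)) t)).
    by move=> t /set_mem; rewrite /= in_itv /= => /andP[t0 _]; rewrite (e t t0) ReD.
  by apply: measurable_funD => //; exact: measurable_prim.
apply: (eq_measurable_fun (fun t => Im (W 0 i 0) + prim (fun s => Im (G s i 0)) t)).
  by move=> t /set_mem; rewrite /= in_itv /= => /andP[t0 _]; rewrite (e t t0) ImD.
by apply: measurable_funD => //; exact: measurable_prim.
Qed.

Lemma vac_distr_derivative n (W G f g : R -> 'cV[C]_n) : vac W G ->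
  mx_measurable half_line f -> mx_measurable half_line g ->
  {ae mu, forall t, half_line t -> W t = f t} ->
  {ae mu, forall t, half_line t -> G t = g t} -> distr_derivative f g.
Proof.
move=> WG mf mg Wf Gg phi tphi i; have [l e] := WG i.
have [_ mG] := vac_meas WG.
have cphi : complex_measurable half_line (fun t => (phi t)%:C).
  split; last exact: measurable_cst.
  by apply: measurable_continuous => //; have [] := test_function_continuous tphi.
rewrite (@complex_ibp_test _ _ (fun t => G t i 0) (W 0 i 0))//.
- congr (- _); apply: cint_ae => //; try (by apply: cmeasM).
  by apply: (aeS Gg) => t Ht t0; rewrite Ht.
- by apply: (aeS Wf) => t Ht t0; rewrite -Ht// e//; exact/half_lineP.
Qed.

Lemma ae_forall_ord n (P : 'I_n -> R -> Prop) :
  (forall i, {ae mu, forall t, P i t}) -> {ae mu, forall t, forall i, P i t}.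
Proof.
move=> HP.
have S (s : seq 'I_n) : {ae mu, forall t, forall i, i \in s -> P i t}.
  elim: s => [|i s IHs]; first by apply: aeW.
  by apply: (aeS2 (HP i) IHs) => t h1 h2 j; rewrite inE => /orP[/eqP->|/h2].
by apply: (aeS (S (index_enum 'I_n))) => t Ht i; apply: Ht; rewrite mem_index_enum.
Qed.

Lemma distr_derivative_vac n (f g : R -> 'cV[C]_n) :
  (forall i, cloc (fun t => f t i 0)) -> (forall i, cloc (fun t => g t i 0)) ->
  distr_derivative f g ->
  exists W, vac W g /\ {ae mu, forall t, half_line t -> W t = f t}.
Proof.
move=> fl gl fg.
have /choice[c Hc] : forall i, exists c, {ae mu, forall t, half_line t ->
    f t i 0 = c + cprim (fun s => g s i 0) t}.
  by move=> i; apply: complex_du_bois_reymond => // phi tphi; exact: fg.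
exists (fun t => \col_i (c i + cprim (fun s => g s i 0) t)); split.
  move=> i; split=> // t t0; rewrite !mxE; congr (_ + _).
  rewrite [cprim _ 0](_ : _ = 0) ?addr0//.
  by rewrite /cprim /complex_integral set_itv1 !Rintegral_set1.
have {}Hc : {ae mu, forall t, forall i, half_line t ->
    f t i 0 = c i + cprim (fun s => g s i 0) t} by exact: ae_forall_ord.
apply: (aeS Hc) => t Ht t0; apply/matrixP => i j.
by rewrite (ord1 j) mxE Ht.
Qed.

End AbsolutelyContinuous.

(** * Green's formula and the adjoint *)

Section MaximalOperator.
Variable R : realType.
Local Notation C := R[i].
Local Notation mu := (@lebesgue_measure R).
Local Notation Re := complex.Re.
Local Notation Im := complex.Im.
Let mD : measurable (half_line : set R) := @half_line0 R.
Variables (d : nat) (H : R -> 'M[C]_d) (hH : hamiltonian_density H).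
Variables (P1 P0 : 'M[C]_d).
Hypotheses (hP1 : P1^t* = P1) (uP1 : P1 \in unitmx) (hP0 : P0^t* = - P0).
Local Notation ip := (L2H_ip hH).
Implicit Types (x y u v : L2H hH).

(* [y = P1 (H x)' + P0 H x], where [W] is the absolutely continuous
   representative of [H x] and [c = (H x)(0)]. *)
Definition maximal x y (c : 'cV[C]_d) : Prop :=
  exists W G, [/\ vac W G, W 0 = c,
    {ae mu, forall t, half_line t -> W t = H t *m L2H_repr x t} &
    {ae mu, forall t, half_line t -> L2H_repr y t = P1 *m G t + P0 *m W t}].

(** The weight disappears pointwise: [y1^* H x2 = y1^* W2] and [x1^* H y2 = W1^* y2]. The terms with
    [P0] cancel by skew-symmetry, and what remains is the derivative of [W1^* P1 W2], which is
    integrable together with its derivative. *)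
Lemma maximal_green x1 y1 c1 x2 y2 c2 : maximal x1 y1 c1 -> maximal x2 y2 c2 ->
  ip y1 x2 + ip x1 y2 = - hform P1 c1 c2.
Proof.
move=> [W1 [G1 [a1 <- w1 e1]]] [W2 [G2 [a2 <- w2 e2]]].
have F := hform_cac P1 a1 a2.
have [mW1 mG1] := vac_meas a1; have [mW2 mG2] := vac_meas a2.
have mP1 : mx_measurable (half_line : set R) (fun=> P1) by exact: mxmeas_cst.
have mF' : complex_measurable half_line
    (fun t => hform P1 (G1 t) (W2 t) + hform P1 (W1 t) (G2 t)).
  by apply: cmeasD; exact: cmeas_hform2.
have i12 := cintgD mD (L2H_ip_cintg y1 x2) (L2H_ip_cintg x1 y2).
have E : {ae mu, forall t, half_line t ->
    hform (H t) (L2H_repr y1 t) (L2H_repr x2 t) +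
    hform (H t) (L2H_repr x1 t) (L2H_repr y2 t) =
    hform P1 (G1 t) (W2 t) + hform P1 (W1 t) (G2 t)}.
  have a1' := aeS2 (ae_hermitian_psd hH) w1 (fun t h k => conj h k).
  have a2' := aeS2 w2 (aeS2 e1 e2 (fun t h k => conj h k)) (fun t h k => conj h k).
  apply: (aeS2 a1' a2') => t [hh ww1] [ww2 [ee1 ee2]] t0.
  have [HH _] := hh t0.
  have q1 a b : hform (H t) a b = hform 1%:M a (H t *m b) by rewrite hform_mulr mul1mx.
  have q2 a b : hform (H t) a b = hform 1%:M (H t *m a) b by rewrite hform_mull HH mulmx1.
  rewrite q1 [X in _ + X]q2 -ww1// -ww2// ee1// ee2//.
  rewrite hformDl hformDr !hform_mull !hform_mulr hP1 hP0 !mulmx1 !mul1mx.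
  have -> : hform (- P0) (W1 t) (W2 t) = - hform P0 (W1 t) (W2 t).
    by rewrite /hform mulmxN mulNmx mxE.
  by rewrite addrACA [X in _ + X]addrC subrr addr0.
have iF' := cintg_aeeq mD mF' E i12.
have iF : cintg half_line (fun t => hform P1 (W1 t) (W2 t)).
  apply: vsq_cintg_hform => //.
    apply: vsq_aeeq (in_L2H_mul_vsq hH (L2H_repr_in x1)) => //.
    by apply: (aeS w1) => t e t0; rewrite e.
  apply: vsq_aeeq (in_L2H_mul_vsq hH (L2H_repr_in x2)) => //.
  by apply: (aeS w2) => t e t0; rewrite e.
rewrite (cac_integrable_limit F iF iF') opprK /L2H_ip -cintD//; try exact: L2H_ip_cintg.
by apply: cint_ae => //; exact: cintg_meas.
Qed.

Lemma maximal_lin (a : C) x1 y1 c1 x2 y2 c2 : maximal x1 y1 c1 -> maximal x2 y2 c2 ->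
  maximal (a *: x1 + x2) (a *: y1 + y2) (a *: c1 + c2).
Proof.
move=> [W1 [G1 [a1 <- w1 e1]]] [W2 [G2 [a2 <- w2 e2]]].
exists (fun t => a *: W1 t + W2 t), (fun t => a *: G1 t + G2 t); split=> //.
- exact: vac_lin.
- apply: (aeS2 (aeS2 w1 w2 (fun t h1 h2 => conj h1 h2)) (L2H_repr_lin a x1 x2)).
  move=> t [h1 h2] hx t0; rewrite hx// h1// h2//.
  by rewrite mulmxDr -scalemxAr.
- apply: (aeS2 (aeS2 e1 e2 (fun t h1 h2 => conj h1 h2)) (L2H_repr_lin a y1 y2)).
  move=> t [h1 h2] hx t0; rewrite hx// h1// h2// !mulmxDr -!scalemxAr scalerDr.
  by rewrite addrACA.
Qed.

Lemma maximal_boundary_value (S : 'M[C]_d) x y c : maximal x y c ->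
  value0 (fun t => S *m (H t *m L2H_repr x t)) = S *m c.
Proof.
move=> [W [G [WG <- Wx _]]]; apply: has_value0P.
have := vac_has_value0 (vac_mulmx S WG) (y := fun t => S *m (H t *m L2H_repr x t)).
by apply; apply: (aeS Wx) => t e t0; rewrite e.
Qed.

Lemma L2H_reprN v : {ae mu, forall t, half_line t ->
  L2H_repr (- v) t = - L2H_repr v t}.
Proof.
apply: (aeS2 (L2H_repr_lin (-1) v 0) (L2H_repr0 hH)) => t h1 h2 t0.
by have := h1 t0; rewrite h2// !addr0 !scaleN1r.
Qed.

Lemma mul_repr_cloc x i : cloc (fun t => (H t *m L2H_repr x t) i 0).
Proof.
apply: vsq_cloc => b; apply: vsqS (in_L2H_mul_vsq hH (L2H_repr_in x)) => //.
exact: sub_half_line.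
Qed.

Lemma repr_cloc x i : cloc (fun t => L2H_repr x t i 0).
Proof. by apply: vsq_cloc; exact: in_L2H_vsq_loc (L2H_repr_in x). Qed.

Lemma graph_maximal x y : ph_graph hH P1 P0 (x, y) -> maximal x y 0.
Proof.
move=> [/= [_ v0] [g xg yg]].
have [W [Wg Wx]] := distr_derivative_vac (mul_repr_cloc x) (repr_cloc g) xg.
have W0 : W 0 = 0 := has_value0_unique (vac_has_value0 Wg Wx) v0.
exists W, (L2H_repr g); split=> //.
by apply: (aeS2 Wx yg) => t h1 h2 t0; rewrite h2// h1.
Qed.

(** The derivative is recovered as [P1^-1 (y - P0 H x)]. Since [y] is in X and [P0 H x] is square
    integrable, its membership in X comes down to the invariance of X under [P1^-1]. *)
Lemma maximal_graph x y :
  (forall z, in_L2H H z -> in_L2H H (fun t => invmx P1 *m z t)) ->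
  maximal x y 0 -> ph_graph hH P1 P0 (x, y).
Proof.
move=> P1X [W [G [WG W0 Wx yE]]].
have v0 := vac_has_value0 WG Wx; rewrite W0 in v0.
have hz : in_L2H H (fun t => - P0 *m (H t *m L2H_repr x t) + L2H_repr y t).
  have h1 : in_L2H H (fun t => - P0 *m (H t *m L2H_repr x t)).
    by apply: vsq_in_L2H => //; apply: vsq_mulmx => //; exact: in_L2H_mul_vsq (L2H_repr_in x).
  have := in_L2H_lin hH 1 h1 (L2H_repr_in y).
  by rewrite (_ : 1 *: _ + _ = fun t => - P0 *m (H t *m L2H_repr x t) + L2H_repr y t)//
    scale1r.
have [g gE] := L2H_class hH (P1X _ hz).
have Gg : {ae mu, forall t, half_line t -> G t = L2H_repr g t}.
  apply: (aeS2 (aeS2 Wx yE (fun t h1 h2 => conj h1 h2)) gE) => t [h1 h2] h3 t0.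
  by rewrite h3// h2// -h1// mulNmx addrC addrK mulKmx.
have dg : distr_derivative (fun t => H t *m L2H_repr x t) (L2H_repr g).
  apply: (vac_distr_derivative WG _ _ Wx Gg).
    exact: vsq_meas (in_L2H_mul_vsq hH (L2H_repr_in x)).
  exact: in_L2H_meas (L2H_repr_in g).
split; first by split=> //; exists g.
exists g => //=; apply: (aeS2 (aeS2 Wx yE (fun t h1 h2 => conj h1 h2)) Gg).
by move=> t [h1 h2] h3 t0; rewrite h2// h1// h3.
Qed.

(** Square integrability of [W] and [G] puts [G] and [P1 G + P0 W] in X directly, which makes these
    the pairs to test with. *)
Lemma supported_maximal (b : R) (W G : R -> 'cV[C]_d) : vac W G ->
  vsq half_line W -> vsq half_line G -> (forall t, b < t -> W t = 0) ->
  exists x y, [/\ maximal x y (W 0),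
    {ae mu, forall t, half_line t -> L2H_repr x t = unweight H W t},
    {ae mu, forall t, half_line t -> L2H_repr y t = P1 *m G t + P0 *m W t} &
    W 0 = 0 -> ph_graph hH P1 P0 (x, y)].
Proof.
move=> WG W2 G2 out.
have [x xE] := L2H_class hH (unweight_supported hH W2 out).
have hy : in_L2H H (fun t => P1 *m G t + P0 *m W t).
  apply: vsq_in_L2H => // i.
  have := vsq_lin 1 mD (vsq_mulmx P1 mD G2) (vsq_mulmx P0 mD W2) i.
  by under [X in csq _ X]funext do rewrite scale1r.
have [y yE] := L2H_class hH hy.
have [g gE] := L2H_class hH (vsq_in_L2H hH G2).
have Wx : {ae mu, forall t, half_line t -> W t = H t *m L2H_repr x t}.
  by apply: (aeS2 xE (mul_unweight hH W)) => t h1 h2 t0; rewrite h1// h2.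
exists x, y; split=> //; first by exists W, G.
move=> W0.
have dg : distr_derivative (fun t => H t *m L2H_repr x t) (L2H_repr g).
  apply: (vac_distr_derivative WG _ _ Wx).
  - exact: vsq_meas (in_L2H_mul_vsq hH (L2H_repr_in x)).
  - exact: in_L2H_meas (L2H_repr_in g).
  - by apply: (aeS gE) => t e t0; rewrite e.
have v0 := vac_has_value0 WG Wx; rewrite W0 in v0.
split; first by split=> //; exists g.
exists g => //=; apply: (aeS2 (aeS2 Wx yE (fun t h1 h2 => conj h1 h2)) gE).
by move=> t [h1 h2] h3 t0; rewrite h2// h1// h3.
Qed.

(** In Green's formula against an element of the graph the boundary term vanishes, as that element
    has boundary value 0. *)
Lemma maximal_adjoint x y c : maximal x y c ->
  adjoint_graph ip (ph_graph hH P1 P0) (x, - y).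
Proof.
move=> xy [u v] /graph_maximal uv /=.
have := maximal_green uv xy.
rewrite [hform _ _ _](_ : _ = 0); last by rewrite /hform trmx0 map_mx0 !mul0mx mxE.
rewrite oppr0 => /eqP; rewrite addr_eq0 => /eqP ->.
by rewrite (formNr (L2H_ip_sesquilinear hH)).
Qed.

Lemma vsq_bounded_supported n (b : R) (W : R -> 'cV[C]_n) (K : R) :
  mx_measurable half_line W -> (forall t, half_line t -> vsqnorm (W t) <= K) ->
  (forall t, b < t -> W t = 0) -> vsq half_line W.
Proof.
move=> mW WK out; apply/vsqP => //; split=> //.
apply: (@intg_half_line_itv _ _ b).
  apply: (@intg_bounded _ _ _ K) => //; first exact: muitv.
    apply: (@measurable_funS _ _ _ _ half_line) => //; first exact: sub_half_line.
    have [m _] := cmeas_hform (@mxmeas_cst R half_line _ _ 1%:M) mW.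
    by apply: (eq_measurable_fun _ _ m) => t _; rewrite vsqnormE.
  by move=> t /sub_half_line tb; rewrite ger0_norm ?vsqnorm_ge0// WK.
move=> t bt; rewrite out// /vsqnorm big1// => i _.
by rewrite mxE /sqnorm /= expr0n addr0.
Qed.

Lemma vsq_scaled_supported n (f : R -> R) (b : R) (c : 'cV[C]_n) : continuous f ->
  (forall t, b < t -> f t = 0) -> vsq half_line (fun t => (f t)%:C *: c).
Proof.
move=> cf f0; have [K HK] := continuous_bounded b cf.
have nE (a : R) : vsqnorm (a%:C *: c) = a ^+ 2 * vsqnorm c.
  by rewrite vsqnormZ {1}/sqnorm /= expr0n addr0.
apply: (@vsq_bounded_supported _ b _ (K ^+ 2 * vsqnorm c)) => [i j|t /half_lineP t0|t bt].
- under [X in complex_measurable _ X]funext do rewrite mxE.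
  apply: cmeasM; last exact: cmeas_cst.
  by split; [exact: measurable_continuous|exact: measurable_cst].
- rewrite nE ler_wpM2r ?vsqnorm_ge0//; have [tb|bt] := leP t b; last first.
    by rewrite f0// expr0n sqr_ge0.
  by rewrite -real_normK ?num_real// lerXn2r ?nnegrE// ?(le_trans _ (HK t _))//
     ?HK//= in_itv /= t0.
- by rewrite f0// scale0r.
Qed.

Lemma adjoint_maximal u v : adjoint_graph ip (ph_graph hH P1 P0) (u, v) ->
  exists c, maximal u (- v) c.
Proof.
move=> adj; pose w t := H t *m L2H_repr u t.
have w2 : vsq half_line w := in_L2H_mul_vsq hH (L2H_repr_in u).
(* Solving [- v = P1 w' + P0 w] for [P1 w'] gives this candidate for the weak derivative of
   [P1 w]. *)
pose g t := - (L2H_repr v t + P0 *m w t).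
have wl i : cloc (fun t => (P1 *m w t) i 0).
  apply: vsq_cloc => b; apply: vsq_mulmx => //.
  by apply: vsqS w2 => //; exact: sub_half_line.
have gl i : cloc (fun t => g t i 0).
  move=> b; apply: (@cintg_ext _ _ (fun t => -1 * (L2H_repr v t i 0 + (P0 *m w t) i 0))) => //.
    by move=> t _; rewrite mulN1r !mxE.
  apply: cintgZ => //; apply: cintgD => //; first exact: repr_cloc.
  by apply: vsq_cloc => c; apply: vsq_mulmx => //; apply: vsqS w2 => //; exact: sub_half_line.
have dd : distr_derivative (fun t => P1 *m w t) g.
  move=> phi tphi i.
  have [b b0 out] := test_function_itv tphi.
  have [cphi cphi'] := test_function_continuous tphi.
  pose e : 'cV[C]_d := delta_mx i 0.
  pose W t := (phi t)%:C *: e; pose G t := (derive1 phi t)%:C *: e.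
  have WG : vac W G.
    apply: vac_const; apply: cac_real; first exact: continuous_intg.
    move=> t t0; rewrite -test_function_prim// (proj1 (out 0 _)) ?add0r//.
    by left.
  have [mW mG] := vac_meas WG.
  have vW : vsq half_line W.
    by apply: (vsq_scaled_supported (b := b)) => // t bt; apply: (out t _).1; right; exact: ltW.
  have vG : vsq half_line G.
    by apply: (vsq_scaled_supported (b := b)) => // t bt; apply: (out t _).2; right; exact: ltW.
  have outW t : b < t -> W t = 0.
    by move=> bt; rewrite /W (proj1 (out t _)) ?scale0r//; right; exact: ltW.
  (* The pair built from [phi] and a unit vector has boundary value 0, so the adjoint relation holds
     for it; written out, it is the weak derivative identity in the coordinate [i]. *)
  have [x [y [_ xE yE gr]]] := supported_maximal WG vW vG outW.
  have W0 : W 0 = 0 by rewrite /W (proj1 (out 0 _)) ?scale0r//; left.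
  have := adj _ (gr W0); rewrite /= /L2H_ip.
  have cW : csq half_line (fun t => (phi t)%:C).
    by have := vW i; under [X in csq _ X]funext do rewrite !mxE !eqxx mulr1.
  have cG : csq half_line (fun t => (derive1 phi t)%:C).
    by have := vG i; under [X in csq _ X]funext do rewrite !mxE !eqxx mulr1.
  have i1 : cintg half_line (fun t => (derive1 phi t)%:C * (P1 *m w t) i 0).
    by apply: csqM => //; exact: vsq_mulmx.
  have i2 : cintg half_line (fun t => (phi t)%:C * (P0 *m w t) i 0).
    by apply: csqM => //; exact: vsq_mulmx.
  have cr (M : 'M[C]_d) (a : R) z : hform M (a%:C *: e) z = a%:C * (M *m z) i 0.
    rewrite (formZl (hform_sesquilinear M)) hform_delta; congr (_ * _).
    by apply: complex_ext; rewrite ?Re_conj ?Im_conj /= ?oppr0.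
  have E2 : {ae mu, forall t, half_line t ->
      hform (H t) (L2H_repr x t) (L2H_repr v t) = (phi t)%:C * L2H_repr v t i 0}.
    apply: (aeS2 (aeS2 xE (mul_unweight hH W) (fun t h k => conj h k)) (ae_hermitian_psd hH)).
    move=> t [h1 h2] h3 t0; have [HH _] := h3 t0; rewrite h1//.
    have -> : hform (H t) (unweight H W t) (L2H_repr v t) =
        hform 1%:M (H t *m unweight H W t) (L2H_repr v t) by rewrite hform_mull HH mulmx1.
    by rewrite h2// cr mul1mx.
  have m3 : complex_measurable half_line (fun t => (phi t)%:C * L2H_repr v t i 0).
    apply: cmeasM; first exact: csq_meas.
    by have := in_L2H_meas (L2H_repr_in v) i 0.
  have i3 := cintg_aeeq mD m3 E2 (L2H_ip_cintg x v).
  rewrite [X in _ = X](cint_ae mD (cintg_meas (L2H_ip_cintg x v)) m3 E2).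
  have E1 : {ae mu, forall t, half_line t ->
      hform (H t) (L2H_repr y t) (L2H_repr u t) =
      (derive1 phi t)%:C * (P1 *m w t) i 0 + - ((phi t)%:C * (P0 *m w t) i 0)}.
    apply: (aeS yE) => t h1 t0; rewrite h1//.
    have -> : forall z, hform (H t) z (L2H_repr u t) = hform 1%:M z (w t).
      by move=> z; rewrite hform_mulr mul1mx.
    rewrite hformDl !hform_mull hP1 hP0 !mulmx1 !cr.
    by rewrite -mulrN; congr (_ + _ * _); rewrite mulNmx mxE.
  rewrite [X in X = _](cint_ae mD (cintg_meas (L2H_ip_cintg y u)) _ E1); last first.
    by apply: cintg_meas; apply: cintgD => //; apply: cintgN.
  rewrite cintD//; last exact: cintgN.
  rewrite cintN// => /eqP; rewrite subr_eq => /eqP ->.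
  rewrite -cintD// -cintN//; first by apply: cint_ext => t _; rewrite !mxE; ring.
  apply: (@cintg_ext _ _ (fun t =>
    - ((phi t)%:C * L2H_repr v t i 0 + (phi t)%:C * (P0 *m w t) i 0))) => //.
    by move=> t _; rewrite !mxE; ring.
  by apply: cintgN => //; exact: cintgD.
have [W [Wg Ww]] := distr_derivative_vac wl gl dd.
(* What has become absolutely continuous is [P1 H u]; multiplying by [P1^-1] gives the
   representative of [H u]. *)
exists (invmx P1 *m W 0), (fun t => invmx P1 *m W t), (fun t => invmx P1 *m g t).
split=> //; first exact: vac_mulmx.
  by apply: (aeS Ww) => t e t0; rewrite e// mulKmx.
apply: (aeS2 Ww (L2H_reprN v)) => t h1 h2 t0.
by rewrite h2// h1// mulKVmx// mulKmx// /g opprD addrNK.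
Qed.

End MaximalOperator.

Section AbstractForms.
Variables (R : realType) (X : lmodType R[i]) (ip : X -> X -> R[i]).
Hypotheses (ip_sesq : sesquilinear_form ip) (ip_conj : forall x y, ip x y = (ip y x)^*)
  (ip_ge0 : forall x, 0 <= complex.Re (ip x x)).

(** For every [n] the left-hand side is, up to sign, the same expression in the differences
    [u n - x] and [v n - y], and Cauchy-Schwarz bounds it by their norms. *)
Lemma form_limit0 (u v : nat -> X) x y a b : ip_cvg ip u x -> ip_cvg ip v y ->
  (forall n, ip a (u n) + ip b (v n) = 0) -> ip a x + ip b y = 0.
Proof.
move=> ux vy uv0; apply: sqnorm_eq0; apply/eqP; rewrite eq_le sqnorm_ge0 andbT.
pose f n := ip_norm ip (u n - x); pose g n := ip_norm ip (v n - y).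
pose A := complex.Re (ip a a); pose B := complex.Re (ip b b).
have l : (fun n => 2 * (A * (f n * f n) + B * (g n * g n))) @ \oo -->
    (2 * (A * (0 * 0) + B * (0 * 0)) : R).
  by apply: cvgMr; apply: cvgD; apply: cvgMr; apply: cvgM.
rewrite !(mul0r, mulr0, addr0) in l.
apply: (cvgr_to_ge l); apply: nearW => n.
have -> : ip a x + ip b y = - (ip a (u n - x) + ip b (v n - y)).
  rewrite !(formBr ip_sesq) opprD !opprB.
  by rewrite addrACA -opprD uv0 subr0.
have nrm z : ip_norm ip z * ip_norm ip z = complex.Re (ip z z).
  by rewrite -expr2 sqr_sqrtr.
rewrite sqnormN.
apply: (le_trans (sqnormD _ _)); rewrite ler_pM2l//.
by rewrite /f /g !nrm lerD// form_cauchy_schwarz.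
Qed.

End AbstractForms.

(** * Linearity, skew-symmetry and closedness of the operator *)

Section GraphProperties.
Variable R : realType.
Local Notation C := R[i].
Local Notation mu := (@lebesgue_measure R).
Local Notation Re := complex.Re.
Local Notation Im := complex.Im.
Let mD : measurable (half_line : set R) := @half_line0 R.

Lemma elementary_derive0 (f g : R -> R) (b : R) :
  (forall t : R, is_derive t (1 : R) f (g t)) -> (forall t, b < t -> f t = 0) ->
  forall t, b < t -> g t = 0.
Proof.
move=> fg out t bt; have [_ <-] := fg t.
rewrite (@near_eq_derive _ _ _ _ (cst 0)) ?derive_cst//.
near=> u; apply: out; near: u; exact: lt_nbhsr.
Unshelve. all: by end_near. Qed.

Lemma cutoff : exists chi chi' : R -> R, [/\ continuous chi, continuous chi',
  chi 0 = 1, forall t, 1 < t -> chi t = 0 /\ chi' t = 0 &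
  forall t, 0 <= t -> chi t = chi 0 + prim chi' t].
Proof.
(* This is [e exp(-1 / (1 - t))] for [t < 1]; the factor [e] normalizes the value at 0 to 1. *)
pose chi : R -> R := cst (expR 1) * (fun t : R => expinv 0 (-1 * t + 1)).
have echi : elementary chi by do !constructor.
have [g [eg dg ge]] := elementary_prim echi.
have out t : 1 < t -> chi t = 0.
  move=> t1; rewrite /chi fctE /expinv ifF ?mulr0//; apply/negbTE.
  by rewrite -leNgt mulN1r addrC subr_le0 ltW.
exists chi, g; split=> //.
- exact: elementary_continuous.
- exact: elementary_continuous.
- rewrite /chi fctE /expinv mulr0 add0r ltr01 expr0 mul1r invr1 /= -expRD.
  by rewrite subrr expR0.
- by move=> t t1; split; [exact: out|exact: elementary_derive0 dg out t t1].
Qed.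

(** The weak derivative of the zero function is 0. Hence the derivative of an absolutely continuous
    representative is unique almost everywhere, and the operator is single-valued. *)
Lemma vac_ae0 n (W G : R -> 'cV[C]_n) : vac W G ->
  {ae mu, forall t, half_line t -> W t = 0} -> {ae mu, forall t, half_line t -> G t = 0}.
Proof.
move=> WG W0.
have G0 i : {ae mu, forall t, half_line t -> G t i 0 = 0}.
  have [l e] := WG i.
  have We : {ae mu, forall t, half_line t -> (0 : C) = W 0 i 0 + cprim (fun s => G s i 0) t}.
    by apply: (aeS W0) => t h t0; rewrite -(e t (proj1 (half_lineP t) t0)) h// mxE.
  have Z phi : test_function phi ->
      complex_integral half_line (fun t => (phi t)%:C * G t i 0) = 0.
    move=> tphi; have := complex_ibp_test (cmeas_cst _ _) l We tphi.
    rewrite [X in X = _](_ : _ = 0).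
      by move=> /esym/eqP; rewrite oppr_eq0 => /eqP.
    rewrite (@cint_ext _ _ _ (fun=> 0 * 0)); last by move=> t _; rewrite !mulr0.
    by rewrite (cintZ 0 mD (cintg0 mD)) mul0r.
  have r : {ae mu, forall t, half_line t -> Re (G t i 0) = 0}.
    apply: ae0_of_test => [b|phi tphi]; first by case: (l b).
    have /(congr1 (@complex.Re R)) /= <- := Z phi tphi.
    by apply: Rint_ext => t _; rewrite ReM /= mul0r subr0.
  have im : {ae mu, forall t, half_line t -> Im (G t i 0) = 0}.
    apply: ae0_of_test => [b|phi tphi]; first by case: (l b).
    have /(congr1 (@complex.Im R)) /= <- := Z phi tphi.
    by apply: Rint_ext => t _; rewrite ImM /= mul0r addr0.
  by apply: (aeS2 r im) => t h1 h2 t0; apply: complex_ext; rewrite ?h1 ?h2.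
have {}G0 : {ae mu, forall t, forall i, half_line t -> G t i 0 = 0}.
  exact: ae_forall_ord.
apply: (aeS G0) => t Ht t0; apply/matrixP => i j.
by rewrite (ord1 j) mxE Ht.
Qed.

Variables (d : nat) (H : R -> 'M[C]_d) (hH : hamiltonian_density H).
Variables (P1 P0 : 'M[C]_d).
Hypotheses (hP1 : P1^t* = P1) (uP1 : P1 \in unitmx) (hP0 : P0^t* = - P0).
Hypothesis P1X : forall z, in_L2H H z -> in_L2H H (fun t => invmx P1 *m z t).
Local Notation ip := (L2H_ip hH).
Local Notation A := (ph_graph hH P1 P0).

(** A smooth cutoff equal to 1 at the origin, times the constant vector [c]. *)
Lemma maximal_surjective c : exists x y, maximal (hH := hH) P1 P0 x y c.
Proof.
have [chi [chi' [cc cc' chi0 out chiE]]] := cutoff.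
pose W t := (chi t)%:C *: c; pose G t := (chi' t)%:C *: c.
have WG : vac W G by apply: vac_const; apply: cac_real => //; exact: continuous_intg.
have sW : vsq half_line W := vsq_scaled_supported c cc (fun t h => (out t h).1).
have sG : vsq half_line G := vsq_scaled_supported c cc' (fun t h => (out t h).2).
have W0 t : 1 < t -> W t = 0 by move=> /out[t0 _]; rewrite /W t0 scale0r.
have [x [y [xy _ _ _]]] := supported_maximal hH P1 P0 WG sW sG W0.
by exists x, y; move: xy; rewrite /W chi0 scale1r.
Qed.

Lemma ph_graph_linear : linear_operator A.
Proof.
have m0 : maximal (hH := hH) P1 P0 0 0 0.
  exists (fun=> 0), (fun=> 0); split=> //.
  - by move=> i; have := cac_cst (0 : C); under [X in _ -> cac X _]funext do rewrite mxE;
      under [X in _ -> cac _ X]funext do rewrite mxE.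
  - by apply: (aeS (L2H_repr0 hH)) => t h t0; rewrite h// mulmx0.
  - by apply: (aeS (L2H_repr0 hH)) => t h t0; rewrite h// !mulmx0 addr0.
split.
- exact: maximal_graph.
- move=> a [x1 y1] [x2 y2] /graph_maximal h1 /graph_maximal h2.
  apply: maximal_graph => //; have := maximal_lin a h1 h2.
  by rewrite scaler0 addr0.
- move=> y /graph_maximal[W [G [WG _ Wx yE]]]; apply: L2H_eq.
  have W0 : {ae mu, forall t, half_line t -> W t = 0}.
    by apply: (aeS2 Wx (L2H_repr0 hH)) => t h k t0; rewrite h// k// mulmx0.
  apply: (aeS2 (aeS2 W0 (vac_ae0 WG W0) (fun t h k => conj h k))
    (aeS2 yE (L2H_repr0 hH) (fun t h k => conj h k))) => t [h1 h2] [h3 h4] t0.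
  by rewrite h3// h4// h1// h2// !mulmx0 addr0.
Qed.

Lemma ph_graph_skew : skew_symmetric ip A.
Proof.
move=> [x1 y1] [x2 y2] /graph_maximal h1 /graph_maximal h2 /=.
apply/eqP; rewrite -addr_eq0 (maximal_green hP1 hP0 h1 h2).
by rewrite (form0l (hform_sesquilinear P1)) oppr0.
Qed.

(* A limit [(x, y)] of the graph is maximal, with some boundary value [c]; testing
   Green's formula against a pair with boundary value [P1 c] gives [|P1 c|^2 = 0]. *)
Lemma ph_graph_closed : closed_operator ip A.
Proof.
move=> u v x y uv ux vy.
have lim0 := form_limit0 (L2H_ip_sesquilinear hH) (L2H_ip_conj (hH := hH))
  (Re_L2H_ip_ge0 (hH := hH)) ux vy.
have adj : adjoint_graph ip A (x, - y).
  move=> p Ap /=; rewrite (formNr (L2H_ip_sesquilinear hH)).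
  apply/eqP; rewrite -addr_eq0; apply/eqP/lim0 => n.
  by apply/eqP; rewrite addr_eq0 (ph_graph_skew Ap (uv n)).
have [c mxy] := adjoint_maximal hP1 uP1 hP0 adj; rewrite opprK in mxy.
suff c0 : c = 0 by apply: maximal_graph => //; rewrite c0 in mxy.
have [a [b mab]] := maximal_surjective (P1 *m c).
have /lim0 h n : ip b (u n) + ip a (v n) = 0.
  rewrite (maximal_green hP1 hP0 mab (graph_maximal (uv n))).
  by rewrite (form0r (hform_sesquilinear P1)) oppr0.
have := maximal_green hP1 hP0 mab mxy; rewrite h => /esym/eqP; rewrite oppr_eq0.
have -> : hform P1 (P1 *m c) c = hform 1%:M (P1 *m c) (P1 *m c).
  by rewrite !hform_mull hform_mulr hP1 mulmx1.
rewrite vsqnormE => /eqP/(congr1 (@complex.Re R)) /= /vsqnorm_eq0 Pc.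
by rewrite -[c](mulKmx uP1) Pc mulmx0.
Qed.

End GraphProperties.

(** * The boundary map *)

Section BoundaryMap.
Variable R : realType.
Local Notation C := R[i].
Variables (np nm : nat) (H : R -> 'M[C]_(np + nm)) (hH : hamiltonian_density H).
Variables (P1 P0 S : 'M[C]_(np + nm)) (lam : 'rV[C]_np) (theta : 'rV[C]_nm).
Hypotheses (hP1 : P1^t* = P1) (uP1 : P1 \in unitmx) (hP0 : P0^t* = - P0).
Hypothesis hdiag : P1 = S^t* *m block_mx (diag_mx lam) 0 0 (- diag_mx theta) *m S.
Local Notation ip := (L2H_ip hH).
Local Notation A := (ph_graph hH P1 P0).
Local Notation F := (boundary_map hH S).

Lemma boundary_mapE (p : L2H hH * L2H hH) y c : maximal P1 P0 p.1 y c ->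
  F p = (usubmx (S *m c), dsubmx (S *m c)).
Proof. by move=> h; rewrite /boundary_map (maximal_boundary_value S h). Qed.

Lemma boundary_map_linear a p q : adjoint_graph ip A p -> adjoint_graph ip A q ->
  F (a *: p + q) = a *: F p + F q.
Proof.
case: p q => [x1 y1] [x2 y2] /(adjoint_maximal hP1 uP1 hP0)[c1 m1].
move=> /(adjoint_maximal hP1 uP1 hP0)[c2 m2].
rewrite (boundary_mapE (p := a *: (x1, y1) + (x2, y2)) (maximal_lin a m1 m2)).
rewrite (boundary_mapE (p := (x1, y1)) m1) (boundary_mapE (p := (x2, y2)) m2).
rewrite mulmxDr -scalemxAr.
congr (_, _); apply/matrixP => i j; by rewrite !mxE.
Qed.

Lemma boundary_map_surjective (g : 'cV[C]_np * 'cV[C]_nm) : S \in unitmx ->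
  exists2 p, adjoint_graph ip A p & F p = g.
Proof.
move=> uS; have [x [y xy]] := maximal_surjective hH P1 P0 (invmx S *m col_mx g.1 g.2).
exists (x, - y); first exact: maximal_adjoint xy.
by rewrite (boundary_mapE (p := (x, - y)) xy) mulKVmx// col_mxKu col_mxKd; case: g xy.
Qed.

Lemma hform_block (u v : 'cV[C]_(np + nm)) :
  hform (block_mx (diag_mx lam) 0 0 (- diag_mx theta)) u v =
  hform (diag_mx lam) (usubmx u) (usubmx v) - hform (diag_mx theta) (dsubmx u) (dsubmx v).
Proof.
rewrite -{1}[u]vsubmxK -{1}[v]vsubmxK /hform -mulmxA mul_block_col !mul0mx addr0 add0r.
by rewrite tr_col_mx map_row_mx mul_row_col mulNmx mulmxN !mulmxA !mxE.
Qed.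

(** Elements of the adjoint have the form [(x, - y)] with [(x, y)] maximal, which turns the minus
    sign of Green's formula into a plus: both sides are [c1^* P1 c2], the right one after the change
    of coordinates by [S]. *)
Lemma boundary_map_identity p q : adjoint_graph ip A p -> adjoint_graph ip A q ->
  std_symmetric_form ip p q =
  std_unitary_form (hform (diag_mx lam)) (hform (diag_mx theta)) (F p) (F q).
Proof.
case: p q => [x1 y1] [x2 y2] /(adjoint_maximal hP1 uP1 hP0)[c1 m1].
move=> /(adjoint_maximal hP1 uP1 hP0)[c2 m2].
rewrite (boundary_mapE (p := (x1, y1)) m1) (boundary_mapE (p := (x2, y2)) m2).
rewrite /std_symmetric_form /std_unitary_form /= -hform_block.
rewrite hform_mull hform_mulr -hdiag.
have := maximal_green hP1 hP0 m1 m2.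
rewrite (formNl (L2H_ip_sesquilinear hH)) (formNr (L2H_ip_sesquilinear hH)).
by move: (ip y1 x2) (ip x1 y2) (hform P1 c1 c2) => a b c E; apply: oppr_inj; rewrite -E opprD addrC.
Qed.

End BoundaryMap.

(** * Density of the domain *)

Section Density.
Variable R : realType.
Local Notation C := R[i].
Local Notation mu := (@lebesgue_measure R).
Local Notation Re := complex.Re.
Local Notation Im := complex.Im.
Let mD : measurable (half_line : set R) := @half_line0 R.

Lemma intg_sum (I : Type) (s : seq I) (D : set R) (f : I -> R -> R) : measurable D ->
  (forall i, intg D (f i)) -> intg D (fun t => \sum_(i <- s) f i t).
Proof.
move=> mE fi; elim: s => [|i s IHs].
  by under [X in intg _ X]funext do rewrite big_nil; exact: integrable0.
by under [X in intg _ X]funext do rewrite big_cons; exact: intgD.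
Qed.

Lemma Rint_sum (I : Type) (s : seq I) (D : set R) (f : I -> R -> R) : measurable D ->
  (forall i, intg D (f i)) ->
  \int[mu]_(t in D) \sum_(i <- s) f i t = \sum_(i <- s) \int[mu]_(t in D) f i t.
Proof.
move=> mE fi; elim: s => [|i s IHs].
  rewrite big_nil (@Rint_ext _ _ _ (fun=> 0)); last by move=> t _; rewrite big_nil.
  by rewrite /Rintegral integral_cst// mul0e.
rewrite big_cons -IHs -RintegralD//; [|exact: fi|exact: intg_sum].
by apply: Rint_ext => t _; rewrite big_cons.
Qed.

Lemma half_line_patch (f : R -> R) (b : R) : intg `[0, b] f ->
  intg half_line (f \_ `[0, b]) /\
  \int[mu]_(t in half_line) (f \_ `[0, b]) t = prim f b.
Proof.
move=> fi; have inE' t : `[0, b]%classic t -> (f \_ `[0, b]) t = f t.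
  by move=> tb; rewrite patchE mem_set.
have out t : b < t -> (f \_ `[0, b]) t = 0.
  by move=> bt; rewrite patchE memNset//= in_itv /= [t <= b]leNgt bt andbF.
split; last by rewrite (Rint_half_line out); exact: Rint_ext.
apply: intg_half_line_itv out.
by apply: intg_ext fi => // t tb; rewrite inE'.
Qed.

Lemma vsq_approximable (a b : R) n (w : R -> 'cV[C]_n) (e : R) : 0 <= a -> a < b ->
  vsq `[a, b] w -> 0 < e ->
  exists W G, [/\ vac W G, forall t, t <= a \/ b <= t -> W t = 0 /\ G t = 0,
    vsq half_line W, vsq half_line G &
    \int[mu]_(t in `[a, b]) vsqnorm (w t - W t) < e].
Proof.
move=> a0 ab w2 e0.
(* Each of the [2 n] real components contributes less than [del]; the added 1 makes the total fall
   strictly below [e] and covers [n = 0]. *)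
pose del := e / (2 * n%:R + 1).
have den0 : 0 < 2 * n%:R + 1 :> R by rewrite ltr_wpDl// mulr_ge0.
have del0 : 0 < del by rewrite divr_gt0.
have /choice[xr Hr] i : exists p : (R -> R) * (R -> R), prim_supported a b p.1 p.2 /\
    L2dist a b (fun t => Re (w t i 0)) p.1 < del.
  have [_ /(_ del del0)[xi [zeta h]]] := square_intg_approximable a0 ab (w2 i).1.
  by exists (xi, zeta).
have /choice[xm Hm] i : exists p : (R -> R) * (R -> R), prim_supported a b p.1 p.2 /\
    L2dist a b (fun t => Im (w t i 0)) p.1 < del.
  have [_ /(_ del del0)[xi [zeta h]]] := square_intg_approximable a0 ab (w2 i).2.
  by exists (xi, zeta).
pose W t : 'cV[C]_n := \col_i ((xr i).1 t +i* (xm i).1 t).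
pose G t : 'cV[C]_n := \col_i ((xr i).2 t +i* (xm i).2 t).
have out t : t <= a \/ b <= t -> W t = 0 /\ G t = 0.
  move=> tab; split; apply/matrixP => i j; rewrite !mxE.
    have [[_ /(_ t tab)[-> _] _ _] _] := Hr i.
    by have [[_ /(_ t tab)[-> _] _ _] _] := Hm i.
  have [[_ /(_ t tab)[_ ->] _ _] _] := Hr i.
  by have [[_ /(_ t tab)[_ ->] _ _] _] := Hm i.
have WG : vac W G.
  move=> i; split=> [c|t t0].
    split; under [X in intg _ X]funext do rewrite mxE.
      exact: prim_supported_loc (Hr i).1 c.
    exact: prim_supported_loc (Hm i).1 c.
  have W00 : W 0 i 0 = 0 by rewrite (proj1 (out 0 (or_introl a0))) mxE.
  rewrite W00 add0r mxE /cprim /complex_integral.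
  have [[er _ _ _] _] := Hr i; have [[em _ _ _] _] := Hm i.
  by rewrite er// em// /prim; congr (_ +i* _); apply: Rint_ext => s _; rewrite mxE.
have [mW mG] := vac_meas WG.
have sq (f : R -> R) : square_intg `[a, b] f -> (forall t, t <= a \/ b <= t -> f t = 0) ->
    measurable_fun half_line f -> square_intg half_line f.
  move=> [mf f2] f0 mfD; split=> //; apply: (@intg_half_line_itv _ _ b).
    have f2T := intgT_patch (measurable_itv `[a, b]) f2.
    apply: (@intg_ext _ _ ((fun t => f t ^+ 2) \_ `[a, b])) => //.
      move=> t _; rewrite patchE; case: ifPn => // /negP tab; rewrite f0 ?expr0n//.
      have [ta|at_] := leP t a; [by left|right].
      rewrite leNgt; apply/negP => tb; apply: tab; rewrite inE /= in_itv /=.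
      by rewrite !ltW.
    by apply: intgS f2T => //; exact: measurable_itv.
  by move=> t bt; rewrite f0 ?expr0n//; right; exact: ltW.
have supm i : square_intg `[a, b] (xm i).1 by exact: prim_supported_square_intg (Hm i).1.
have supr i : square_intg `[a, b] (xr i).1 by exact: prim_supported_square_intg (Hr i).1.
have subab := @sub_half_line_itv R a b a0.
have bsq (f : R -> R) : (exists M, forall t, `|f t| <= M) -> measurable_fun half_line f ->
    square_intg `[a, b] f.
  move=> [M HM] mfD; have mf := measurable_funS mD subab mfD; split=> //.
  apply: (@intg_bounded _ _ _ (M ^+ 2)) => //; first exact: muitv.
    exact: measurable_funX.
  move=> t _; rewrite normrX lerXn2r ?nnegrE//.
  exact: le_trans (HM t).
exists W, G; split=> //.
- move=> i; split.
    under [X in square_intg _ X]funext do rewrite mxE.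
    have [[_ o _ _] _] := Hr i.
    apply: (sq (xr i).1 (supr i)) => [t /o[]//|].
    by have [m _] := mW i 0; apply: eq_measurable_fun m => t _; rewrite mxE.
  under [X in square_intg _ X]funext do rewrite mxE.
  have [[_ o _ _] _] := Hm i.
  apply: (sq (xm i).1 (supm i)) => [t /o[]//|].
  by have [_ m] := mW i 0; apply: eq_measurable_fun m => t _; rewrite mxE.
- move=> i; split.
    under [X in square_intg _ X]funext do rewrite mxE.
    have [[_ o M m] _] := Hr i.
    apply: (sq (xr i).2) => [|t /o[]//|]; [exact: bsq M m|exact: m].
  under [X in square_intg _ X]funext do rewrite mxE.
  have [[_ o M m] _] := Hm i.
  apply: (sq (xm i).2) => [|t /o[]//|]; [exact: bsq M m|exact: m].
have mab : measurable (`[a, b]%classic : set R) by [].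
have ir i := (square_intgB mab (w2 i).1 (supr i)).2.
have im i := (square_intgB mab (w2 i).2 (supm i)).2.
rewrite (@Rint_ext _ _ _ (fun t => \sum_i ((Re (w t i 0) - (xr i).1 t) ^+ 2 +
    (Im (w t i 0) - (xm i).1 t) ^+ 2))); last first.
  by move=> t _; apply: eq_bigr => i _; rewrite !mxE /sqnorm !raddfB.
rewrite Rint_sum//; last by move=> i; exact: intgD.
apply: (@le_lt_trans _ _ (\sum_(i < n) (2 * del))).
  apply: ler_sum => i _; rewrite RintegralD//; [|exact: ir|exact: im].
  rewrite mulr_natl mulr2n lerD// ltW//.
    exact: (Hr i).2.
  exact: (Hm i).2.
have -> : e = del * (2 * n%:R + 1) by rewrite divfK// gt_eqF.
rewrite sumr_const card_ord -mulr_natl -subr_gt0.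
by rewrite [ltRHS](_ : _ = del)//; ring.
Qed.

Variables (d : nat) (H : R -> 'M[C]_d) (hH : hamiltonian_density H).
Variables (P1 P0 : 'M[C]_d).
Local Notation ip := (L2H_ip hH).
Local Notation A := (ph_graph hH P1 P0).

Lemma unweightK (x : R -> 'cV[C]_d) : {ae mu, forall t, half_line t ->
  unweight H (fun s => H s *m x s) t = x t}.
Proof.
apply: (aeS (ae_det_hamiltonian hH)) => t Ht t0.
by rewrite /unweight mulmxA (mulmx1C (cramer_invE (Ht t0))) mul1mx.
Qed.

(** Choose [n] so that the weighted tail of [y] beyond [n] is below [e^2 / 2], and approximate [H y]
    on [[0, n]] by a [W] vanishing at both ends. Then [x = H^-1 W] is in the domain, and on [[0, n]]
    the squared weighted error is at most [1 / m] times the unweighted one. *)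
Lemma ph_graph_dense : densely_defined ip A.
Proof.
move=> y e e0.
pose w t := H t *m L2H_repr y t.
have w2 : vsq half_line w := in_L2H_mul_vsq hH (L2H_repr_in y).
pose h t := Re (hform (H t) (L2H_repr y t) (L2H_repr y t)).
have hi : intg half_line h := (L2H_ip_cintg y y).1.
have e2 : 0 < e ^+ 2 / 2 by rewrite divr_gt0// exprn_gt0.
have /cvgrPdist_lt/(_ _ e2)[n0 _ Hn0] := prim_cvg hi.
(* The successor makes the segment [[0, n]] nondegenerate. *)
pose n := n0.+1.
have nlt : `|\int[mu]_(t in half_line) h t - prim h n%:R| < e ^+ 2 / 2.
  by apply: Hn0; rewrite /= leqnSn.
have n0' : 0 < n%:R :> R by rewrite ltr0n.
have [m m0 Hm] := unweight_le hH n%:R.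
have me : 0 < m * (e ^+ 2 / 2) by rewrite mulr_gt0.
have w2n : vsq `[0, n%:R] w by apply: vsqS w2 => //; exact: sub_half_line.
have [W [G [WG out W2 G2 dist]]] := vsq_approximable (lexx 0) n0' w2n me.
have outW t : n%:R < t -> W t = 0 by move=> nt; have [] := out t (or_intror (ltW nt)).
have [x [z [_ xE _ gr]]] := supported_maximal hH P1 P0 WG W2 G2 outW.
exists x; first by exists z; apply: gr; have [] := out 0 (or_introl (lexx 0)).
rewrite /ip_norm -(ltr_pXn2r (n := 2)) ?nnegrE ?sqrtr_ge0 ?(ltW e0)//.
rewrite sqr_sqrtr ?Re_L2H_ip_ge0//.
have yx := L2H_repr_lin (-1) x y; rewrite scaleN1r addrC in yx.
move: (y - x) yx => z' yx.
have [ki _] := L2H_ip_cintg z' z'.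
set k := (fun t => Re _) in ki.
have [hni hnE] := half_line_patch (intg_loc hi n%:R).
pose q t := m^-1 * vsqnorm (w t - W t).
have dW : vsq `[0, n%:R] (fun t => w t - W t).
  have W2n : vsq `[0, n%:R] W by apply: vsqS W2 => //; exact: sub_half_line.
  move=> i; have -> : (fun t => (w t - W t) i 0) = (fun t => (-1 *: W t + w t) i 0).
    by apply/funext => t; rewrite !mxE mulN1r addrC.
  exact: vsq_lin.
have qi : intg `[0, n%:R] q by apply: intgZ => //; case/vsqP: dW.
have [qni qnE] := half_line_patch qi.
(* Up to [n] the error is that of the approximation, transported by [H^-1]; beyond [n] only [y]
   itself is left, as [x] vanishes there. *)
have kle : {ae mu, forall t, half_line t ->
    k t <= (h t - (h \_ `[0, n%:R]) t) + (q \_ `[0, n%:R]) t}.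
  apply: (aeS2 (aeS2 (unweightK (L2H_repr y)) xE (fun t h k => conj h k))
    (aeS2 yx (Hm (fun t => w t - W t)) (fun t h k => conj h k))).
  move=> t [h1 h2] [h3 h4] t0; have t0' := proj1 (half_lineP t) t0.
  have yxt : L2H_repr z' t = unweight H (fun t => w t - W t) t.
    rewrite h3// h2// /unweight mulmxBr scaleN1r addrC; congr (_ - _).
    by rewrite -[LHS](h1 t0).
  have [tn|nt] := leP t n%:R.
    have tin : `[0, n%:R]%classic t by rewrite /= in_itv /= t0' tn.
    rewrite !patchE !mem_set// subrr add0r /q /k yxt.
    by rewrite ler_pdivlMl//; have [] := h4 tin.
  rewrite !patchE !memNset /= ?in_itv /= ?[t <= _]leNgt ?nt ?andbF// subr0 addr0.
  rewrite /k h3// h2// /unweight outW// mulmx0 scaler0 add0r.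
  exact: lexx.
have hdi := intgB mD hi hni.
rewrite /L2H_ip /complex_integral [Re _]/= -/k.
have mk := intg_meas ki; have bi := intgD mD hdi qni.
apply: (@le_lt_trans _ _ (\int[mu]_(t in half_line)
   ((h t - (h \_ `[0, n%:R]) t) + (q \_ `[0, n%:R]) t))).
  exact: le_Rint_ae.
rewrite RintegralD// RintegralB// hnE qnE [e ^+ 2]splitr.
apply: ltrD; first exact: le_lt_trans (ler_norm _) nlt.
rewrite /prim /q RintegralZl//; last by case/vsqP: dW.
by rewrite ltr_pdivrMl.
Qed.

End Density.

(** * Invariance of the weighted space under [P1] *)

Section Oscillation.
Variable R : realType.
Local Notation C := R[i].
Local Notation mu := (@lebesgue_measure R).
Local Notation Re := complex.Re.
Local Notation Im := complex.Im.
Let mD : measurable (half_line : set R) := @half_line0 R.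

Lemma intg_half_line_geometric (f : R -> R) : loc_intg f ->
  (forall t, half_line t -> 0 <= f t) ->
  (forall n : nat, \int[mu]_(t in `[n%:R, n.+1%:R]) f t <= 2^-1 ^+ n) ->
  intg half_line f.
Proof.
move=> fl f0 fn.
(* The right-hand side is the sum of the first [n] terms of the geometric series of ratio 1/2. *)
have bnd n : prim f n%:R <= 2 - 2 * 2^-1 ^+ n.
  elim: n => [|n IHn].
    by rewrite /prim set_itv1 Rintegral_set1 expr0 mulr1 subrr.
  have n1 : n%:R <= n.+1%:R :> R by rewrite ler_nat.
  have := primB fl (ler0n R n) n1 => /eqP; rewrite subr_eq => /eqP ->.
  apply: (le_trans (lerD (fn n) IHn)); rewrite exprS mulrA divff ?mul1r//.
  by rewrite le_eqVlt; apply/orP; left; apply/eqP; ring.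
have mf : measurable_fun half_line f.
  by apply: measurable_half_line => b; exact: intg_meas (fl b).
apply/integrableP; split; first exact/measurable_EFinP.
have -> : (\int[mu]_(t in half_line) `|(EFin \o f) t| =
    \int[mu]_(t in half_line) (f t)%:E)%E.
  by apply: eq_integral => t /set_mem t0; rewrite /= ger0_norm// f0.
pose F (n : nat) : set R := `[0, n%:R]%classic.
have cover : half_line = \bigcup_n F n.
  apply/seteqP; split=> t; last by move=> [n _]; exact: sub_half_line.
  move=> /half_lineP t0; exists (Num.bound t) => //.
  by rewrite /F /= in_itv /= t0 ltW// archi_boundP.
have ndF : nondecreasing_seq F.
  move=> n m nm; apply/subsetPset => t; rewrite /F /= !in_itv /= => /andP[-> tn] /=.
  by rewrite (le_trans tn)// ler_nat.
have l : (fun n : nat => \int[mu]_(t in F n) (f t)%:E)%E @ \oo -->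
    (\int[mu]_(t in half_line) (f t)%:E)%E.
  rewrite cover; apply: ge0_nondecreasing_set_cvg_integral => //.
  - by move=> n; exact: measurable_itv.
  - by move=> n; apply/measurable_EFinP; exact: intg_meas (fl _).
  - by move=> n t /sub_half_line t0; rewrite lee_fin f0.
apply: (@le_lt_trans _ _ 2%:E); last exact: ltry.
apply: (cvge_to_le l); apply: nearW => n /=.
rewrite -EFin_Rint//; [|exact: measurable_itv|exact: fl].
rewrite lee_fin (le_trans (bnd n))//.
by rewrite gerBl mulr_ge0// exprn_ge0.
Qed.

Lemma intg_half_line_geometric_ae (f : R -> R) : loc_intg f ->
  {ae mu, forall t, half_line t -> 0 <= f t} ->
  (forall n : nat, \int[mu]_(t in `[n%:R, n.+1%:R]) f t <= 2^-1 ^+ n) ->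
  intg half_line f.
Proof.
move=> fl f0 fn.
have mf : measurable_fun half_line f.
  by apply: measurable_half_line => b; exact: intg_meas (fl b).
have sub (n : nat) := @sub_half_line_itv R _ n.+1%:R (ler0n R n).
apply: (@intg_le _ _ _ (fun t => `|f t|)) => //.
apply: intg_half_line_geometric => [b|t _|n]; [exact: intg_norm| |] => //.
apply: le_trans (fn n); rewrite le_eqVlt; apply/orP; left; apply/eqP.
have mfn : measurable_fun (`[n%:R, n.+1%:R] : set R) f by exact: measurable_funS mf.
apply: Rint_ae => //; first exact: measurableT_comp.
by apply: (aeS f0) => t h /(sub n) t0; rewrite ger0_norm// h.
Qed.

(** This is [i e^(i N t)], of modulus 1. *)
Definition wave (N t : R) : C := (- sin (N * t)) +i* cos (N * t).

(** This is [e^(i N t) / N], an antiderivative of [wave N] of modulus only [1 / N]. *)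
Definition wave_prim (N t : R) : C := (N^-1 * cos (N * t)) +i* (N^-1 * sin (N * t)).

Lemma sqnorm_wave N t : sqnorm (wave N t) = 1 :> R.
Proof. by rewrite /sqnorm /= sqrrN addrC cos2Dsin2. Qed.

Lemma sqnorm_wave_prim N t : sqnorm (wave_prim N t) = N ^- 2 :> R.
Proof. by rewrite /sqnorm /= !exprMn -mulrDr cos2Dsin2 mulr1 exprVn. Qed.

Lemma cac_wave N : 0 < N -> cac (wave_prim N) (wave N).
Proof.
move=> N0.
have dl t : is_derive (t : R) 1 (fun u : R => N * u) N.
  have -> : (fun u : R => N * u) = N \*: id by [].
  by apply: is_derive_eq; rewrite [LHS]mulr1.
have dc t : is_derive (t : R) 1 (fun u : R => N^-1 * cos (N * u)) (- sin (N * t)).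
  have -> : (fun u : R => N^-1 * cos (N * u)) = N^-1 \*: (fun u : R => cos (N * u)) by [].
  have h := @is_derive1_comp R cos (fun u : R => N * u) t _ _ (is_derive_cos (N * t)) (dl t).
  have hz : is_derive (t : R) 1 (N^-1 \*: (cos \o *%R N))
    (N^-1 *: (- sin (N * t) * N)) by exact: is_deriveZ.
  apply: (is_derive_eq hz).
  by rewrite [LHS]mulrC -mulrA mulfV ?gt_eqF// mulr1.
have ds t : is_derive (t : R) 1 (fun u : R => N^-1 * sin (N * u)) (cos (N * t)).
  have -> : (fun u : R => N^-1 * sin (N * u)) = N^-1 \*: (fun u : R => sin (N * u)) by [].
  have h := @is_derive1_comp R sin (fun u : R => N * u) t _ _ (is_derive_sin (N * t)) (dl t).
  have hz : is_derive (t : R) 1 (N^-1 \*: (sin \o *%R N))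
    (N^-1 *: (cos (N * t) * N)) by exact: is_deriveZ.
  apply: (is_derive_eq hz).
  by rewrite [LHS]mulrC -mulrA mulfV ?gt_eqF// mulr1.
have cl : continuous (fun u : R => N * u).
  by move=> t; apply: cvgMr; exact: cvg_id.
have cs : continuous (fun u : R => sin (N * u)).
  by move=> t; apply: (@continuous_comp _ _ _ (fun u : R => N * u) sin);
    [exact: cl|exact: continuous_sin].
have cc : continuous (fun u : R => cos (N * u)).
  by move=> t; apply: (@continuous_comp _ _ _ (fun u : R => N * u) cos);
    [exact: cl|exact: continuous_cos].
have cms : continuous (fun u : R => - sin (N * u)) by move=> t; apply: cvgN; exact: cs.
have cnc : continuous (fun u : R => N^-1 * cos (N * u)) by move=> t; apply: cvgMr; exact: cc.
have cns : continuous (fun u : R => N^-1 * sin (N * u)) by move=> t; apply: cvgMr; exact: cs.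
split=> [b|t t0]; first by split; exact: continuous_intg.
by apply: complex_ext; rewrite ?ReD ?ImD /=;
  [exact: (derive_prim cnc cms dc t0)|exact: (derive_prim cns cc ds t0)].
Qed.

Lemma vsq_scale n (D : set R) (a : R -> C) (x : R -> 'cV[C]_n) (K : R) : measurable D ->
  complex_measurable D a -> (forall t, D t -> sqnorm (a t) <= K) -> vsq D x ->
  vsq D (fun t => a t *: x t).
Proof.
move=> mE ma aK x2 i; under [X in csq _ X]funext do rewrite mxE.
exact: csq_mul_bounded ma aK.
Qed.

Variables (d : nat) (H : R -> 'M[C]_d) (hH : hamiltonian_density H).

(** The triple [q] consists of the unimodular factor, of [U] and of its derivative [V]. With [G] an
    absolutely continuous approximation of [g] that vanishes at the end points, [U] is [wave_prim N]
    times [G]; hence [V] is [wave N] times [G] plus an error of order [1 / N]. Large [N] makes this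
    error and the weighted norm of [H^-1 U] small at once. *)
Lemma oscillating_approximation (n : nat) (g : R -> 'cV[C]_d) (eta : R) :
  vsq `[n%:R, n.+1%:R] g -> 0 < eta ->
  exists q : (R -> C) * (R -> 'cV[C]_d) * (R -> 'cV[C]_d),
  [/\ complex_measurable half_line q.1.1 /\ (forall t, sqnorm (q.1.1 t) = 1),
    vac q.1.2 q.2,
    forall t, t <= n%:R \/ n.+1%:R <= t -> q.1.2 t = 0 /\ q.2 t = 0,
    vsq half_line q.1.2 /\ vsq half_line q.2 &
    \int[mu]_(t in `[n%:R, n.+1%:R])
       Re (hform (H t) (unweight H q.1.2 t) (unweight H q.1.2 t)) <= eta /\
    \int[mu]_(t in `[n%:R, n.+1%:R]) vsqnorm (q.2 t - q.1.1 t *: g t) <= eta].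
Proof.
move=> g2 eta0; set I : set R := `[n%:R, n.+1%:R]%classic.
have nn : n%:R < n.+1%:R :> R by rewrite ltr_nat.
have eta4 : 0 < eta / 4 by rewrite divr_gt0.
have [G [G' [GG out G2 G'2 dist]]] := vsq_approximable (ler0n R n) nn g2 eta4.
have [m m0 Hm] := unweight_le hH n.+1%:R.
have Isub : I `<=` half_line by exact: sub_half_line_itv.
have Isub2 : I `<=` `[0, n.+1%:R].
  by move=> t; rewrite /I /= !in_itv /= => /andP[t0 ->]; rewrite (le_trans _ t0).
have mI : measurable I by exact: measurable_itv.
have [mGI iG] := (vsqP _ mI).1 (vsqS mD mI Isub G2).
have [mG'I iG'] := (vsqP _ mI).1 (vsqS mD mI Isub G'2).
(* By [unweight_le] this bounds the squared weighted norm of [H^-1 G]; the factor [wave_prim N] then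
   contributes [N ^- 2]. *)
pose K0 := m^-1 * \int[mu]_(t in I) vsqnorm (G t).
pose K1 := \int[mu]_(t in I) vsqnorm (G' t).
have K00 : 0 <= K0.
  by rewrite mulr_ge0 ?invr_ge0 ?(ltW m0)//; apply: Rintegral_ge0 => // t _; exact: vsqnorm_ge0.
have K10 : 0 <= K1 by apply: Rintegral_ge0 => // t _; exact: vsqnorm_ge0.
(* What is required is [N^2 eta >= K0 + 4 K1]; as [N >= 1], it holds already with [N] in place of
   [N^2]. The weight 4 makes [N ^- 2 * K1 <= eta / 4], so that after the doubling in [vsqnormD] the
   two parts of the error add up to at most [eta]. *)
pose N := 1 + (K0 + 4 * K1) / eta.
have Q0 : 0 <= (K0 + 4 * K1) / eta by rewrite divr_ge0 ?(ltW eta0)// addr_ge0// mulr_ge0.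
have N0 : 0 < N by rewrite ltr_wpDr.
have N2 : N ^- 2 * (K0 + 4 * K1) <= eta.
  rewrite ler_pdivrMl ?exprn_gt0//.
  rewrite -[leLHS](divfK (lt0r_neq0 eta0)) ler_pM2r//.
  by rewrite /N; nra.
have Nn : 0 <= N ^- 2 by rewrite invr_ge0 exprn_ge0// ltW.
have NK0 : N ^- 2 * K0 <= eta.
  by apply: le_trans N2; rewrite ler_wpM2l// lerDl mulr_ge0.
have NK1 : N ^- 2 * K1 <= eta / 4.
  rewrite ler_pdivlMr// -mulrA [K1 * 4]mulrC; apply: le_trans N2.
  by rewrite ler_wpM2l// lerDr.
have [we wE] := cac_wave N0.
have mw : complex_measurable half_line (wave N).
  by apply: cmeas_half_line => b; exact: cintg_meas.
have mw' : complex_measurable half_line (wave_prim N).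
  have := (@vac_meas R 1 (fun t => wave_prim N t *: 1%:M) (fun t => wave N t *: 1%:M)
    (vac_const _ (cac_wave N0))).1 0 0.
  by under [X in complex_measurable _ X -> _]funext do rewrite !mxE mulr1.
pose U t := wave_prim N t *: G t.
pose V t := wave N t *: G t + wave_prim N t *: G' t.
have UV : vac U V.
  move=> i; under [X in cac X]funext do rewrite mxE.
  under [X in cac _ X]funext do rewrite !mxE.
  exact: cacM (cac_wave N0) (GG i).
have outUV t : t <= n%:R \/ n.+1%:R <= t -> U t = 0 /\ V t = 0.
  by move=> /out[G0 G'0]; rewrite /U /V G0 G'0 !scaler0 addr0.
have U2 : vsq half_line U.
  by apply: (vsq_scale (K := N ^- 2)) => // t _; rewrite sqnorm_wave_prim.
have V2 : vsq half_line V.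
  have h1 : vsq half_line (fun t => wave N t *: G t).
    by apply: (vsq_scale (K := 1)) => // t _; rewrite sqnorm_wave.
  have h2 : vsq half_line (fun t => wave_prim N t *: G' t).
    by apply: (vsq_scale (K := N ^- 2)) => // t _; rewrite sqnorm_wave_prim.
  by have := vsq_lin 1 mD h1 h2; under [X in vsq _ X -> _]funext do rewrite scale1r.
have mwI := cmeas_sub mD Isub mw.
exists (wave N, U, V); split=> //=; first by split=> // t; exact: sqnorm_wave.
have outU t : n.+1%:R < t -> U t = 0 by move=> /ltW tn; have [] := outUV t (or_intror tn).
split.
  have iU := (in_L2H_cintg hH (unweight_supported hH U2 outU) (unweight_supported hH U2 outU)).1.
  apply: le_trans NK0; rewrite /K0 mulrA -RintegralZl//.
  apply: le_Rint_ae => //; [exact: intgS iU|exact: intgZ|].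
  apply: (aeS (Hm U)) => t h tI; have [_] := h (Isub2 t tI).
  rewrite vsqnormZ sqnorm_wave_prim -ler_pdivlMl// => /le_trans; apply.
  by rewrite mulrCA mulrA.
have g2' : vsq I (fun t => wave N t *: g t).
  by apply: (vsq_scale (K := 1)) => // t _; rewrite sqnorm_wave.
have [_ iL] := (vsqP _ mI).1 (vsq_lin (-1) mI g2' (vsqS mD mI Isub V2)).
have [_ iGg] := (vsqP _ mI).1 (vsq_lin (-1) mI (vsqS mD mI Isub G2) g2).
have E1 t : vsqnorm (-1 *: (wave N t *: g t) + V t) = vsqnorm (V t - wave N t *: g t).
  by rewrite scaleN1r addrC.
have E2 t : vsqnorm (-1 *: G t + g t) = vsqnorm (g t - G t).
  by rewrite scaleN1r addrC.
have {}iL : intg I (fun t => vsqnorm (V t - wave N t *: g t)).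
  by apply: intg_ext iL => // t _; rewrite E1.
have {}iGg : intg I (fun t => vsqnorm (g t - G t)).
  by apply: intg_ext iGg => // t _; rewrite E2.
have i1 := intgZ 2 mI iGg; have i2 := intgZ (2 * N ^- 2) mI iG'.
apply: (@le_trans _ _ (\int[mu]_(t in I) (2 * vsqnorm (g t - G t) + 2 * N ^- 2 * vsqnorm (G' t)))).
  apply: le_Rintegral => //; first exact: intgD.
  move=> t tI; have -> : V t - wave N t *: g t = - wave N t *: (g t - G t) + wave_prim N t *: G' t.
    by rewrite /V scaleNr -scalerN opprB scalerBr addrAC.
  apply: (le_trans (vsqnormD _ _)); rewrite !vsqnormZ sqnorm_wave_prim mulrDr mulrA.
  by rewrite sqnormN sqnorm_wave mulr1 mulrA.
rewrite RintegralD// !RintegralZl//.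
have -> : eta = 2 * (eta / 4) + 2 * (eta / 4) by field.
by rewrite -[2 * N ^- 2 * _]mulrA lerD// ler_pM2l// ltW.
Qed.

End Oscillation.

(** * Gluing the pieces; invariance of the space under the matrix and its inverse *)

Section Gluing.
Variable R : realType.
Local Notation C := R[i].
Local Notation mu := (@lebesgue_measure R).
Local Notation Re := complex.Re.
Local Notation Im := complex.Im.
Let mD : measurable (half_line : set R) := @half_line0 R.

Definition glue T (F : nat -> R -> T) (t : R) : T := F (Num.truncn t) t.

Lemma glueE T (F : nat -> R -> T) (n : nat) t : n%:R <= t < n.+1%:R -> glue F t = F n t.
Proof. by move=> tn; rewrite /glue (truncn_def tn). Qed.

Definition segment_supported d (F : nat -> R -> 'cV[C]_d) :=
  forall n t, t <= n%:R \/ n.+1%:R <= t -> F n t = 0.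

(** Pieces that vanish off their own segments may be added instead of concatenated. On every bounded
    range the glued function is thus a finite sum, and integrability and absolute continuity pass to
    it from the pieces. *)
Lemma glue_sum d (F : nat -> R -> 'cV[C]_d) (K : nat) t : segment_supported F ->
  0 <= t -> t < K%:R -> glue F t = \sum_(n < K) F n t.
Proof.
move=> F0 t0 tK; have /andP[kt tk] := truncn_itv t0.
have kK : (Num.truncn t < K)%N by rewrite truncn_lt_nat.
rewrite (bigD1 (Ordinal kK))//= big1 ?addr0// => j jk.
have {}jk : (j : nat) != Num.truncn t by apply: contra jk => /eqP jk; apply/eqP/val_inj.
apply: F0; case: (ltngtP j (Num.truncn t)) jk => // jk _; [right|left].
  by apply: le_trans kt; rewrite ler_nat.
by apply: (le_trans (ltW tk)); rewrite ler_nat.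
Qed.

Lemma lt_truncn_norm (b : R) : b < ((Num.truncn `|b|).+1)%:R.
Proof. by apply: (le_lt_trans (ler_norm b)); have /andP[] := truncn_itv (normr_ge0 b). Qed.

Lemma glue_vsq d (F : nat -> R -> 'cV[C]_d) (b : R) : segment_supported F ->
  (forall n, vsq half_line (F n)) -> vsq `[0, b] (glue F).
Proof.
move=> F0 F2 i; pose K := (Num.truncn `|b|).+1.
have bK : b < K%:R := lt_truncn_norm b.
apply: (@csq_ext _ _ (fun t => \sum_(n < K) F n t i 0)) => //.
  move=> t; rewrite /= in_itv /= => /andP[t0 tb].
  by rewrite (glue_sum F0 t0 (le_lt_trans tb bK)) summxE.
by apply: csq_sum => // n; apply: csqS (F2 n i) => //; exact: sub_half_line.
Qed.

Lemma glue_vac d (U V : nat -> R -> 'cV[C]_d) : segment_supported U ->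
  segment_supported V -> (forall n, vac (U n) (V n)) -> vac (glue U) (glue V).
Proof.
move=> U0 V0 UV i.
have S (K : nat) : cac (fun t => \sum_(n < K) U n t i 0) (fun t => \sum_(n < K) V n t i 0).
  by apply: cac_sum => n; exact: UV.
have E (F : nat -> R -> 'cV[C]_d) (K : nat) t : segment_supported F -> 0 <= t -> t < K%:R ->
    glue F t i 0 = \sum_(n < K) F n t i 0.
  by move=> F0 t0 tK; rewrite (glue_sum F0 t0 tK) summxE.
have bK := lt_truncn_norm.
split=> [b|t t0].
  apply: cintg_ext ((S (Num.truncn `|b|).+1).1 b) => //.
  move=> t; rewrite /= in_itv /= => /andP[t0 tb].
  by rewrite (E _ _ _ V0 t0 (le_lt_trans tb (bK b))).
have [_ /(_ t t0) h] := S (Num.truncn `|t|).+1.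
rewrite (E _ _ _ U0 t0 (bK t)) h (E _ _ _ U0 (lexx 0) (le_lt_trans t0 (bK t))).
congr (_ + _); apply: cint_ext => s; rewrite /= in_itv /= => /andP[s0 st].
by rewrite (E _ _ _ V0 s0 (le_lt_trans st (bK t))).
Qed.

Lemma cmeas_glue (e : nat -> R -> C) : (forall n, complex_measurable half_line (e n)) ->
  complex_measurable half_line (glue e).
Proof.
move=> me.
have cover : half_line = \bigcup_n (`[n%:R, n.+1%:R[%classic : set R).
  apply/seteqP; split=> t.
    move=> /half_lineP t0; exists (Num.truncn t) => //=.
    by rewrite in_itv /= truncn_itv.
  by move=> [n _]; rewrite /= in_itv /= => /andP[nt _]; apply/half_lineP; exact: le_trans nt.
have sub n : `[n%:R, n.+1%:R[ `<=` (half_line : set R).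
  by move=> t; rewrite /= in_itv /= => /andP[nt _]; apply/half_lineP; exact: le_trans nt.
rewrite cover; split; apply/measurable_fun_bigcup => // n.
  have [m _] := me n; apply: (eq_measurable_fun (fun t => Re (e n t))).
    by move=> t /set_mem; rewrite /= in_itv /= => /glueE ->.
  exact: measurable_funS m.
have [_ m] := me n; apply: (eq_measurable_fun (fun t => Im (e n t))).
  by move=> t /set_mem; rewrite /= in_itv /= => /glueE ->.
exact: measurable_funS m.
Qed.

(** Write the characteristic polynomial as [q X + c]; then [c] is the determinant up to sign, hence
    nonzero, and [q(P) P = - c] exhibits the inverse as [- c^-1 q(P)]. *)
Lemma invmx_horner (F : fieldType) n (P : 'M[F]_n.+1) : P \in unitmx ->
  exists p, invmx P = horner_mx P p.
Proof.
move=> uP; have CH := Cayley_Hamilton P.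
have c0 : (char_poly P)`_0 != 0.
  rewrite char_poly_det mulf_neq0 ?expf_neq0 ?oppr_eq0 ?oner_eq0//.
  by rewrite -unitfE -unitmxE.
move: (char_poly P) CH c0 => q; elim/poly_ind: q => [|q c _]; first by rewrite coef0 eqxx.
rewrite coefD coefMX coefC eqxx add0r rmorphD rmorphM /= horner_mx_X horner_mx_C => E c0.
exists (- c^-1 *: q); set X := horner_mx _ _.
have XP : X *m P = 1%:M.
  rewrite /X linearZ /= -scalemxAl.
  have -> : horner_mx P q *m P = - c%:M by apply/eqP; rewrite -addr_eq0; apply/eqP.
  by rewrite scaleNr scalerN opprK scale_scalar_mx mulVf.
by rewrite -[RHS](mulmxK uP) XP mul1mx.
Qed.

(** Horner's scheme: by induction on the polynomial, [Q] is preserved by every polynomial in [P],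
    and the inverse is one of them. *)
Lemma invmx_invariant n (P : 'M[C]_n) (Q : (R -> 'cV[C]_n) -> Prop) : P \in unitmx ->
  (forall (a : C) x y, Q x -> Q y -> Q (a *: x + y)) ->
  (forall x, Q x -> Q (fun t => P *m x t)) ->
  forall x, Q x -> Q (fun t => invmx P *m x t).
Proof.
(* Evaluation of polynomials at a matrix takes place in square matrices of positive size; in size 0
   all vectors coincide. *)
case: n P Q => [|n] P Q uP Qlin QP x Qx.
  by rewrite (_ : (fun t => _) = x)//; apply/funext => t; rewrite [LHS]flatmx0 [RHS]flatmx0.
have [p ->] := invmx_horner uP.
elim/poly_ind: p x Qx => [|p c IHp] x Qx.
  (* The zero function satisfies [Q], being [- x + x]. *)
  have := Qlin (-1) x x Qx Qx; rewrite scaleN1r addNr.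
  by congr (Q _); apply/funext => t; rewrite rmorph0 mul0mx.
have := Qlin c x _ Qx (IHp _ (QP x Qx)); congr (Q _); apply/funext => t.
rewrite rmorphD rmorphM /= horner_mx_X horner_mx_C mulmxDl mul_scalar_mx -mulmxA.
by rewrite addrC.
Qed.

Variables (d : nat) (H : R -> 'M[C]_d) (hH : hamiltonian_density H).

Lemma in_L2H_aeeq x y : in_L2H H x -> mx_measurable half_line y ->
  {ae mu, forall t, half_line t -> x t = y t} -> in_L2H H y.
Proof.
move=> hx my xy; have [[mx lx] ix] := hx.
have sub (b : R) := @sub_half_line R b.
split; first split=> // b.
  apply: (intg_aeeq _ _ _ (lx b)) => //.
    have [m _] := cmeas_hform (@mxmeas_cst R half_line _ _ 1%:M) my.
    exact: measurable_funS mD (sub b) m.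
  by apply: (aeS xy) => t e tb; rewrite e//; exact: sub tb.
apply: (intg_aeeq mD _ _ ix); first by have [] := cmeas_hform (hd_measurable hH) my.
by apply: (aeS xy) => t e tb; rewrite e.
Qed.

Lemma in_L2H_unimodular (a : R -> C) x : complex_measurable half_line a ->
  (forall t, sqnorm (a t) = 1) -> in_L2H H x -> in_L2H H (fun t => a t *: x t).
Proof.
move=> ma a1 [[mx lx] ix].
have E (M : 'M[C]_d) t : hform M (a t *: x t) (a t *: x t) = hform M (x t) (x t).
  rewrite (formZl (hform_sesquilinear M)) (formZr (hform_sesquilinear M)) mulrA.
  by rewrite sqnormE a1 mul1r.
split; first split=> [i j|b].
- by under [X in complex_measurable _ X]funext do rewrite mxE; exact: cmeasM.
- by apply: intg_ext (lx b) => // t _; rewrite E.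
- by apply: intg_ext ix => // t _; rewrite E.
Qed.

Lemma glue_intg_hform (U : nat -> R -> 'cV[C]_d) (b : R) : segment_supported U ->
  (forall n, vsq half_line (U n)) ->
  intg `[0, b] (fun t => Re (hform (H t) (unweight H (glue U) t) (unweight H (glue U) t))).
Proof.
move=> U0 U2; pose K := (Num.truncn `|b|).+1.
have bK : b < K%:R := lt_truncn_norm b.
pose S t := \sum_(n < K) U n t.
have S2 : vsq half_line S.
  move=> i; apply: (@csq_ext _ _ (fun t => \sum_(n < K) U n t i 0)) => //.
    by move=> t _; rewrite summxE.
  by apply: csq_sum => // n; exact: U2.
have outS t : K%:R < t -> S t = 0.
  move=> Kt; apply: big1 => n _; apply: U0; right.
  by apply: le_trans (ltW Kt); rewrite ler_nat.
have hS := unweight_supported hH S2 outS.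
have iS := intg_loc (in_L2H_cintg hH hS hS).1 b; apply: intg_ext iS => //.
move=> t; rewrite /= in_itv /= => /andP[t0 tb].
by rewrite /unweight (glue_sum U0 t0 (le_lt_trans tb bK)).
Qed.

Variables (P1 P0 : 'M[C]_d).
Hypothesis hA : ph_maps_into hH P1 P0.

(* Multiplying [g] by a suitable unimodular function [e], of ever higher
   frequency near infinity, turns it up to a square integrable error [s] into
   the derivative of a small function [u], with [u = H x] for some [x] in the
   domain of the operator. *)
Lemma in_L2H_mul_P1 g : in_L2H H g -> in_L2H H (fun t => P1 *m g t).
Proof.
move=> hg; have mg := in_L2H_meas hg.
have subn (n : nat) := @sub_half_line_itv R _ n.+1%:R (ler0n R n).
have gn (n : nat) : vsq `[n%:R, n.+1%:R] g.
  apply: vsqS (in_L2H_vsq_loc hg n.+1%:R) => //.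
  by move=> t; rewrite /= !in_itv /= => /andP[nt ->]; rewrite (le_trans _ nt).
have h0 (n : nat) : 0 < 2^-1 ^+ n :> R by rewrite exprn_gt0// invr_gt0.
(* Tolerances [2^-n] on [n, n + 1] have a finite sum; they bound the weighted norm of [H^-1 U] and
   the L2 error alike. *)
have /choice[q Hq] n := oscillating_approximation hH (gn n) (h0 n).
pose U n := (q n).1.2; pose V n := (q n).2; pose e n := (q n).1.1.
have U0 : segment_supported U by move=> n t nt; have [_ _ /(_ t nt)[]] := Hq n.
have V0 : segment_supported V by move=> n t nt; have [_ _ /(_ t nt)[]] := Hq n.
have U2 n : vsq half_line (U n) by have [_ _ _ []] := Hq n.
have V2 n : vsq half_line (V n) by have [_ _ _ []] := Hq n.
have UV : vac (glue U) (glue V) by apply: glue_vac => // n; have [] := Hq n.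
have me : complex_measurable half_line (glue e).
  by apply: cmeas_glue => n; have [[]] := Hq n.
have e1 t : sqnorm (glue e t) = 1 by have [[_ h] _ _ _ _] := Hq (Num.truncn t); exact: h.
have [mU mV] := vac_meas UV.
have heg := in_L2H_unimodular me e1 hg.
(* The error [V - e g] is square integrable on the whole half-line, so [s] and [P1 s] are both in
   X. *)
pose s t := -1 *: (glue e t *: g t) + glue V t.
have s2 : vsq half_line s.
  have sl b : vsq `[0, b] s.
    by apply: vsq_lin => //; [exact: in_L2H_vsq_loc heg b|exact: glue_vsq].
  have ms : mx_measurable half_line s by apply: mxmeas_lin => //; exact: in_L2H_meas heg.
  apply/vsqP => //; split=> //; apply: intg_half_line_geometric => [b|t _|n].
  - by have /vsqP[] := sl b.
  - exact: vsqnorm_ge0.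
  have [[mn _] _ _ [_ V2n] [_]] := Hq n; apply: le_trans.
  have egn : vsq `[n%:R, n.+1%:R] (fun t => e n t *: g t).
    apply: (vsq_scale (K := 1)) => //; first exact: cmeas_sub mn.
    by move=> t _; have [[_ ->]] := Hq n.
  have sn := vsq_lin (-1) (measurable_itv _) egn (vsqS mD (measurable_itv _) (subn n) V2n).
  rewrite le_eqVlt; apply/orP; left; apply/eqP; apply: Rint_ae => //.
  - have /vsqP[//|_ /intg_meas] := sl n.+1%:R; apply: measurable_funS => //.
    by move=> t; rewrite /= !in_itv /= => /andP[nt ->]; rewrite (le_trans _ nt).
  - have /vsqP[//|_ /intg_meas] := sn; apply: eq_measurable_fun => t _.
    by rewrite scaleN1r addrC.
  (* At the right end point the glued function already follows the next piece; a single point is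
     null. *)
  - apply: (aeS (ae_neq n.+1%:R)) => t tn; rewrite /= in_itv /= => /andP[nt tn1].
    have tn' : n%:R <= t < n.+1%:R by rewrite nt lt_neqAle tn.
    by rewrite /s !(glueE _ tn') scaleN1r addrC.
have hs := vsq_in_L2H hH s2.
have hx : in_L2H H (unweight H (glue U)).
  apply: unweight_in_L2H => //; first by move=> b; exact: glue_vsq.
  apply: intg_half_line_geometric_ae => [b||n].
  - exact: glue_intg_hform.
  - apply: (aeS (ae_hermitian_psd hH)) => t h t0; have [_ /(_ (unweight H (glue U) t))] := h t0.
    by rewrite lecE => /andP[].
  have [_ _ _ _ [+ _]] := Hq n; apply: le_trans.
  rewrite le_eqVlt; apply/orP; left; apply/eqP; apply: Rint_ae => //.
  - have := intg_meas (glue_intg_hform n.+1%:R U0 U2); apply: measurable_funS => //.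
    by move=> t; rewrite /= !in_itv /= => /andP[nt ->]; rewrite (le_trans _ nt).
  - have outU t : n.+1%:R < t -> U n t = 0 by move=> nt; apply: U0; right; exact: ltW.
    have hn := unweight_supported hH (U2 n) outU.
    have := intg_meas (in_L2H_cintg hH hn hn).1; exact: measurable_funS.
  - apply: (aeS (ae_neq n.+1%:R)) => t tn; rewrite /= in_itv /= => /andP[nt tn1].
    by rewrite /unweight (@glueE _ U n)// nt lt_neqAle tn.
have hV : in_L2H H (glue V).
  have := in_L2H_lin hH 1 heg hs; congr (in_L2H H _); apply/funext => t.
  by rewrite /s scale1r !fctE scaleN1r addrA subrr add0r.
have [x xE] := L2H_class hH hx; have [v vE] := L2H_class hH hV.
have Ux : {ae mu, forall t, half_line t -> glue U t = H t *m L2H_repr x t}.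
  by apply: (aeS2 xE (mul_unweight hH (glue U))) => t h1 h2 t0; rewrite h1// h2.
have dom : ph_domain hH x.
  split.
    exists v; apply: (vac_distr_derivative UV _ _ Ux).
    - exact: vsq_meas (in_L2H_mul_vsq hH (L2H_repr_in x)).
    - exact: in_L2H_meas (L2H_repr_in v).
    - by apply: (aeS vE) => t h t0; rewrite h.
  have := vac_has_value0 UV Ux.
  by rewrite (glueE (n := 0) U) ?lexx ?ltr01// U0//; left.
(* Here the operator is known to map into X: its value [y = P1 V + P0 H x] is in X, and so is
   [P0 H x], hence also [P1 V]. *)
have [y /graph_maximal[W [G [WG _ Wx yE]]]] := hA dom.
(* Both [G] and the glued [V] are derivatives of representatives of [H x]. *)
have GV : {ae mu, forall t, half_line t -> -1 *: glue V t + G t = 0}.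
  apply: (vac_ae0 (vac_lin (-1) UV WG)).
  by apply: (aeS2 Ux Wx) => t h1 h2 t0; rewrite h1// h2// scaleN1r addNr.
have hPV : in_L2H H (fun t => P1 *m glue V t).
  have hy : in_L2H H (fun t => (-1) *: (P0 *m (H t *m L2H_repr x t)) + L2H_repr y t).
    apply: (in_L2H_lin hH (-1) _ (L2H_repr_in y)); apply: vsq_in_L2H => //.
    by apply: vsq_mulmx => //; exact: in_L2H_mul_vsq (L2H_repr_in x).
  apply: (in_L2H_aeeq hy); first by apply: mxmeasM => //; exact: mxmeas_cst.
  apply: (aeS2 (aeS2 yE Wx (fun t h k => conj h k)) GV) => t [h1 h2] h3 t0.
  have /eqP := h3 t0; rewrite scaleN1r addrC subr_eq0 => /eqP <-.
  by rewrite h1// h2// scaleN1r addrC addrK.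
have hPs : in_L2H H (fun t => P1 *m s t) by apply: vsq_in_L2H => //; exact: vsq_mulmx.
have mce : complex_measurable half_line (fun t => (glue e t)^*) by exact: cmeas_conj.
have ce1 t : sqnorm ((glue e t)^*) = 1 by rewrite /sqnorm Re_conj Im_conj sqrrN -[RHS](e1 t).
(* [P1 V - P1 s] is [e P1 g], and the conjugate of [e] removes the unimodular factor. *)
have := in_L2H_unimodular mce ce1 (in_L2H_lin hH (-1) hPs hPV).
congr (in_L2H H _); apply/funext => t; rewrite !fctE.
rewrite /s mulmxDr -scalemxAr scaleN1r opprD addrNK scaleN1r opprK.
by rewrite -scalemxAr scalerA sqnormE e1 scale1r.
Qed.

End Gluing.

(** * The boundary spaces and the theorem *)

Section FiniteDimensional.
Variable R : realType.
Local Notation C := R[i].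
Local Notation Re := complex.Re.
Local Notation Im := complex.Im.

Lemma gt0_complexE (z : C) : 0 < z -> 0 < Re z /\ z = (Re z)%:C.
Proof.
rewrite ltcE => /andP[/eqP /= i0 r0]; split=> //.
by apply: complex_ext; rewrite //= i0.
Qed.

Lemma real_cauchy_cvg (a : nat -> R) : (forall e : R, 0 < e -> exists N : nat,
  forall m n : nat, (N <= m)%N -> (N <= n)%N -> `|a m - a n| < e) ->
  exists l : R, a @ \oo --> l.
Proof.
move=> ca; exists (lim (a @ \oo)); apply/cauchy_cvgP/cauchy_ballP => e e0.
have [N HN] := ca e e0.
exists ([set a n | n in [set n | (N <= n)%N]], [set a n | n in [set n | (N <= n)%N]]).
  by split; exists N => // n Nn; exists n.
by move=> [x y] /= [[m Nm <-] [n Nn <-]]; exact: HN.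
Qed.

Lemma cvg_sum_seq (I : Type) (s : seq I) (f : I -> nat -> R) (l : I -> R) :
  (forall i, f i @ \oo --> l i) ->
  (fun n => \sum_(i <- s) f i n) @ \oo --> \sum_(i <- s) l i.
Proof.
move=> fl; elim: s => [|i s IHs].
  rewrite big_nil (_ : (fun n => _) = cst 0); first exact: cvg_cst.
  by apply/funext => n; rewrite big_nil.
rewrite big_cons (_ : (fun n => _) = fun n => f i n + \sum_(j <- s) f j n).
  by apply: cvgD.
by apply/funext => n; rewrite big_cons.
Qed.

Variables (n : nat) (lam : 'rV[C]_n).
Hypothesis lam0 : forall k, 0 < lam 0 k.

Lemma hform_diagE (u : 'cV[C]_n) :
  hform (diag_mx lam) u u = (\sum_i Re (lam 0 i) * sqnorm (u i 0))%:C.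
Proof.
rewrite hformE rmorph_sum /=; apply: eq_bigr => j _.
rewrite (bigD1 j)//= big1 ?addr0 => [|i ij].
  rewrite mxE eqxx mulr1n rmorphM /= -sqnormE -(gt0_complexE (lam0 j)).2.
  by rewrite mulrAC mulrC.
by rewrite mxE (negbTE ij) mulr0n mulr0 mul0r.
Qed.

Lemma diag_scalar_product : scalar_product (hform (diag_mx lam)).
Proof.
split; first exact: hform_sesquilinear.
- apply: hform_trmxC_id; apply/matrixP => i j; rewrite !mxE eq_sym.
  have [->|_] := eqVneq i j; last by rewrite !mulr0n conjC0.
  rewrite !mulr1n; have [_ E] := gt0_complexE (lam0 j).
  by apply: complex_ext; rewrite ?Re_conj ?Im_conj// E /= oppr0.
- move=> u u0; rewrite hform_diagE -[0 : C]/(0%:C) ltcR lt_neqAle.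
  have nn i : 0 <= Re (lam 0 i) * sqnorm (u i 0).
    by rewrite mulr_ge0 ?sqnorm_ge0// ltW// (gt0_complexE (lam0 i)).1.
  rewrite sumr_ge0 ?andbT//; apply: contra u0; rewrite eq_sym psumr_eq0// => /allP z.
  apply/eqP/matrixP => i j; rewrite (ord1 j) mxE; apply: sqnorm_eq0.
  have := z i (mem_index_enum _); rewrite /= mulf_eq0 => /orP[|/eqP//].
  by rewrite gt_eqF// (gt0_complexE (lam0 i)).1.
Qed.

(** Each weight is positive, so the norm controls every coordinate. A Cauchy sequence converges
    coordinatewise, and the finite weighted sum of the squared errors tends to 0. *)
Lemma diag_hilbert_space : hilbert_space (hform (diag_mx lam)).
Proof.
split; first exact: diag_scalar_product.
move=> u cu.
have r0 i : 0 < Re (lam 0 i) by have [] := gt0_complexE (lam0 i).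
have nn (z : 'cV[C]_n) i : 0 <= Re (lam 0 i) * sqnorm (z i 0).
  by rewrite mulr_ge0 ?sqnorm_ge0// ltW.
have nE z : ip_norm (hform (diag_mx lam)) z = Num.sqrt (\sum_i Re (lam 0 i) * sqnorm (z i 0)).
  by rewrite /ip_norm hform_diagE.
have comp z i (e : R) : 0 < e -> ip_norm (hform (diag_mx lam)) z < Num.sqrt (Re (lam 0 i)) * e ->
    sqnorm (z i 0) < e ^+ 2.
  move=> e0; rewrite nE => h; rewrite -(ltr_pM2l (r0 i)).
  apply: (@le_lt_trans _ _ (\sum_i Re (lam 0 i) * sqnorm (z i 0))).
    by rewrite (bigD1 i)//= lerDl sumr_ge0.
  have s0 : 0 <= \sum_i Re (lam 0 i) * sqnorm (z i 0) by rewrite sumr_ge0.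
  rewrite -(sqr_sqrtr s0) -[X in _ < X * _](sqr_sqrtr (ltW (r0 i))) -exprMn.
  by rewrite ltr_pXn2r ?nnegrE ?sqrtr_ge0// mulr_ge0 ?sqrtr_ge0// ltW.
have cauchy_comp i (e : R) : 0 < e -> exists N : nat,
    forall m p : nat, (N <= m)%N -> (N <= p)%N -> sqnorm ((u m - u p) i 0) < e ^+ 2.
  move=> e0; have [|N HN] := cu (Num.sqrt (Re (lam 0 i)) * e).
    by rewrite mulr_gt0// sqrtr_gt0.
  by exists N => m p Nm Np; apply: comp => //; exact: HN.
have /choice[lr Hr] i : exists l : R, (fun m => Re (u m i 0)) @ \oo --> l.
  apply: real_cauchy_cvg => e e0; have [N HN] := cauchy_comp i _ e0.
  exists N => m p Nm Np; have := HN m p Nm Np; rewrite /sqnorm !mxE => h.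
  rewrite -(ltr_pXn2r (n := 2)) ?nnegrE ?(ltW e0)// real_normK ?num_real//.
  by apply: le_lt_trans h; rewrite -raddfB /= lerDl sqr_ge0.
have /choice[li Hi] i : exists l : R, (fun m => Im (u m i 0)) @ \oo --> l.
  apply: real_cauchy_cvg => e e0; have [N HN] := cauchy_comp i _ e0.
  exists N => m p Nm Np; have := HN m p Nm Np; rewrite /sqnorm !mxE => h.
  rewrite -(ltr_pXn2r (n := 2)) ?nnegrE ?(ltW e0)// real_normK ?num_real//.
  by apply: le_lt_trans h; rewrite -raddfB /= lerDr sqr_ge0.
exists (\col_i (lr i +i* li i)); rewrite /ip_cvg.
have d0 (a : nat -> R) (l : R) : a @ \oo --> l -> (fun m => (a m - l) ^+ 2) @ \oo --> (0 : R).
  move=> al; have al0 : (fun m => a m - l) @ \oo --> (0 : R).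
    by rewrite -(subrr l); apply: cvgB al _; exact: cvg_cst.
  by rewrite -(mulr0 (0 : R)); apply: cvgM.
have S : (fun m => \sum_i Re (lam 0 i) * ((Re (u m i 0) - lr i) ^+ 2 + (Im (u m i 0) - li i) ^+ 2))
    @ \oo --> (0 : R).
  have := @cvg_sum_seq _ (index_enum 'I_n) (fun i m =>
    Re (lam 0 i) * ((Re (u m i 0) - lr i) ^+ 2 + (Im (u m i 0) - li i) ^+ 2))
    (fun i => Re (lam 0 i) * (0 + 0)).
  rewrite [X in _ --> X]big1 => [|i _]; last by rewrite addr0 mulr0.
  apply => i; apply: cvgMr; apply: cvgD; first exact: (d0 _ _ (Hr i)).
  exact: (d0 _ _ (Hi i)).
rewrite -(@sqrtr0 R).
rewrite [X in X @ _](_ : _ = @Num.sqrt R \o (fun m => \sum_i Re (lam 0 i) *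
    ((Re (u m i 0) - lr i) ^+ 2 + (Im (u m i 0) - li i) ^+ 2))).
  exact: cvg_comp S (@sqrt_continuous R 0).
apply/funext => m; rewrite nE /=; congr Num.sqrt; apply: eq_bigr => i _.
by rewrite !mxE /sqnorm !raddfB.
Qed.

End FiniteDimensional.

Lemma std_symmetric_form_sesquilinear (R : realType) (X : lmodType R[i])
    (ip : X -> X -> R[i]) :
  sesquilinear_form ip -> sesquilinear_form (std_symmetric_form ip).
Proof.
move=> [bl br]; split=> a [u1 u2] [v1 v2] [w1 w2]; rewrite /std_symmetric_form /=.
  by rewrite !bl; ring.
by rewrite !br; ring.
Qed.

Lemma std_unitary_form_sesquilinear (R : realType) (G1 G2 : lmodType R[i])
    (ip1 : G1 -> G1 -> R[i]) (ip2 : G2 -> G2 -> R[i]) :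
  sesquilinear_form ip1 -> sesquilinear_form ip2 ->
  sesquilinear_form (std_unitary_form ip1 ip2).
Proof.
move=> [bl br] [cl cr]; split=> a [u1 u2] [v1 v2] [w1 w2]; rewrite /std_unitary_form /=.
  by rewrite bl cl; ring.
by rewrite br cr; ring.
Qed.

Theorem lemma6p1 (R : realType) (np nm : nat) (hd : (0 < np + nm)%N)
    (P1 P0 : 'M[R[i]]_(np + nm))
    (hP1 : P1^t* = P1) (uP1 : P1 \in unitmx) (hP0 : P0^t* = - P0)
    (H : R -> 'M[R[i]]_(np + nm)) (hH : hamiltonian_density H)
    (hA : ph_maps_into hH P1 P0)
    (S : 'M[R[i]]_(np + nm)) (hS : S \is unitarymx)
    (lam : 'rV[R[i]]_np) (theta : 'rV[R[i]]_nm)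
    (hlam : forall k, 0 < lam 0 k) (htheta : forall j, 0 < theta 0 j)
    (hdiag : P1 = S^t* *m block_mx (diag_mx lam) 0 0 (- diag_mx theta) *m S) :
  boundary_system (L2H_ip hH) (ph_graph hH P1 P0)
    (std_symmetric_form (L2H_ip hH))
    (hform (diag_mx lam)) (hform (diag_mx theta))
    (boundary_map hH S)
    (std_unitary_form (hform (diag_mx lam)) (hform (diag_mx theta))).
Proof.
(* With this invariance the operator is exactly the maximal one restricted to boundary value 0. *)
have P1X := invmx_invariant uP1 (in_L2H_lin hH) (in_L2H_mul_P1 hA).
have uS : S \in unitmx by exact: unitarymx_unit.
split.
- exact: ph_graph_linear.
- exact: ph_graph_dense.
- exact: ph_graph_closed.
- exact: ph_graph_skew.
- exact: diag_hilbert_space.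
- exact: diag_hilbert_space.
- exact/std_symmetric_form_sesquilinear/L2H_ip_sesquilinear.
- by apply: std_unitary_form_sesquilinear; exact: hform_sesquilinear.
- move=> a p q; exact: boundary_map_linear.
- move=> g; exact: boundary_map_surjective.
- move=> p q; exact: boundary_map_identity.
Qed.
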